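(* Let $\Lambda$ be a finitely aligned $k$-graph. If $C^*(\Lambda)$ is AF (approximately finite-dimensional), then $\Lambda$ contains no generalised cycles.
   Context: Let $\mathbb N=\{0,1,2,\dots\}$ and $k\ge 1$; order $\mathbb N^k$ coordinatewise, with $m\vee n$ the coordinatewise maximum. A $k$-graph is a countable small category $\Lambda$ with a functor $d:\Lambda\to\mathbb N^k$ (the degree) satisfying the factorisation property: if $d(\lambda)=m+n$ then there are unique $\mu,\nu\in\Lambda$ with $d(\mu)=m$, $d(\nu)=n$, $\lambda=\mu\nu$. Put $\Lambda^n=d^{-1}(n)$. Elements of $\Lambda^0$ are the identity morphisms, identified with the objects and called vertices; $r,s:\Lambda\to\Lambda^0$ are the codomain and domain maps, so $\mu\nu$ is defined when $s(\mu)=r(\nu)$. For $v\in\Lambda^0$ and $E\subseteq\Lambda$, $vE=\{\lambda\in E: r(\lambda)=v\}$ and $Ev=\{\lambda\in E: s(\lambda)=v\}$. For $\mu,\nu\in\Lambda$, $\mathrm{MCE}(\mu,\nu)$ is the set of $\lambda\in\Lambda$ with $d(\lambda)=d(\mu)\vee d(\nu)$ and $\lambda=\mu\mu'=\nu\nu'$ for some $\mu',\nu'\in\Lambda$. $\Lambda$ is finitely aligned if $\mathrm{MCE}(\mu,\nu)$ is finite (possibly empty) for all $\mu,\nu$. A set $F\subseteq v\Lambda$ is exhaustive if for every $\lambda\in v\Lambda$ there is $\mu\in F$ with $\mathrm{MCE}(\lambda,\mu)\ne\emptyset$. For finitely aligned $\Lambda$, $C^*(\Lambda)$ is the universal $C^*$-algebra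 generated by a Cuntz–Krieger $\Lambda$-family $\{s_\lambda:\lambda\in\Lambda\}$, i.e. elements such that (CK1) the $s_v$, $v\in\Lambda^0$, are mutually orthogonal projections; (CK2) $s_\mu s_\nu=s_{\mu\nu}$ when $s(\mu)=r(\nu)$; (CK3) $s_\mu^*s_\nu=\sum_{\mu\alpha=\nu\beta\in\mathrm{MCE}(\mu,\nu)}s_\alpha s_\beta^*$ for all $\mu,\nu$; (CK4) $\prod_{\lambda\in E}(s_v-s_\lambda s_\lambda^* )=0$ for all $v\in\Lambda^0$ and finite exhaustive $E\subseteq v\Lambda$. A generalised cycle in a finitely aligned $k$-graph $\Lambda$ is a pair $(\mu,\nu)\in\Lambda\times\Lambda$ such that $\mu\ne\nu$, $s(\mu)=s(\nu)$, $r(\mu)=r(\nu)$, and $\mathrm{MCE}(\mu\tau,\nu)\ne\emptyset$ for all $\tau\in s(\mu)\Lambda$. *)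

(* Defs.v *)
From HB Require Import structures.
From mathcomp Require Import all_boot all_order all_algebra.
From mathcomp Require Import finmap complex.
From mathcomp Require Import all_classical all_reals all_analysis.

Set Implicit Arguments.
Unset Strict Implicit.
Unset Printing Implicit Defensive.

Import Order.TTheory GRing.Theory Num.Theory.
Import numFieldNormedType.Exports.

Local Open Scope classical_set_scope.
Local Open Scope ring_scope.

Definition degree (k : nat) := {ffun 'I_k -> nat}.

Definition degree_join (k : nat) (m n : degree k) : degree k :=
  [ffun i => maxn (m i) (n i)].

(** The category is presented by its morphisms only: an object is identified
    with its identity morphism, [kg_r] and [kg_s] send a morphism to the
    identity at its codomain and domain, and [kg_comp mu nu] is meaningful only
    when [kg_s mu = kg_r nu] (its value is unconstrained otherwise). *)
Record kgraph (k : nat) : Type := KGraph {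
  kg_mor :> countType;
  kg_r : kg_mor -> kg_mor;
  kg_s : kg_mor -> kg_mor;
  kg_comp : kg_mor -> kg_mor -> kg_mor;
  kg_d : kg_mor -> degree k;
  kg_rr : forall l, kg_r (kg_r l) = kg_r l;
  kg_sr : forall l, kg_s (kg_r l) = kg_r l;
  kg_rs : forall l, kg_r (kg_s l) = kg_s l;
  kg_ss : forall l, kg_s (kg_s l) = kg_s l;
  kg_r_comp : forall m n, kg_s m = kg_r n -> kg_r (kg_comp m n) = kg_r m;
  kg_s_comp : forall m n, kg_s m = kg_r n -> kg_s (kg_comp m n) = kg_s n;
  kg_comp_id_l : forall l, kg_comp (kg_r l) l = l;
  kg_comp_id_r : forall l, kg_comp l (kg_s l) = l;
  kg_compA : forall l m n, kg_s l = kg_r m -> kg_s m = kg_r n ->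
    kg_comp l (kg_comp m n) = kg_comp (kg_comp l m) n;
  kg_d_id : forall l, kg_d (kg_r l) = 0;
  kg_d_comp : forall m n, kg_s m = kg_r n ->
    kg_d (kg_comp m n) = kg_d m + kg_d n;
  kg_factorisation : forall l (m n : degree k), kg_d l = m + n ->
    exists! p : kg_mor * kg_mor,
      [/\ kg_d p.1 = m, kg_d p.2 = n, kg_s p.1 = kg_r p.2
        & l = kg_comp p.1 p.2]
}.

Section KGraphTheory.
Variables (k : nat) (L : kgraph k).
Implicit Types (l mu nu v : L).

Definition vertices : set L := [set v | kg_d v = 0].

Lemma verticesP v : vertices v <-> kg_r v = v.
Proof.
split=> [dv|<-]; last exact: kg_d_id.
have [p [_ pU]] : exists! p : L * L, [/\ kg_d p.1 = 0, kg_d p.2 = 0,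
    kg_s p.1 = kg_r p.2 & v = kg_comp p.1 p.2].
  by apply: kg_factorisation; rewrite dv addr0.
have h1 : p = (kg_r v, v).
  by apply: pU; split; rewrite /= ?kg_d_id ?kg_sr ?kg_comp_id_l.
have ds : kg_d (kg_s v) = 0 by rewrite -(kg_rs v) kg_d_id.
have h2 : p = (v, kg_s v).
  by apply: pU; split; rewrite /= ?kg_rs ?kg_comp_id_r.
by move: h1; rewrite h2 => -[<- _].
Qed.

Definition MCE mu nu : set L := [set l |
  [/\ kg_d l = degree_join (kg_d mu) (kg_d nu),
      exists2 mu', kg_s mu = kg_r mu' & l = kg_comp mu mu'
    & exists2 nu', kg_s nu = kg_r nu' & l = kg_comp nu nu']].

Definition finitely_aligned : Prop := forall mu nu, finite_set (MCE mu nu).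

Definition exhaustive v (F : set L) : Prop :=
  F `<=` [set l | kg_r l = v] /\
  forall l, kg_r l = v -> exists2 mu, F mu & MCE l mu !=set0.

Definition MCE_pairs mu nu : set (L * L) := [set p |
  [/\ kg_s mu = kg_r p.1, kg_s nu = kg_r p.2,
      kg_comp mu p.1 = kg_comp nu p.2 & MCE mu nu (kg_comp mu p.1)]].

Definition generalised_cycle mu nu : Prop :=
  [/\ mu <> nu, kg_s mu = kg_s nu, kg_r mu = kg_r nu
    & forall t, kg_r t = kg_s mu -> MCE (kg_comp mu t) nu !=set0].

End KGraphTheory.

(** C*-algebras are not assumed unital, which rules out [pzRingType]. The norm
    takes its values in the nonnegative (hence real) elements of [R[i]]. *)
HB.mixin Record CompleteNormedModule_isCStarAlgebra (R : realType) A
    of CompleteNormedModule R[i] A := {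
  cmul : A -> A -> A;
  cadj : A -> A;
  cmulA : associative cmul;
  cmulDl : left_distributive cmul +%R;
  cmulDr : right_distributive cmul +%R;
  cscalerAl : forall (c : R[i]) x y, c *: cmul x y = cmul (c *: x) y;
  cscalerAr : forall (c : R[i]) x y, c *: cmul x y = cmul x (c *: y);
  cadjK : involutive cadj;
  cadjD : {morph cadj : x y / x + y};
  cadjZ : forall (c : R[i]) x, cadj (c *: x) = Num.conj c *: cadj x;
  cadjM : forall x y, cadj (cmul x y) = cmul (cadj y) (cadj x);
  cnormM : forall x y, `|cmul x y| <= `|x| * `|y|;
  cnorm_adjM : forall x, `|cmul (cadj x) x| = `|x| ^+ 2
}.

#[short(type="cstarAlgType")]
HB.structure Definition CStarAlgebra (R : realType) :=
  {A of CompleteNormedModule R[i] A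
      & CompleteNormedModule_isCStarAlgebra R A}.

Section CStarTheory.
Variables (R : realType) (A : cstarAlgType R).

Definition cstar_subalgebra (S : set A) : Prop :=
  closed S /\
  [/\ S 0, forall x y, S x -> S y -> S (x + y),
      forall (c : R[i]) x, S x -> S (c *: x),
      forall x y, S x -> S y -> S (cmul x y)
    & forall x, S x -> S (cadj x)].

(** For a linear subspace [S], being contained in the span of finitely many
    vectors of [A] is the same as having finite dimension. *)
Definition finite_dimensional (S : set A) : Prop :=
  exists (n : nat) (b : 'I_n -> A),
    forall x, S x -> exists c : 'I_n -> R[i], x = \sum_(i < n) c i *: b i.

Definition AF : Prop :=
  exists F : nat -> set A,
    [/\ forall n, cstar_subalgebra (F n),
        forall n, finite_dimensional (F n),
        forall n, F n `<=` F n.+1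
      & closure (\bigcup_n F n) = setT].

Definition generates (T : Type) (s : T -> A) : Prop :=
  forall S : set A, cstar_subalgebra S -> (forall t, S (s t)) -> S = setT.

End CStarTheory.

Definition star_hom (R : realType) (A B : cstarAlgType R)
    (f : {linear A -> B}) : Prop :=
  {morph f : x y / cmul x y} /\ {morph f : x / cadj x}.

(** In [ck4] the unit of the corner [s_v A s_v], namely [s v], serves as the
    empty product. It changes nothing: an exhaustive [E] is non-empty, and
    every factor [s_v - s_l s_l^*] is fixed by multiplication by [s_v].
    The factors commute by the other relations, so the order in which the finite set
    [E] is enumerated is irrelevant.
    The sum in [ck3] is over a finite set whenever [L] is finitely aligned. *)
Record CK_family (k : nat) (L : kgraph k) (R : realType) (A : cstarAlgType R)
    (s : L -> A) : Prop := {
  ck1_proj : forall v, vertices v -> cadj (s v) = s v /\ cmul (s v) (s v) = s v;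
  ck1_orth : forall v w, vertices v -> vertices w -> v <> w ->
    cmul (s v) (s w) = 0;
  ck2 : forall mu nu : L, kg_s mu = kg_r nu ->
    cmul (s mu) (s nu) = s (kg_comp mu nu);
  ck3 : forall mu nu : L,
    cmul (cadj (s mu)) (s nu) =
    \sum_(p \in MCE_pairs mu nu) cmul (s p.1) (cadj (s p.2));
  ck4 : forall (v : L) (E : {fset L}), vertices v -> exhaustive v [set` E] ->
    \big[@cmul R A/s v]_(l <- E) (s v - cmul (s l) (cadj (s l))) = 0
}.

(** This determines [(A, s)] up to isomorphism. The homomorphism [f] is unique
    because [s] generates [A] and *-homomorphisms are contractive. *)
Definition is_graph_cstar_algebra (k : nat) (L : kgraph k) (R : realType)
    (A : cstarAlgType R) (s : L -> A) : Prop :=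
  [/\ CK_family s, generates s
    & forall (B : cstarAlgType R) (t : L -> B), CK_family t ->
        exists2 f : {linear A -> B}, star_hom f & forall l, f (s l) = t l].

(* Main.v *)
(** Let [(mu, nu)] be a generalised cycle and put [p = s_mu s_mu^*],
    [q = s_nu s_nu^*], [V = s_mu s_nu^*].  The finite set of all [alpha] with
    [mu alpha] in [MCE(mu, nu)] is exhaustive, and (CK4) for this set gives
    [p <= q]; hence [1 + (V - q)] is an isometry.  In a finite-dimensional
    algebra a left invertible element is invertible, so an AF algebra has no
    proper isometries and [p = q].  Now [1 + (V - q)] is unitary, and
    [d(mu) <> d(nu)], so for some coordinate circle of the gauge action [V] is
    homogeneous of degree [n <> 0].  Approximate [1 + (V - q)] by an invertible
    [1 + x] with [x] in a finite-dimensional subalgebra, and join [1 + x] to [1]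
    by invertibles there.  The gauge action turns this path into a contraction of
    the loop [z |-> 1 + (z^n V - q)], all of which is approximated inside one
    finite-dimensional subalgebra [F]; but there the determinant of left
    multiplication on [F] has winding number [n r], where [r >= 1] is the rank of
    an idempotent close to [q].  Winding numbers are detected by roots: a
    contractible loop in the nonzero complex numbers has continuous [2^k]-th
    roots for all [k], and [c z^s] has none if [0 < s < 2^k].

    That [q <> 0] in the universal algebra is seen by representing it on the
    Hilbert space of an orbit of ultrafilters of paths. *)

Require Import Defs.
From HB Require Import structures.
From mathcomp Require Import all_boot all_order all_algebra.
From mathcomp Require Import finmap complex.
From mathcomp Require Import all_classical all_reals all_analysis.
From mathcomp Require Import ring lra.

Set Implicit Arguments.
Unset Strict Implicit.
Unset Printing Implicit Defensive.

Import Order.TTheory GRing.Theory Num.Theory.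
Import numFieldNormedType.Exports.

Local Open Scope classical_set_scope.
Local Open Scope ring_scope.

(** * Norms and completeness *)

(** The algebra need not have a unit, so [1 + x] is only a left action [v |-> v + x v]; products
    become [x + y + x y], and invertibility is measured by a bound [k |v| <= |v + x v|]. Such bounds
    survive perturbation and hold for all [v] of the algebra. So a path built in one
    finite-dimensional subalgebra can be moved by the gauge action, which need not preserve that
    subalgebra, and then be approximated inside another.

    That [1 + (V - q)] is connected to [1] is in itself no contradiction. The gauge action supplies
    a second parameter: up to the fixed factor [1 + (V - q)], the loop is the Bott loop
    [1 + (z^n - 1) q] of the projection [q], and contracting it would force a rank to vanish.

    Determinants are compared through eigenvalues: the eigenvectors are elements of [F], hence
    controlled by the norm of the algebra, and [F] is never split into matrix blocks. The circle is
    sampled by iterated square roots of [-1], so continuity is used only along small rotations, and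
    neither exponential nor argument enters. *)

Section TrivialExtension.
Variables (K : fieldType) (V : lmodType K).

(* The square-zero extension [K + V] is a commutative ring, so that linear
   identities in [V] can be proved by [ring]. *)
Definition trivext : Type := (K * V)%type.
HB.instance Definition _ := GRing.Zmodule.on trivext.

Definition trivext_mul (a b : trivext) : trivext := (a.1 * b.1, a.1 *: b.2 + b.1 *: a.2).

Fact trivext_mulA : associative trivext_mul.
Proof.
move=> a b c; rewrite /trivext_mul /=; congr pair; first exact: mulrA.
by rewrite !scalerDr !scalerA addrA [c.1 * a.1]mulrC [c.1 * b.1]mulrC.
Qed.

Fact trivext_mulC : commutative trivext_mul.
Proof. by move=> a b; rewrite /trivext_mul mulrC addrC. Qed.

Fact trivext_mul1 : left_id ((1, 0) : trivext) trivext_mul.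
Proof. by move=> [a x]; rewrite /trivext_mul /= mul1r scale1r scaler0 addr0. Qed.

Fact trivext_mulD : left_distributive trivext_mul +%R.
Proof.
move=> a b c; rewrite /trivext_mul /=; congr pair; first exact: mulrDl.
by rewrite scalerDl scalerDr addrACA.
Qed.

Fact trivext_1_neq0 : ((1, 0) : trivext) != 0.
Proof. by rewrite xpair_eqE oner_eq0. Qed.

HB.instance Definition _ := GRing.Zmodule_isComNzRing.Build trivext
  trivext_mulA trivext_mulC trivext_mul1 trivext_mulD trivext_1_neq0.

Definition trivext_inj (x : V) : trivext := (0, x).
Definition trivext_scalar (c : K) : trivext := (c, 0).

Lemma trivext_injI : injective trivext_inj.
Proof. by move=> x y []. Qed.

Lemma trivext_inj0 : trivext_inj 0 = 0. Proof. by []. Qed.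
Lemma trivext_injD x y : trivext_inj (x + y) = trivext_inj x + trivext_inj y.
Proof. by rewrite /trivext_inj; congr pair; rewrite addr0. Qed.
Lemma trivext_injN x : trivext_inj (- x) = - trivext_inj x.
Proof. by rewrite /trivext_inj; congr pair; rewrite oppr0. Qed.
Lemma trivext_injZ c x : trivext_inj (c *: x) = trivext_scalar c * trivext_inj x.
Proof. by congr pair; rewrite /= ?mulr0 // scale0r addr0. Qed.
Lemma trivext_scalar1 : trivext_scalar 1 = 1. Proof. by []. Qed.
Lemma trivext_scalarD a b : trivext_scalar (a + b) = trivext_scalar a + trivext_scalar b.
Proof. by congr pair; rewrite addr0. Qed.
Lemma trivext_scalarN a : trivext_scalar (- a) = - trivext_scalar a.
Proof. by congr pair; rewrite oppr0. Qed.
Lemma trivext_scalarM a b : trivext_scalar (a * b) = trivext_scalar a * trivext_scalar b.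
Proof. by congr pair; rewrite /= scaler0 scaler0 addr0. Qed.
Lemma trivext_scalarX a n : trivext_scalar (a ^+ n) = trivext_scalar a ^+ n.
Proof. by elim: n => // n IH; rewrite !exprS trivext_scalarM IH. Qed.
Lemma trivext_scalarn n : trivext_scalar n%:R = n%:R.
Proof. by elim: n => // n IH; rewrite -natr1 trivext_scalarD IH natr1. Qed.

Definition trivextE := (trivext_inj0, trivext_injD, trivext_injN, trivext_injZ,
  trivext_scalarD, trivext_scalarN, trivext_scalarM, trivext_scalarX,
  trivext_scalarn, trivext_scalar1).

End TrivialExtension.

Ltac linear_ring := apply: trivext_injI; rewrite ?trivextE; ring.

Section RealNorm.
Variables (R : realType) (V : normedZmodType R[i]).
Implicit Types x y : V.

(** The norm of a module over [R[i]] is complex-valued; its real part moves all estimates to [R],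
    where [lra] and [nra] apply. *)
Definition nm x : R := complex.Re `|x|.

Lemma normE x : `|x| = real_complex R (nm x).
Proof. by rewrite /nm RRe_real // ger0_real //; apply: normr_ge0. Qed.

Lemma nm_ge0 x : 0 <= nm x.
Proof. by rewrite -lecR -normE; apply: normr_ge0. Qed.

Lemma nm0 : nm 0 = 0.
Proof. by rewrite /nm normr0. Qed.

Lemma nm_eq0 x : nm x = 0 -> x = 0.
Proof. by move=> h; apply/normr0_eq0; rewrite normE h. Qed.

Lemma nmN x : nm (- x) = nm x.
Proof. by rewrite /nm normrN. Qed.

Lemma nmBC x y : nm (x - y) = nm (y - x).
Proof. by rewrite /nm distrC. Qed.

Lemma nmD x y : nm (x + y) <= nm x + nm y.
Proof. by rewrite -lecR rmorphD /= -!normE; apply: ler_normD. Qed.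

Lemma nmB x y : nm (x - y) <= nm x + nm y.
Proof. by rewrite -(nmN y) nmD. Qed.

Lemma nm_leD x y : nm x <= nm (x + y) + nm y.
Proof. by rewrite -{1}(addrK y x) nmB. Qed.

Lemma nm_tri y x z : nm (x - z) <= nm (x - y) + nm (y - z).
Proof. by rewrite -[x - z](subrKA y) nmD. Qed.

Lemma nm_sum (I : Type) (r : seq I) (P : pred I) (F : I -> V) :
  nm (\sum_(i <- r | P i) F i) <= \sum_(i <- r | P i) nm (F i).
Proof.
elim/big_ind2: _ => [|x a y b ha hb|//]; first by rewrite nm0.
by apply: le_trans (nmD _ _) _; apply: lerD.
Qed.

End RealNorm.

Section ScalarNorm.
Variable R : realType.
Implicit Types a b : R[i].

Lemma nmM a b : nm (a * b) = nm a * nm b.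
Proof. by apply/complexI; rewrite rmorphM /= -!normE normrM. Qed.

Lemma nm1 : nm (1 : R[i]) = 1.
Proof. by rewrite /nm normr1. Qed.

Lemma nmX a n : nm (a ^+ n) = nm a ^+ n.
Proof. by elim: n => [|n IH]; rewrite ?expr0 ?nm1 // !exprS nmM IH. Qed.

Lemma nmV a : nm a^-1 = (nm a)^-1.
Proof. by apply/complexI; rewrite fmorphV /= -!normE normfV. Qed.

Lemma nm_conj a : nm (Num.conj a) = nm a.
Proof. by rewrite /nm norm_conjC. Qed.

Lemma nm_real (r : R) : nm (real_complex R r) = `|r|.
Proof. by rewrite /nm normc_def /= expr0n addr0 sqrtr_sqr. Qed.

Lemma nm_gt0 a : (0 < nm a) = (a != 0).
Proof.
rewrite lt_neqAle nm_ge0 andbT eq_sym; congr negb; apply/eqP/eqP => [/nm_eq0//|->].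
exact: nm0.
Qed.

Lemma nmZ (V : normedModType R[i]) a (x : V) : nm (a *: x) = nm a * nm x.
Proof. by apply/complexI; rewrite rmorphM /= -!normE normrZ. Qed.

Lemma nm_unit a : nm a = 1 -> a * Num.conj a = 1.
Proof. by move=> h; rewrite -normCK normE h expr1n. Qed.

End ScalarNorm.

Section Metric.
Variables (R : realType) (V : normedModType R[i]).

Lemma pos_complexP (e : R[i]) : 0 < e -> e = real_complex R (complex.Re e).
Proof. by move=> /gtr0_real/RRe_real ->. Qed.

Lemma nbhs_nmP (x : V) (P : set V) :
  nbhs x P <-> exists2 e : R, 0 < e & forall y, nm (x - y) < e -> P y.
Proof.
split=> [/nbhs_normP [e /= e0 h]|[e e0 h]].
  exists (complex.Re e); first by rewrite -ltcR -pos_complexP.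
  by move=> y yx; apply: h; rewrite /= normE (pos_complexP e0) ltcR.
apply/nbhs_normP; exists (real_complex R e); rewrite /= ?ltcR // => y /=.
by rewrite normE ltcR => /h.
Qed.

Lemma closure_nmP (S : set V) (x : V) :
  closure S x <-> forall e : R, 0 < e -> exists2 y, S y & nm (x - y) <= e.
Proof.
split=> [h e e0|h B /nbhs_nmP [e e0 hB]].
  have [|y [Sy /= ye]] := h [set y | nm (x - y) < e].
    by apply/nbhs_nmP; exists e.
  by exists y => //; apply: ltW.
have [|y Sy ye] := h (e / 2); first lra.
by exists y; split=> //; apply: hB; lra.
Qed.

Lemma closed_nmP (S : set V) :
  (forall x, (forall e : R, 0 < e -> exists2 y, S y & nm (x - y) <= e) -> S x) ->
  closed S.
Proof. by move=> h x /closure_nmP; apply: h. Qed.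

End Metric.

Section Complete.
Variables (R : realType) (V : completeNormedModType R[i]).

Lemma geometric_small (M e : R) : 0 <= M -> 0 < e -> exists n, M / 2 ^+ n < e.
Proof.
move=> M0 e0; have /= := @cvg_expr R 2^-1.
rewrite ger0_norm ?invr_ge0 // => /(_ _)/cvgrPdist_lt.
have e1 : 0 < e / (M + 1) by rewrite divr_gt0 // ; lra.
have h2 : (2 : R)^-1 < 1 by rewrite invf_lt1 // ltr1n.
move=> /(_ h2 _ e1) [n _ /(_ n (leqnn _))] /=.
rewrite sub0r normrN ger0_norm ?exprn_ge0 ?invr_ge0 // exprVn => hn.
exists n; have : 0 < (2 ^+ n : R)^-1 by rewrite invr_gt0 exprn_gt0.
move: hn; rewrite ltr_pdivlMr; last lra.
set t := _^-1; nra.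
Qed.

Lemma geometric_cvg (u : nat -> V) (M : R) :
  (forall n, nm (u n.+1 - u n) <= M / 2 ^+ n) ->
  exists l, forall n, nm (u n - l) <= 2 * M / 2 ^+ n.
Proof.
move=> hu.
have hp (k : nat) : 0 < (2 : R) ^+ k by rewrite exprn_gt0.
have M0 : 0 <= M.
  by have := le_trans (nm_ge0 _) (hu 0%N); rewrite expr0 divr1.
(* The factor [1 - 1 / 2 ^+ m] is the exact geometric partial sum, which makes the induction on [m]
   close. *)
have hm n m : nm (u (n + m)%N - u n) <= 2 * M / 2 ^+ n * (1 - 1 / 2 ^+ m).
  elim: m => [|m IH]; first by rewrite addn0 subrr nm0 expr0 divr1 subrr mulr0.
  apply: le_trans (nm_tri (u (n + m)%N) _ _) _; rewrite addnS.
  have := lerD (hu (n + m)%N) IH; move/le_trans; apply.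
  have := hp n; have := hp m; rewrite exprD exprS => pm pn.
  rewrite le_eqVlt; apply/orP; left; apply/eqP; field.
  by rewrite !lt0r_neq0.
have hm' n m : (n <= m)%N -> nm (u m - u n) <= 2 * M / 2 ^+ n.
  move=> /subnKC <-; apply: le_trans (hm _ _) _.
  rewrite -[leRHS]mulr1; apply: ler_wpM2l.
    by rewrite divr_ge0 ?mulr_ge0 // ltW.
  by rewrite gerBl divr_ge0 // ltW.
have cu : cvgn u.
  apply: cauchy_cvg; apply/cauchy_ballP => e e0.
  have e1 : 0 < complex.Re e by rewrite -ltcR -pos_complexP.
  have e2 : 0 < complex.Re e / 2 by lra.
  have [n hn] := geometric_small (mulr_ge0 (ler0n R 2) M0) e2.
  exists (u @` [set m | (n <= m)%N], u @` [set m | (n <= m)%N]) => /=.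
    by split; exists n => // m /= nm0'; exists m.
  move=> [x y] /= [[a na <-] [b nb <-]]; rewrite -ball_normE /= normE.
  rewrite (pos_complexP e0) ltcR.
  apply: le_lt_trans (nm_tri (u n) _ _) _.
  rewrite [ltRHS]splitr; apply: ltrD; first exact: le_lt_trans (hm' _ _ na) hn.
  by rewrite nmBC; apply: le_lt_trans (hm' _ _ nb) hn.
exists (limn u) => n; rewrite leNgt; apply/negP => hlt.
set l := limn u in hlt.
have [e e0 he] : exists2 e : R, 0 < e & 2 * M / 2 ^+ n + e <= nm (u n - l).
  by by exists (nm (u n - l) - 2 * M / 2 ^+ n); rewrite ?subr_gt0 // addrC subrK.
have : nbhs l [set y | nm (l - y) < e] by apply/nbhs_nmP; exists e.
move=> /cu [m _ /= hm1].
have {hm1} := hm1 (maxn n m) (leq_maxr _ _); rewrite /= => h1.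
have := nm_tri (u (maxn n m)) (u n) l.
have := hm' _ _ (leq_maxl n m).
move: he h1; rewrite [nm (l - _)]nmBC [nm (u n - u _)]nmBC.
set B := 2 * M / _; lra.
Qed.

(** Banach's theorem with ratio 1/2. It takes the place of functional calculus, both for square
    roots and for idempotents near approximate ones. *)
Lemma fixpoint_exists (S : set V) (f : V -> V) :
  closed S -> S !=set0 -> (forall x, S x -> S (f x)) ->
  (forall x y, S x -> S y -> nm (f x - f y) <= nm (x - y) / 2) ->
  exists2 x, S x & f x = x.
Proof.
move=> cS [x0 Sx0] Sf hf.
pose u n := iter n f x0.
have Su n : S (u n) by elim: n => //= n; apply: Sf.
have [|l hl] := @geometric_cvg u (nm (u 1%N - u 0%N)).
  elim=> [|n IH]; first by rewrite expr0 divr1.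
  have := hf _ _ (Su n.+1) (Su n) => /le_trans; apply.
  have hp : 0 < (2 : R) ^+ n by rewrite exprn_gt0.
  apply: le_trans (_ : _ <= _ / 2 ^+ n / 2) _; first by apply: ler_wpM2r IH; rewrite invr_ge0.
  by rewrite exprSr invfM mulrA.
set M := nm _ in hl; have M0 : 0 <= 2 * M by rewrite mulr_ge0 ?nm_ge0.
have Sl : S l.
  apply: cS; apply/closure_nmP => e e0.
  have [n hn] := geometric_small M0 e0.
  by exists (u n) => //; rewrite nmBC; apply: le_trans (hl n) (ltW hn).
exists l => //; apply/subr0_eq/nm_eq0/eqP; rewrite eq_le nm_ge0 andbT.
apply/ler_addgt0Pr => e e0; rewrite add0r; have [|n hn] := @geometric_small _ (e / 2) M0; first lra.
apply: le_trans (nm_tri (u n.+1) _ _) _.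
have h1 := hf _ _ Sl (Su n); have h2 := hl n; have h3 := hl n.+1.
have : 2 * M / 2 ^+ n.+1 <= 2 * M / 2 ^+ n.
  by rewrite ler_wpM2l // lef_pV2 ?posrE ?exprn_gt0 // ler_weXn2l // ler1n.
move: hn h1 h2 h3; rewrite [nm (l - _)]nmBC /=.
set B := _ / 2 ^+ n; set B' := _ / 2 ^+ n.+1; lra.
Qed.

End Complete.

(** * C*-algebras *)

Reserved Notation "a ** b" (at level 40, left associativity).
Local Notation "a ** b" := (cmul a b).

Section CStarAlgebraTheory.
Variables (R : realType) (A : cstarAlgType R).
Implicit Types a b c d x y z : A.

Lemma cmul0l x : 0 ** x = 0.
Proof. by apply: (addrI (0 ** x)); rewrite -cmulDl !addr0. Qed.

Lemma cmul0r x : x ** 0 = 0.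
Proof. by apply: (addrI (x ** 0)); rewrite -cmulDr !addr0. Qed.

Lemma cmulNl x y : (- x) ** y = - (x ** y).
Proof. by apply: (addrI (x ** y)); rewrite -cmulDl !subrr cmul0l. Qed.

Lemma cmulNr x y : x ** (- y) = - (x ** y).
Proof. by apply: (addrI (x ** y)); rewrite -cmulDr !subrr cmul0r. Qed.

Lemma cmulBl x y z : (x - y) ** z = x ** z - y ** z.
Proof. by rewrite cmulDl cmulNl. Qed.

Lemma cmulBr x y z : z ** (x - y) = z ** x - z ** y.
Proof. by rewrite cmulDr cmulNr. Qed.

Lemma cmulZl (k : R[i]) x y : (k *: x) ** y = k *: (x ** y).
Proof. by rewrite cscalerAl. Qed.

Lemma cmulZr (k : R[i]) x y : x ** (k *: y) = k *: (x ** y).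
Proof. by rewrite cscalerAr. Qed.

Definition cmulE :=
  (cmul0l, cmul0r, @cmulDl R A, @cmulDr R A, cmulNl, cmulNr, cmulZl, cmulZr,
   @cmulA R A).

Lemma cmul_sumr (I : Type) (r : seq I) (P : pred I) (F : I -> A) x :
  x ** (\sum_(i <- r | P i) F i) = \sum_(i <- r | P i) x ** F i.
Proof. by apply: (big_morph (cmul x)) => [u v|]; rewrite ?cmulDr ?cmul0r. Qed.

Lemma cadj0 : cadj 0 = 0 :> A.
Proof. by apply: (addrI (cadj 0)); rewrite -cadjD !addr0. Qed.

Lemma cadjN x : cadj (- x) = - cadj x.
Proof. by apply: (addrI (cadj x)); rewrite -cadjD !subrr cadj0. Qed.

Lemma cadjB x y : cadj (x - y) = cadj x - cadj y.
Proof. by rewrite cadjD cadjN. Qed.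

Lemma nm_cmul x y : nm (x ** y) <= nm x * nm y.
Proof. by rewrite -lecR rmorphM /= -!normE; apply: cnormM. Qed.

Lemma nm_cstar x : nm (cadj x ** x) = nm x ^+ 2.
Proof. by apply/complexI; rewrite rmorphXn /= -!normE; apply: cnorm_adjM. Qed.

Lemma nm_adj x : nm (cadj x) = nm x.
Proof.
have le y : nm y <= nm (cadj y).
  have [->|y0] := eqVneq (nm y) 0; first exact: nm_ge0.
  have yp : 0 < nm y by rewrite lt_neqAle eq_sym y0 nm_ge0.
  by rewrite -(ler_pM2r yp) -expr2 -nm_cstar nm_cmul.
by apply/eqP; rewrite eq_le le -{2}(cadjK x) le.
Qed.

Lemma nm_eq_of_cstar x y : cadj x ** x = cadj y ** y -> nm x = nm y.
Proof.
move=> h; have := congr1 (@nm R A) h; rewrite !nm_cstar => /eqP.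
by rewrite eqrXn2 ?nm_ge0 // => /eqP.
Qed.

Lemma closed_kernel (f : A -> A) (K : R) :
  (forall x y, nm (f x - f y) <= K * nm (x - y)) -> closed [set x | f x = 0].
Proof.
move=> lf; apply: closed_nmP => x hx /=; apply/nm_eq0/eqP.
rewrite eq_le nm_ge0 andbT; apply/ler_addgt0Pr => e e0; rewrite add0r.
have K0 : 0 < `|K| + 1 by rewrite ltr_wpDl.
have [|y fy yx] := hx (e / (`|K| + 1)); first by rewrite divr_gt0.
have := lf x y; rewrite fy subr0 => /le_trans; apply.
apply: (@le_trans _ _ ((`|K| + 1) * nm (x - y))); last first.
  by rewrite mulrC -ler_pdivlMr.
by apply: ler_wpM2r; rewrite ?nm_ge0 // (le_trans (ler_norm K)) // lerDl.
Qed.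

Lemma closed_nm_ball (r : R) : closed [set x : A | nm x <= r].
Proof.
apply: closed_nmP => x hx /=; apply/ler_addgt0Pr => e e0.
have [y yr xy] := hx _ e0; apply: le_trans (nm_leD x (- y)) _.
by rewrite nmN addrC; apply: lerD.
Qed.

Lemma closed_selfadj : closed [set x : A | cadj x = x].
Proof.
have -> : [set x : A | cadj x = x] = [set x | cadj x - x = 0].
  by apply/seteqP; split => x /= [h]; [rewrite h subrr|apply/subr0_eq].
apply: (@closed_kernel _ 2) => x y.
rewrite opprD opprK addrACA -cadjB [- x + y]addrC.
by apply: le_trans (nmD _ _) _; rewrite nm_adj mulrDl mul1r [nm (y - x)]nmBC.
Qed.

Lemma closed_commutant b : closed [set x | b ** x = x ** b].
Proof.
have -> : [set x : A | b ** x = x ** b] = [set x | b ** x - x ** b = 0].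
  by apply/seteqP; split => x /= [h]; [rewrite h subrr|apply/subr0_eq].
apply: (@closed_kernel _ (2 * nm b)) => x y.
rewrite opprD opprK addrACA -cmulBr [- _ + _]addrC -cmulBl.
apply: le_trans (nmD _ _) _; rewrite -mulrA mulrDl mul1r; apply: lerD.
  exact: nm_cmul.
by rewrite mulrC nmBC; apply: nm_cmul.
Qed.

(* [1 + c] is the square root of [1 - b ^ 2]. *)
Lemma sqrt_one_sub_sqr b : cadj b = b -> nm b <= 1 / 2 ->
  exists2 c, cadj c = c /\ b ** c = c ** b & c + c + c ** c = - (b ** b).
Proof.
move=> bs bh.
pose h : R[i] := real_complex R (1 / 2).
(* A fixed point [c = -(b^2 + c^2)/2] satisfies [(1 + c)^2 = 1 - b^2]. On the ball of radius 1/2 the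
   map contracts by 1/2, since [x^2 - y^2 = x (x - y) + (x - y) y]. *)
pose f c := - (h *: (b ** b + c ** c)).
have hE : h + h = 1 by rewrite -rmorphD /= -splitr.
have nh x : nm (h *: x) = nm x / 2.
  by rewrite nmZ nm_real ger0_norm // mulrC; congr (_ * _); rewrite div1r.
have sq_le c : nm c <= 1 / 2 -> nm (c ** c) <= 1 / 4.
  by move=> ch; apply: le_trans (nm_cmul _ _) _; have := nm_ge0 c; nra.
have [||c [[ch cs] cc]|x y [[xh _] _] [[yh _] _]|c [[_ cs] cc] cf] :=
  @fixpoint_exists _ A ([set c | nm c <= 1 / 2] `&` [set c | cadj c = c] `&`
   [set c | b ** c = c ** b]) f.
- apply: closedI (@closed_commutant _); apply: closedI.
    exact: closed_nm_ball.
  exact: closed_selfadj.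
- by exists 0; split; [split|]; rewrite /= ?nm0 ?cadj0 ?cmul0l ?cmul0r.
- rewrite /= in ch cs cc *; split; [split|]; rewrite /f.
  + rewrite nmN nh; have := nmD (b ** b) (c ** c).
    by have := sq_le _ ch; have := sq_le _ bh; lra.
  + rewrite cadjN cadjZ cadjD !cadjM bs cs; congr (- (_ *: _)).
    by apply: conj_Creal; apply/complex_realP; exists (1 / 2).
  + rewrite cmulNl cmulNr -cscalerAl -cscalerAr cmulDl cmulDr cmulA.
    by congr (- (_ *: (_ + _))); rewrite cmulA cc -cmulA cc cmulA.
- rewrite /= in xh yh; rewrite /f opprK addrC -scalerBr.
  rewrite opprD addrACA subrr add0r nh nmBC; apply: ler_wpM2r; first by rewrite invr_ge0.
  have -> : x ** x - y ** y = x ** (x - y) + (x - y) ** y.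
    by rewrite cmulBl cmulBr subrKA.
  apply: le_trans (nmD _ _) _.
  have := nm_cmul x (x - y); have := nm_cmul (x - y) y.
  by have := nm_ge0 (x - y); nra.
exists c => //; rewrite -{1 2}cf /f -opprD -scalerDl hE scale1r.
by rewrite opprD subrK.
Qed.

(** With [1 + d] a square root of [1 - b^2] and [j] one of the two square roots of -1,
    [b + j (1 + d)] is unitary; only its left action is available without a unit. *)
Lemma isometry_of_sqr b d x : cadj b = b -> cadj d = d -> b ** d = d ** b ->
  d + d + d ** d = - (b ** b) ->
  forall j : R[i], j * j = -1 -> Num.conj j = - j ->
  nm (b ** x + j *: (x + d ** x)) = nm x.
Proof.
move=> bs ds bd dd j j2 jc; apply: nm_eq_of_cstar.
set u := b ** x; set w := x + d ** x.
have us : cadj u = cadj x ** b by rewrite cadjM bs.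
have ws : cadj w = cadj x + cadj x ** d by rewrite cadjD cadjM ds.
rewrite cadjD cadjZ jc scaleNr cmulDr !cmulBl -!cscalerAl -!cscalerAr !scalerA.
rewrite j2 scaleN1r opprK.
have -> : cadj w ** u = cadj u ** w.
  by rewrite us ws /u /w cmulDl cmulDr -!cmulA [d ** (b ** x)]cmulA -bd -!cmulA.

rewrite subrKA us ws cmulDl -!cmulA -!cmulDr; congr (_ ** _).
have e : d ** x + (d ** x + d ** (d ** x)) = - (b ** (b ** x)).
  by rewrite [d ** (d ** x)]cmulA -!cmulDl addrA dd cmulNl cmulA.
by rewrite /u /w cmulDr -[x + _ + _]addrA e addrCA subrr addr0.
Qed.

End CStarAlgebraTheory.

Ltac cstar_ring := rewrite ?cmulE; linear_ring.

(** * Contractivity of star-homomorphisms *)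

Section StarHom.
Variables (R : realType) (A B : cstarAlgType R).

(** The image of [b] is the mean of the two unitaries [f b + j (1 + f d)], [j = i] and [j = -i],
    hence a contraction. The square root is taken in [A] and carried over by [f]. *)
Lemma nm_real_contraction (f : {linear A -> B}) (b : A) :
  star_hom f -> cadj b = b -> nm b <= 1 / 2 -> nm (f b) <= 1.
Proof.
move=> [fM fs] bs /(sqrt_one_sub_sqr bs) [d [ds bd] dd].
pose b' := f b; pose d' := f d.
have bs' : cadj b' = b' by rewrite /b' -fs bs.
have ds' : cadj d' = d' by rewrite /d' -fs ds.
have bd' : b' ** d' = d' ** b' by rewrite /b' /d' -!fM bd.
have dd' : d' + d' + d' ** d' = - (b' ** b').
  by rewrite /b' /d' -!fM -raddfN -dd !raddfD.
have i2 : ('i : R[i]) * 'i = -1 by rewrite -expr2 sqrCi.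
have key (x : B) : nm (b' ** x) <= nm x.
  have e1 := isometry_of_sqr x bs' ds' bd' dd' i2 (conjCi _).
  have e2 : nm (b' ** x + (- 'i) *: (x + d' ** x)) = nm x.
    apply: isometry_of_sqr => //; first by rewrite mulrNN.
    by rewrite rmorphN /= conjCi.
  have := nmD (b' ** x + 'i *: (x + d' ** x)) (b' ** x + (- 'i) *: (x + d' ** x)).
  rewrite e1 e2 addrACA -scalerDl subrr scale0r addr0.
  rewrite -[b' ** x in X in X -> _]scale1r -scalerDl nmZ.
  have -> : (1 + 1 : R[i]) = real_complex R 2 by rewrite rmorphD.
  by rewrite nm_real ger0_norm //; lra.
have := key b'; rewrite -{1}bs' nm_cstar; have := nm_ge0 b'.
by rewrite -/b'; nra.
Qed.

(** Scaling the previous bound gives [|f b| <= 2 |b|] for self-adjoint [b]. Applied to [b^(2^n)],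
    where the norm is multiplicative by the C*-identity, it shows that the factor 2 is lost in the
    limit; a general [x] is reduced to [x^* x]. *)
Lemma nm_star_hom (f : {linear A -> B}) (x : A) :
  star_hom f -> nm (f x) <= nm x.
Proof.
move=> hf.
have bound (b : A) : cadj b = b -> nm (f b) <= 2 * nm b.
  move=> bs; have [->|b0] := eqVneq b 0; first by rewrite raddf0 !nm0 mulr0.
  have nb : 0 < nm b.
    rewrite lt_neqAle nm_ge0 andbT eq_sym; apply/eqP => /nm_eq0 h.
    by rewrite h eqxx in b0.
  pose t := (2 * nm b)^-1.
  have t0 : 0 < t by rewrite invr_gt0; lra.
  have := @nm_real_contraction f (real_complex R t *: b) hf.
  rewrite cadjZ bs linearZ /= !nmZ nm_real gtr0_norm // => h.
  have : t * nm (f b) <= 1.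
    apply: h; first by rewrite conj_Creal //; apply/complex_realP; exists t.
    by rewrite /t ler_pdivrMl; lra.
  by rewrite mulrC ler_pdivrMr ?mul1r //; lra.
have pow (b : A) n : cadj b = b -> nm (f b) ^+ (2 ^ n) <= 2 * nm b ^+ (2 ^ n).
  elim: n b => [|n IH] b bs; first exact: bound.
  have := IH (b ** b); rewrite cadjM bs => /(_ erefl).
  have [fM fs] := hf.
  have e1 : nm (f (b ** b)) = nm (f b) ^+ 2 by rewrite fM -{1}bs fs nm_cstar.
  have e2 : nm (b ** b) = nm b ^+ 2 by rewrite -{1}bs nm_cstar.
  by rewrite e1 e2 -!exprM -expnS.
have sa (b : A) : cadj b = b -> nm (f b) <= nm b.
  move=> bs; rewrite leNgt; apply/negP => lt.
  have t0 : 0 < nm (f b) by apply: le_lt_trans lt; apply: nm_ge0.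
  have q0 : 0 <= nm b / nm (f b) by rewrite divr_ge0 ?nm_ge0.
  have q1 : `|nm b / nm (f b)| < 1.
    by rewrite ger0_norm // ltr_pdivrMr // mul1r.
  have /cvgrPdist_lt /(_ (1 / 2)) [|n _ hn] := cvg_expr q1; first lra.
  have := hn (2 ^ n)%N (ltnW (ltn_expl n (ltnSn 1))); rewrite /= sub0r normrN.
  rewrite ger0_norm ?exprn_ge0 // expr_div_n ltr_pdivrMr ?exprn_gt0 //.
  by have := pow b n bs; lra.
have [fM fs] := hf.
rewrite -(@ler_pXn2r _ 2) ?nnegrE ?nm_ge0 // -!nm_cstar -fs -fM.
by apply: sa; rewrite cadjM cadjK.
Qed.

End StarHom.

(** * Determinants in finite-dimensional subalgebras *)

(** [l] lists the roots of the characteristic polynomial with multiplicity: for [w != 0],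
    [1 + w K = (-w) (-1/w - K)], so the determinant is that polynomial at [-1/w] times [(-w)^n]. *)
Lemma det_one_add_eigenvalues (C : numClosedFieldType) (n : nat) (K : 'M[C]_n) :
  exists l : seq C, [/\ size l = n,
    forall a, a \in l -> exists2 v : 'rV_n, v *m K = a *: v & v != 0
    & forall w, \det (1%:M + w *: K) = \prod_(a <- l) (1 + w * a)].
Proof.
have [l hl] := closed_field_poly_normal (char_poly K).
rewrite (monicP (char_poly_monic K)) scale1r in hl.
have sl : size l = n.
  by have := congr1 (size : {poly C} -> nat) hl;
     rewrite size_char_poly size_prod_XsubC => -[].
have ev a : (char_poly K).[a] = \det (a%:M - K).
  rewrite -horner_evalE /char_poly -det_map_mx; congr (\det _).
  apply/matrixP => i j; rewrite !mxE /= horner_evalE !hornerE hornerMn.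
  by rewrite hornerX.
exists l; split=> // [a al|w].
  apply/eigenvalueP; rewrite eigenvalue_root_char hl.
  by rewrite root_prod_XsubC.
have [->|w0] := eqVneq w 0.
  rewrite scale0r addr0 det1 big1_seq // => a _.
  by rewrite mul0r addr0.
have -> : 1%:M + w *: K = (- w) *: ((- w^-1)%:M - K).
  by rewrite scalerBr scale_scalar_mx mulrNN mulfV // scaleNr opprK.
rewrite detZ -ev hl horner_prod -{1}sl.
elim: l {hl sl} => [|a l IH]; first by rewrite !big_nil expr0 mul1r.
rewrite !big_cons /= exprS -IH mulrACA; congr (_ * _).
by rewrite !hornerE mulrDr mulrNN mulfV // mulrNN.
Qed.

Section FiniteDimensional.
Variables (R : realType) (A : cstarAlgType R) (F : set A).
Hypotheses (subF : cstar_subalgebra F) (fdF : finite_dimensional F).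
Let C := R[i].
Implicit Types (x y v : A).

Let F0 : F 0. Proof. by have [_ []] := subF. Qed.
Let FD x y : F x -> F y -> F (x + y). Proof. by have [_ [_ h _ _ _]] := subF; apply: h. Qed.
Let FZ (c : C) x : F x -> F (c *: x). Proof. by have [_ [_ _ h _ _]] := subF; apply: h. Qed.
Let FM x y : F x -> F y -> F (x ** y). Proof. by have [_ [_ _ _ h _]] := subF; apply: h. Qed.

Definition lincomb n (e : 'I_n -> A) (c : 'rV[C]_n) : A := \sum_j c 0 j *: e j.

Lemma lincombD n (e : 'I_n -> A) c c' : lincomb e (c + c') = lincomb e c + lincomb e c'.
Proof.
by rewrite /lincomb -big_split; apply: eq_bigr => j _; rewrite mxE scalerDl.
Qed.

Lemma lincombZ n (e : 'I_n -> A) a c : lincomb e (a *: c) = a *: lincomb e c.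
Proof.
by rewrite /lincomb scaler_sumr; apply: eq_bigr => j _; rewrite mxE scalerA.
Qed.

Lemma lincomb_mulmx m n (e : 'I_n -> A) (B : 'M[C]_(m, n)) c :
  lincomb e (c *m B) = lincomb (fun i => lincomb e (row i B)) c.
Proof.
rewrite /lincomb; under eq_bigr do rewrite mxE scaler_suml.
rewrite exchange_big; apply: eq_bigr => i _; rewrite scaler_sumr.
by apply: eq_bigr => j _; rewrite scalerA mxE.
Qed.

(** The vectors given by [finite_dimensional] may lie outside [F], so a basis is a free family in
    [F] of maximal length. The length is bounded because the coordinate matrix of a longer family
    has a non-trivial left kernel. *)
Lemma basis_exists : exists r (e : 'I_r -> A), [/\ forall j, F (e j),
  forall x, F x -> exists c, x = lincomb e c
  & forall c, lincomb e c = 0 -> c = 0].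
Proof.
have [n [b hb]] := fdF.
pose Q r (e : 'I_r -> A) := (forall j, F (e j)) /\ forall c, lincomb e c = 0 -> c = 0.
pose P r := `[< exists e, @Q r e >].
have P0 : exists r, P r.
  by exists 0%N; apply/asboolP; exists (fun=> 0); split=> // c _; apply/rowP => -[].
have Pb r : P r -> (r <= n)%N.
  move=> /asboolP [e [eF ei]]; rewrite leqNgt; apply/negP => lt.
  have [B hB] : exists B : 'M[C]_(r, n), forall i, e i = lincomb b (row i B).
    have [f hf] := choice (fun i => hb _ (eF i)).
    exists (\matrix_(i, j) f i j) => i; rewrite {1}hf; apply: eq_bigr => j _.
    by rewrite !mxE.
  have : kermx B != 0.
    by rewrite kermx_eq0 /row_free neq_ltn (leq_ltn_trans (rank_leq_col B)).
  move=> /eqP; apply; apply/row_matrixP => i; rewrite row0; apply: ei.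
  have -> : e = fun i => lincomb b (row i B) by apply/funext.
  rewrite -lincomb_mulmx -row_mul mulmx_ker row0.
  by rewrite /lincomb big1 // => j _; rewrite mxE scale0r.
case: (ex_maxnP P0 Pb) => r /asboolP [e [eF ei]] rmax.
exists r, e; split=> // x Fx; apply: contrapT => hx.
have : P r.+1; last by move=> /rmax; rewrite ltnn.
apply/asboolP; exists (fun i => if unlift ord0 i is Some j then e j else x).
split=> [j|c]; first by case: unlift.
rewrite /lincomb big_ord_recl unlift_none.
under eq_bigr do rewrite liftK.
pose c' : 'rV[C]_r := \row_j c 0 (lift ord0 j).
have -> : \sum_j c 0 (lift ord0 j) *: e j = lincomb e c'.
  by apply: eq_bigr => j _; rewrite mxE.
have [c0 h|c0 h] := eqVneq (c 0 ord0) 0.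
  move: h; rewrite c0 scale0r add0r => /ei h; apply/rowP => i; rewrite mxE.
  have [j ->|->//] := unliftP ord0 i.
  by have := congr1 (fun u : 'rV_r => u 0 j) h; rewrite !mxE.
case: hx; exists ((- (c 0 ord0)^-1) *: c').
rewrite lincombZ -(addKr (c 0 ord0 *: x) (lincomb e c')) h addr0.
by rewrite scalerN scaleNr opprK scalerA mulVf // scale1r.
Qed.

(* The character [x |-> det (1 + L_x)] of the group of quasi-invertible
   elements of [F], where [L_x] is left multiplication by [x] on [F]. *)
Record quasidet (d : A -> C) : Prop := QuasiDet {
  quasidet0 : d 0 = 1;
  quasidetD : forall x y, F x -> F y -> d (x + y + x ** y) = d x * d y;
  quasidet_neq0 : forall x, F x ->
    (forall v, F v -> v + x ** v = 0 -> v = 0) -> d x != 0;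
  quasidet_inv : forall x, F x -> d x != 0 ->
    exists2 y, F y & x + y + x ** y = 0 /\ x + y + y ** x = 0;
  quasidet_ratio : exists r, forall k eta x x', 0 < k -> F x -> F x' ->
    (forall v, F v -> k * nm v <= nm (v + x ** v)) -> nm (x' - x) <= eta ->
    nm (d x' / d x - 1) <= (1 + eta / k) ^+ r - 1;
  quasidet_idempotent : forall e, F e -> e ** e = e -> e <> 0 ->
    exists2 r, (0 < r)%N & forall w, d (w *: e) = (1 + w) ^+ r;
  quasidet_scale : forall x, F x ->
    exists l : seq C, forall w, d (w *: x) = \prod_(a <- l) (1 + w * a)
}.

Lemma nm_prod_one_add (l : seq C) (eta : R) : (forall a, a \in l -> nm a <= eta) ->
  nm (\prod_(a <- l) (1 + a) - 1) <= (1 + eta) ^+ size l - 1.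
Proof.
move=> h.
elim: l h => [|a l IH] h; first by rewrite big_nil expr0 !subrr nm0.
have ha := h a (mem_head _ _).
have {}IH := IH (fun b bl => h b (mem_behead (s := a :: l) bl)).
rewrite big_cons /= exprS; set p := \prod_(b <- l) _ in IH *.
have -> : (1 + a) * p - 1 = (1 + a) * (p - 1) + a by ring.
apply: le_trans (nmD _ _) _; rewrite nmM.
have := nmD 1 a; rewrite nm1 => h1; have := nm_ge0 (p - 1); have := nm_ge0 (1 + a).
set t := (1 + eta) ^+ _ in IH *; have := nm_ge0 a; nra.
Qed.

Lemma quasidet_exists : exists d, quasidet d.
Proof.
have [r [e [eF espan efree]]] := basis_exists.
have lF c : F (lincomb e c).
  by apply: big_ind => // j _; apply: FZ.
have linj c c' : lincomb e c = lincomb e c' -> c = c'.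
  move=> h; apply/subr0_eq/efree; rewrite -scaleN1r lincombD lincombZ h.
  by rewrite scaleN1r subrr.
have /choice [crd hcrd] : forall x, exists c, F x -> x = lincomb e c.
  move=> x; have [Fx|nF] := pselect (F x); last by exists 0.
  by have [c] := espan x Fx; exists c.
pose M x : 'M[C]_r := \matrix_(j, k) crd (x ** e j) 0 k.
have rowM x j : row j (M x) = crd (x ** e j) by apply/rowP => k; rewrite !mxE.
have actM x c : F x -> x ** lincomb e c = lincomb e (c *m M x).
  move=> Fx; rewrite lincomb_mulmx {1}/lincomb cmul_sumr; apply: eq_bigr => j _.
  by rewrite -cscalerAr rowM -hcrd //; apply: FM.
have act1M x c : F x -> lincomb e c + x ** lincomb e c = lincomb e (c *m (1%:M + M x)).
  by move=> Fx; rewrite mulmxDr mulmx1 lincombD actM.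
have Meq x B : F x -> (forall c, x ** lincomb e c = lincomb e (c *m B)) -> M x = B.
  move=> Fx h; apply/row_matrixP => j; rewrite !rowE; apply: linj.
  by rewrite -actM // h.
have MD x y : F x -> F y -> M (x + y) = M x + M y.
  move=> Fx Fy; apply: Meq => [|c]; first exact: FD.
  by rewrite cmulDl !actM // -lincombD -mulmxDr.
have MZ w x : F x -> M (w *: x) = w *: M x.
  move=> Fx; apply: Meq => [|c]; first exact: FZ.
  by rewrite -cscalerAl actM // -lincombZ -scalemxAr.
(* Row vectors make [M] reverse products; the determinant does not see the order. *)
have MM x y : F x -> F y -> M (x ** y) = M y *m M x.
  move=> Fx Fy; apply: Meq => [|c]; first exact: FM.
  by rewrite -cmulA !actM // mulmxA.
have M0 : M 0 = 0 by rewrite -(scale0r 0) MZ // scale0r.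
pose d x := \det (1%:M + M x).
have dD x y : F x -> F y -> d (x + y + x ** y) = d x * d y.
  move=> Fx Fy; rewrite /d !MD ?MM //; [|exact: FD|exact: FM].
  rewrite mulrC -det_mulmx; congr (\det _).
  by rewrite mulmxDr mulmx1 mulmxDl mul1mx -!addrA (addrCA (M x)).
have unitE x : (1%:M + M x \in unitmx) = (d x != 0) by rewrite unitmxE unitfE.
have inj0 x : F x -> (forall v, F v -> v + x ** v = 0 -> v = 0) -> d x != 0.
  move=> Fx h; rewrite -unitE -row_free_unit -kermx_eq0; apply/eqP/row_matrixP => i.
  rewrite row0; apply: efree; apply: h; first exact: lF.
  by rewrite act1M // -row_mul mulmx_ker row0 /lincomb big1 // => j _; rewrite mxE scale0r.
have inj1 x v : F x -> F v -> d x != 0 -> v + x ** v = 0 -> v = 0.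
  move=> Fx Fv dx; rewrite (hcrd v Fv) act1M // => /efree h.
  have := congr1 (mulmx^~ (invmx (1%:M + M x))) h.
  by rewrite mul0mx mulmxK ?unitE // => ->; rewrite /lincomb big1 // => j _; rewrite mxE scale0r.
exists d; split=> //.
- by rewrite /d M0 addr0 det1.
- move=> x Fx dx.
  pose y := lincomb e (- crd x *m invmx (1%:M + M x)).
  have Fy : F y by apply: lF.
  have hy : x + y + x ** y = 0.
    rewrite -addrA act1M // mulmxKV ?unitE // -scaleN1r lincombZ scaleN1r.
    by rewrite -hcrd // subrr.
  (* [y] solves [(1 + x) y = -x]. For the other side, [1 + x] kills [x + y + y x], and it acts
     injectively on [F]. *)
  exists y => //; split=> //; apply: (inj1 x) => //.
    by apply: FD; [apply: FD|apply: FM].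
  have := congr1 (fun t => t ** x) hy; rewrite !cmulDl cmul0l -cmulA => e1.
  rewrite !cmulDr.
  have e2 : x ** y = - (x + y) by rewrite -[RHS]add0r -hy addrC addKr.
  have gen (a p q t : A) : q + p + t = 0 -> a + p + (q - a + t) = 0.
    by move=> <-; rewrite [q - a + t]addrAC addrA addrC -addrA addKr addrA [p + q]addrC.
  by rewrite e2; apply: gen.
- exists r => k eta x x' k0 Fx Fx' lb hx.
  have dx : d x != 0.
    apply: inj0 => // v Fv hv; have := lb v Fv; rewrite hv nm0 => h.
    by apply/nm_eq0/eqP; rewrite eq_le nm_ge0 andbT -(pmulr_rle0 _ k0).
  have Fxx : F (x' - x) by apply: FD => //; rewrite -scaleN1r; apply: FZ.
  have [l [sl eig hl]] :=
    det_one_add_eigenvalues (M (x' - x) *m invmx (1%:M + M x)).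
  have MB : M (x' - x) = M x' - M x.
    by rewrite -scaleN1r MD //; [rewrite MZ // scaleN1r|apply: FZ].
  have -> : d x' / d x = \prod_(a <- l) (1 + a).
    under eq_bigr do rewrite -[X in 1 + X]mul1r.
    rewrite -hl scale1r /d -det_inv -det_mulmx; congr (\det _).
    have -> : 1%:M + M x' = (1%:M + M x) + (M x' - M x) by rewrite -addrA subrKC.
    by rewrite MB mulmxDl mulmxV // unitE.
  rewrite -[in leRHS]sl; apply: nm_prod_one_add => a al.
  (* An eigenvector for [a] yields [u] in [F] with [(x' - x) u = a (u + x u)]; the lower bound at
     [u] then gives [k |a| <= eta]. *)
  have [v va v0] := eig a al.
  pose u := lincomb e v.
  have u0 : 0 < nm u.
    rewrite lt_neqAle nm_ge0 andbT eq_sym; apply/eqP => /nm_eq0 /efree h.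
    by rewrite h eqxx in v0.
  have e1 : (x' - x) ** u = a *: (u + x ** u).
    rewrite act1M // actM // -lincombZ scalemxAl -va.
    by rewrite mulmxA mulmxKV // unitE.
  rewrite ler_pdivlMr // -(ler_pM2r u0) -mulrA.
  apply: le_trans (_ : nm a * nm (u + x ** u) <= _).
    by apply: ler_wpM2l; [apply: nm_ge0|apply/lb/lF].
  rewrite -nmZ -e1; apply: le_trans (nm_cmul _ _) _.
  by apply: ler_wpM2r => //; apply: nm_ge0.
(* Left multiplication by [p] has eigenvalues 0 and 1, and the rank counts the ones. With none of
   them [1 - p] would have determinant 1 and act injectively on [F], although it kills [p]. *)
- move=> p Fp pp p0.
  have [l [_ eig hl]] := det_one_add_eigenvalues (M p).
  have l01 a : a \in l -> a = (a == 1)%:R.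
    move=> /eig [v va v0]; have : a * a == a.
      rewrite -subr_eq0; have : (a * a - a) *: v == 0.
        by rewrite scalerBl -scalerA -va scalemxAl -va -mulmxA -MM // pp subrr.
      by rewrite scaler_eq0 (negPf v0) orbF.
    have [->//|a1] := eqVneq a 1.
    by rewrite -subr_eq0 -{3}[a]mulr1 -mulrBr mulf_eq0 subr_eq0 (negPf a1) orbF => /eqP.
  have hd w : d (w *: p) = (1 + w) ^+ count (pred1 1) l.
    rewrite /d MZ // hl big_seq (eq_bigr (fun a => if a == 1 then 1 + w else 1)).
      by rewrite -big_seq -big_mkcond big_const_seq iter_mulr_1.
    by move=> a /l01 ->; case: (a == 1); rewrite ?eqxx ?mulr1 // mulr0 addr0 eq_sym oner_eq0.
  exists (count (pred1 1) l) => //; rewrite lt0n; apply/eqP => c0.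
  have := hd (- 1); rewrite c0 expr0 => h1.
  have : d (-1 *: p) != 0 by rewrite h1 oner_eq0.
  move=> dp; apply: p0; apply: (inj1 _ _ _ Fp dp); first by apply: FZ.
  by rewrite scaleN1r cmulNl pp subrr.
- move=> x Fx; have [l [_ _ hl]] := det_one_add_eigenvalues (M x).
  by exists l => w; rewrite /d MZ.
Qed.

End FiniteDimensional.

(** * Roots of functions on the circle *)

Section CircleRoots.
Variable R : realType.
Let C := R[i].
Implicit Types (z w a b : C) (f g h : C -> C).

Definition sqrt_half z : C := if 0 <= complex.Re (sqrtC z) then sqrtC z else - sqrtC z.

Lemma sqrt_halfK z : sqrt_half z ^+ 2 = z.
Proof. by rewrite /sqrt_half; case: ifP => _; rewrite ?sqrrN sqrtCK. Qed.

Lemma Re_sqrt_half z : 0 <= complex.Re (sqrt_half z).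
Proof.
rewrite /sqrt_half; case: ifP => // /negbT; rewrite -ltNge raddfN /= => h.
by rewrite oppr_ge0 ltW.
Qed.

(** A primitive root of unity of order [2^(n+1)]. Taking the square root with non-negative real part
    at each stage makes the sequence tend to 1, so it supplies arbitrarily small rotations. *)
Fixpoint zeta (n : nat) : C := if n is n'.+1 then sqrt_half (zeta n') else -1.

Lemma zetaX n : zeta n ^+ (2 ^ n) = -1.
Proof. by elim: n => [|n IH] //=; rewrite expnS exprM sqrt_halfK. Qed.

Lemma nm_zeta n : nm (zeta n) = 1.
Proof.
have := congr1 (@nm R _) (zetaX n); rewrite nmX nmN nm1 => /eqP.
by rewrite pexpr_eq1 ?expn_gt0 ?nm_ge0 // => /eqP.
Qed.

Lemma nm_sqr z : nm z ^+ 2 = complex.Re z ^+ 2 + complex.Im z ^+ 2.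
Proof. by apply/complexI; rewrite rmorphXn /= -normE -add_Re2_Im2. Qed.

(** Let [w = zeta n.+1]. Then [w^2 - 1 = (w - 1)(w + 1)], and [|w + 1|^2 = 2 + 2 Re w >= 2]; so the
    distance to 1 shrinks by the factor [1 / sqrt 2], which is below 3/4. *)
Lemma zeta_step n : nm (zeta n.+1 - 1) <= 3 / 4 * nm (zeta n - 1).
Proof.
have e1 : zeta n - 1 = (zeta n.+1 - 1) * (zeta n.+1 + 1).
  by rewrite -{1}(sqrt_halfK (zeta n)) -subr_sqr_1.
have h1 := nm_zeta n.+1.
have h2 : 2 <= nm (zeta n.+1 + 1) ^+ 2.
  have := congr1 (fun x => x ^+ 2) h1; rewrite !nm_sqr raddfD [complex.Im (_ + _)]raddfD /=.
  have := Re_sqrt_half (zeta n); rewrite /=; set x := sqrt_half _.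
  by set r := complex.Re x; set s := complex.Im x; rewrite expr1n addr0; nra.
rewrite e1 nmM; have := nm_ge0 (zeta n.+1 + 1); have := nm_ge0 (zeta n.+1 - 1).
by nra.
Qed.

Lemma zeta_cvg e : 0 < e -> exists n0, forall n, (n0 <= n)%N -> nm (zeta n - 1) <= e.
Proof.
move=> e0.
have h n : nm (zeta n - 1) <= 2 * (3 / 4) ^+ n.
  elim: n => [|n IH].
    rewrite expr0 mulr1 -opprD nmN; apply: le_trans (nmD _ _) _.
    by rewrite nm1; lra.
  by apply: le_trans (zeta_step n) _; rewrite exprS mulrCA; apply: ler_wpM2l.
have q1 : `|3 / 4 : R| < 1 by rewrite ger0_norm; lra.
have /cvgrPdist_lt /(_ (e / 2)) [|n0 _ hn] := cvg_expr q1; first lra.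
exists n0 => n /hn; rewrite /= sub0r normrN ger0_norm => [?|]; last exact: exprn_ge0.
by apply: le_trans (h n) _; lra.
Qed.

Lemma zeta_order n m : zeta n ^+ m = 1 -> (2 ^ n.+1 %| m)%N.
Proof.
move=> hm.
have h1 : zeta n ^+ (2 ^ n.+1) = 1 by rewrite expnSr exprM zetaX sqrrN expr1n.
have N0 : (0 < 2 ^ n.+1)%N by rewrite expn_gt0.
have [d dP dN] := prim_order_exists N0 h1.
suff <- : d = (2 ^ n.+1)%N by rewrite (prim_order_dvd dP) hm.
move: dN => /(dvdn_pfactor _ _ (isT : prime 2)) [j jn dj]; rewrite dj; congr (_ ^ _)%N.
apply/eqP; rewrite eqn_leq jn ltnNge; apply/negP => jn'.
have : zeta n ^+ (2 ^ n) == 1.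
  by rewrite -(prim_order_dvd dP) dj dvdn_exp2l.
rewrite zetaX -subr_eq0 -opprD oppr_eq0.
by rewrite -[1 + 1]/(2%:R) pnatr_eq0.
Qed.

(** At 1 the polynomial [X^q - w] takes the value [1 - w], the product of [1 - a] over its roots;
    were all these factors larger than [e], the product would exceed [e^q]. *)
Lemma root_near_one q w e : (0 < q)%N -> 0 <= e -> nm (w - 1) <= e ^+ q ->
  exists2 a, a ^+ q = w & nm (a - 1) <= e.
Proof.
move=> q0 e0 hw.
have [l hl] := closed_field_poly_normal ('X^q - w%:P).
have mon : 'X^q - w%:P \is monic by rewrite monicXnsubC.
rewrite (monicP mon) scale1r in hl.
have sl : size l = q.
  by have := congr1 (size : {poly C} -> nat) hl;
     rewrite size_XnsubC // size_prod_XsubC => -[].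
have [/hasP [a al ha]|/hasPn none] := boolP (has (fun a => nm (a - 1) <= e) l).
  exists a => //; apply/eqP; rewrite -subr_eq0.
  have : root ('X^q - w%:P) a by rewrite hl root_prod_XsubC.
  by rewrite rootE !hornerE.
have := congr1 (fun p => nm p.[1]) hl; rewrite !hornerE expr1n nmBC => h.
have : e ^+ size l < nm (\prod_(z <- l) (1 - z)).
  have : l != [::] by rewrite -size_eq0 sl -lt0n.
  elim: l none {hl sl h} => // a l IH none _.
  have ha : e < nm (1 - a) by rewrite nmBC ltNge none ?mem_head.
  rewrite big_cons /= exprS nmM.
  have [->|l0] := eqVneq l [::].
    by rewrite big_nil expr0 nm1 !mulr1.
  apply: ltr_pM => //; first exact: exprn_ge0.
  by apply: IH => // b bl; apply: none; rewrite inE bl orbT.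
have -> : \prod_(z <- l) (1 - z) = (\prod_(z <- l) ('X - z%:P)).[1].
  by rewrite horner_prod; apply: eq_bigr => z _; rewrite !hornerE.
by rewrite sl ltNge -h hw.
Qed.

(** For [a != 1] the powers of [a] sum to 0, so [q] is the norm of the sum of the [q] terms
    [1 - a^i], each at most [q |a - 1| < 1]. *)
Lemma root_of_one_near q a : (0 < q)%N -> a ^+ q = 1 -> nm (a - 1) * q%:R < 1 -> a = 1.
Proof.
move=> q0 aq ha; apply/eqP; rewrite -subr_eq0; apply/negPn/negP => a1.
have na : nm a = 1.
  have := congr1 (@nm R _) aq; rewrite nmX nm1 => /eqP.
  by rewrite pexpr_eq1 ?nm_ge0 // => /eqP.
have s0 : \sum_(i < q) a ^+ i = 0.
  by apply: (mulfI a1); rewrite -subrX1 aq subrr mulr0.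
have hi i : nm (1 - a ^+ i) <= i%:R * nm (a - 1).
  elim: i => [|i IH]; first by rewrite expr0 subrr nm0 mul0r.
  have -> : 1 - a ^+ i.+1 = a * (1 - a ^+ i) - (a - 1) by rewrite exprS; ring.
  by apply: le_trans (nmB _ _) _; rewrite nmM na mul1r -natr1 mulrDl mul1r lerD2r.
have : q%:R <= \sum_(i < q) q%:R * nm (a - 1).
  have e : (q%:R : R) = nm (\sum_(i < q) (1 - a ^+ i)).
    rewrite sumrB s0 subr0 sumr_const card_ord -(rmorph_nat (real_complex R)) nm_real.
    by rewrite ger0_norm.
  rewrite {1}e; apply: le_trans (nm_sum _ _ _) _; apply: ler_sum => i _.
  apply: le_trans (hi i) _; apply: ler_wpM2r; first exact: nm_ge0.
  by rewrite ler_nat ltnW.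
rewrite sumr_const card_ord -mulr_natr; have : 0 < (q%:R : R) by rewrite ltr0n.
move: ha; set t := (q%:R : R); have := nm_ge0 (a - 1); nra.
Qed.

(* A substitute for uniform continuity on the unit circle of a function with
   values in the nonzero complex numbers. *)
Definition slow f := forall e : R, 0 < e -> exists n0, forall n, (n0 <= n)%N ->
  forall z, nm z = 1 -> nm (f (zeta n * z) / f z - 1) <= e.

Lemma nm_mul_near_one a b : nm (a * b - 1) <=
  nm (a - 1) * nm (b - 1) + nm (a - 1) + nm (b - 1).
Proof.
have -> : a * b - 1 = (a - 1) * (b - 1) + (a - 1) + (b - 1) by ring.
apply: le_trans (nmD _ _) _; rewrite lerD2r; apply: le_trans (nmD _ _) _.
by rewrite lerD2r nmM.
Qed.

Lemma slowM f g : slow f -> slow g -> slow (fun z => f z * g z).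
Proof.
move=> sf sg e e0.
have m0 : 0 < Num.min 1 (e / 3) by rewrite lt_min ltr01 /=; lra.
have [n1 h1] := sf _ m0; have [n2 h2] := sg _ m0.
exists (maxn n1 n2) => n; rewrite geq_max => /andP[le1 le2] z z1.
rewrite -mulf_div; apply: le_trans (nm_mul_near_one _ _) _.
have := h1 _ le1 _ z1; have := h2 _ le2 _ z1; rewrite !le_min.
set u := nm _; set v := nm _ => /andP[u1 u2] /andP[v1 v2].
have : 0 <= u by apply: nm_ge0.
have : 0 <= v by apply: nm_ge0.
by nra.
Qed.

Lemma slowV f : slow f -> slow (fun z => (f z)^-1).
Proof.
move=> sf e e0.
have m0 : 0 < Num.min (1 / 2) (e / 2) by rewrite lt_min; lra.
have [n1 h1] := sf _ m0; exists n1 => n le1 z z1.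
have := h1 _ le1 _ z1; rewrite le_min -invfM.
set u := f _ / _ => /andP[u1 u2].
have nu : 1 / 2 <= nm u by have := nm_leD 1 (u - 1); rewrite subrKC nm1; lra.
have u0 : u != 0 by rewrite -nm_gt0; lra.
have -> : u^-1 - 1 = - (u^-1 * (u - 1)) by rewrite mulrBr mulVf // mulr1 opprB.
rewrite nmN nmM nmV mulrC ler_pdivrMr; last by lra.
by nra.
Qed.

(** Slowness of [h] is the substance: a mere pointwise choice of roots always exists. *)
Definition rootable q f := exists2 h, slow h &
  forall z, nm z = 1 -> h z != 0 /\ h z ^+ q = f z.

Lemma rootable_one q : rootable q (fun=> 1).
Proof.
exists (fun=> 1); last by move=> z _; rewrite oner_neq0 expr1n.
by move=> e e0; exists 0%N => n _ z _; rewrite divr1 subrr nm0 ltW.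
Qed.

(** The quotient [g / f] is so close to 1 that it has a root [k] near 1. Roots that near to 1 are
    unique, and this makes [k] slow; multiplying by [k] turns a root of [f] into one of [g]. *)
Lemma rootable_near q f g : (0 < q)%N -> slow f -> slow g ->
  (forall z, nm z = 1 -> nm (g z / f z - 1) <= (16 * q%:R)^-1 ^+ q) ->
  rootable q f -> rootable q g.
Proof.
move=> q0 sf sg near [h sh hh].
have qR : 1 <= (q%:R : R) by rewrite ler1n.
pose e1 : R := (16 * q%:R)^-1.
have e10 : 0 < e1 by rewrite invr_gt0; lra.
have e1q : e1 * q%:R = 1 / 16 by rewrite /e1; field; rewrite lt0r_neq0 //; lra.
have e116 : e1 <= 1 / 16 by nra.
pose u z := g z / f z.
have su : slow u by apply: slowM sg (slowV sf).
have /choice [k hk] : forall z, exists k, nm z = 1 -> k ^+ q = u z /\ nm (k - 1) <= e1.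
  move=> z; have [z1|nz] := pselect (nm z = 1); last by exists 0.
  by have [k kq k1] := root_near_one q0 (ltW e10) (near z z1); exists k.
have k0 z : nm z = 1 -> 15 / 16 <= nm (k z).
  by move=> /hk [_ k1]; have := nm_leD 1 (k z - 1); rewrite subrKC nm1; lra.
have f0 z : nm z = 1 -> f z != 0.
  by move=> /hh [hz <-]; rewrite expf_neq0.
have sk : slow k.
  move=> e e0.
  have m0 : 0 < Num.min e e1 by rewrite lt_min e0.
  have [n0 hn] := su _ (exprn_gt0 q m0).
  exists n0 => n ln z z1.
  have zz1 : nm (zeta n * z) = 1 by rewrite nmM nm_zeta z1 mulr1.
  have [a aq] := root_near_one q0 (ltW m0) (hn n ln z z1).
  rewrite le_min => /andP[a1 a2].
  have [kz1 kz2] := hk z z1; have [kw1 kw2] := hk _ zz1.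
  have kz0 := k0 z z1.
  have na : 15 / 16 <= nm a by have := nm_leD 1 (a - 1); rewrite subrKC nm1; lra.
  have a0 : a != 0 by rewrite -nm_gt0; lra.
  have kzn : k z != 0 by rewrite -nm_gt0; lra.
  (* [k (zeta n * z)] and [k z * a] have the same [q]-th power and both lie within a few [e1] of 1.
     Since [e1 * q = 1 / 16], their quotient is too close to 1 to be another root of unity. *)
  suff ke : k (zeta n * z) / (k z * a) = 1.
    suff -> : k (zeta n * z) / k z = a by [].
    by rewrite -[RHS]mul1r -ke; field; rewrite ?kzn ?a0.
  apply: (root_of_one_near q0).
    rewrite !exprMn exprVn exprMn kw1 kz1 aq.
    have uz : u z != 0 by rewrite -kz1 expf_neq0.
    have uw : u (zeta n * z) != 0.
      rewrite -kw1 expf_neq0 // -nm_gt0; apply: lt_le_trans (k0 _ zz1); lra.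
    by field; rewrite ?uz ?uw.
  have -> : k (zeta n * z) / (k z * a) - 1 =
      (k (zeta n * z) - 1 - (k z * a - 1)) / (k z * a) by field; rewrite ?kzn ?a0.
  rewrite nmM nmV nmM mulrAC ltr_pdivrMr ?mul1r; last by nra.
  have := nmB (k (zeta n * z) - 1) (k z * a - 1); have := nm_mul_near_one (k z) a.
  move: kz2 kw2 a2 kz0 na e1q e116.
  set t1 := nm (k z - 1); set t2 := nm (k (zeta n * z) - 1); set t3 := nm (a - 1).
  set t4 := nm (_ - _ - _); set t5 := nm (k z * a - 1); set t6 := nm (k z).
  have : 0 <= t1 by apply: nm_ge0.
  have : 0 <= t3 by apply: nm_ge0.
  move=> t30 t10 t1e t2e t3e t6e na e1q e116 t5e t4e.
  have : t4 <= 4 * e1 by nra.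
  move=> t4e'; have : t4 * q%:R <= 1 / 4 by nra.
  nra.
exists (fun z => h z * k z); first exact: slowM.
move=> z z1; have [hz1 hz2] := hh z z1; have [kz1 _] := hk z z1; split.
  by rewrite mulf_neq0 // -nm_gt0; apply: lt_le_trans (k0 _ z1); lra.
by rewrite exprMn hz2 kz1 /u mulrC divfK // f0.
Qed.

(** The interval is cut into equal steps so short that [rootable_near] carries a root across each of
    them. *)
Lemma rootable_homotopy q (D : R -> C -> C) : (0 < q)%N ->
  (forall s, 0 <= s <= 1 -> slow (D s)) ->
  (forall e : R, 0 < e -> exists2 d : R, 0 < d & forall s t, 0 <= s <= 1 -> 0 <= t <= 1 ->
     `|s - t| <= d -> forall z, nm z = 1 -> nm (D s z / D t z - 1) <= e) ->
  rootable q (D 0) -> rootable q (D 1).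
Proof.
move=> q0 sD uD r0.
have e0 : 0 < ((16 * q%:R)^-1 ^+ q : R).
  by rewrite exprn_gt0 // invr_gt0 mulr_gt0 // ltr0n.
have [d d0 hd] := uD _ e0.
have [m hm] : exists m : nat, d^-1 < m.+1%:R.
  by exists (Num.Def.archi_bound d^-1); rewrite (lt_trans (archi_boundP _)) ?ltr_nat ?invr_ge0 // ltW.
have m0 : 0 < (m.+1%:R : R) by rewrite ltr0n.
have : forall i, (i <= m.+1)%N -> rootable q (D (i%:R / m.+1%:R)).
  elim=> [|i IH] im; first by rewrite mul0r.
  have I j : (j <= m.+1)%N -> 0 <= (j%:R / m.+1%:R : R) <= 1.
    by move=> jm; rewrite divr_ge0 // ler_pdivrMr // mul1r ler_nat.
  apply: rootable_near (IH (ltnW im)) => //; try by apply: sD; apply: I => //; apply: ltnW.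
  apply: hd; [exact: I|apply: I; exact: ltnW|].
  rewrite -mulrBl -natrB // subSnn mul1r ger0_norm ?invr_ge0 //.
  by rewrite invf_ple ?posrE // ltW.
by move=> /(_ m.+1 (leqnn _)); rewrite divff // lt0r_neq0.
Qed.

(** For a slow root [h], the ratio of [h (zeta z)] to [h z] is a [2^k]-th root of [zeta^s] near 1,
    hence the same for all [z]. Going once round the circle, its power [2^(n+1)] is 1; therefore
    [zeta^(s 2^(n+1-k)) = 1], and [2^k] divides [s]. *)
Lemma power_not_rootable k s (c : C) : (0 < s)%N -> (s < 2 ^ k)%N -> c != 0 ->
  ~ rootable (2 ^ k) (fun z => c * z ^+ s).
Proof.
move=> s0 sk c0 [h sh hh]; set q := (2 ^ k)%N in sk hh.
have q0 : (0 < q)%N by rewrite expn_gt0.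
have qR : 1 <= (q%:R : R) by rewrite ler1n.
have e0 : 0 < ((16 * q%:R)^-1 : R) by rewrite invr_gt0; lra.
have [n0 hn] := sh _ e0.
pose n := maxn n0 k; have {}hn := hn n (leq_maxl _ _).
have zj j : nm (zeta n ^+ j) = 1 by rewrite nmX nm_zeta expr1n.
pose r z := h (zeta n * z) / h z.
have rq z : nm z = 1 -> r z ^+ q = zeta n ^+ s.
  move=> z1; have [hz hzq] := hh z z1.
  have [|_ hwq] := hh (zeta n * z); first by rewrite nmM nm_zeta z1 mulr1.
  rewrite /r exprMn exprVn hzq hwq exprMn.
  have zs : z ^+ s != 0 by rewrite expf_neq0 // -nm_gt0 z1.
  by field; rewrite ?c0 ?zs.
have rn z : nm z = 1 -> 15 / 16 <= nm (r z).
  move=> z1; have := nm_leD 1 (r z - 1); rewrite subrKC nm1.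
  have : (16 * q%:R)^-1 <= (16 : R)^-1 by rewrite lef_pV2 ?posrE; lra.
  by have := hn z z1; rewrite -/(r z); lra.
have rconst z : nm z = 1 -> r z = r 1.
  move=> z1; have r1 := rn 1 (nm1 R); have rz := rn z z1.
  have r10 : r 1 != 0 by rewrite -nm_gt0; lra.
  suff e : r z / r 1 = 1 by rewrite -[LHS](divfK r10) e mul1r.
  apply: (root_of_one_near q0).
    by rewrite exprMn exprVn !rq ?nm1 // divff // expf_neq0 // -nm_gt0 nm_zeta.
  have -> : r z / r 1 - 1 = (r z - 1 - (r 1 - 1)) / r 1 by field.
  rewrite nmM nmV mulrAC ltr_pdivrMr; last by lra.
  have := nmB (r z - 1) (r 1 - 1); have := hn z z1; have := hn 1 (nm1 R).
  rewrite -!/(r _) mul1r; set e1 := (16 * q%:R)^-1 => h1 h2 h3.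
  have e1q : e1 * q%:R = 1 / 16 by rewrite /e1; field; rewrite lt0r_neq0 //; lra.
  have : nm (r z - 1 - (r 1 - 1)) * q%:R <= 2 * e1 * q%:R.
    by apply: ler_wpM2r; lra.
  lra.
have hj j : h (zeta n ^+ j) = r 1 ^+ j * h 1.
  elim: j => [|j IH]; first by rewrite !expr0 mul1r.
  have hj0 := (hh _ (zj j)).1.
  by rewrite exprS -[LHS](divfK hj0) -/(r _) rconst // IH exprS mulrA.
have rN : r 1 ^+ (2 ^ n.+1) = 1.
  have h10 := (hh 1 (nm1 R)).1; apply: (mulIf h10); rewrite -hj mul1r.
  by rewrite expnSr exprM zetaX sqrrN expr1n.
have kn : (k <= n.+1)%N by rewrite leqW // leq_maxr.
have : zeta n ^+ (s * 2 ^ (n.+1 - k)) = 1.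
  by rewrite exprM -(rq 1 (nm1 R)) -exprM -expnD subnKC.
move=> /zeta_order; rewrite -{1}(subnKC kn) expnD dvdn_pmul2r ?expn_gt0 //.
by move=> /(dvdn_leq s0); rewrite leqNgt sk.
Qed.

End CircleRoots.

(** * AF algebras *)

Section AFAlgebra.
Variables (R : realType) (A : cstarAlgType R) (F : nat -> set A).
Hypotheses (subF : forall n, cstar_subalgebra (F n))
  (fdF : forall n, finite_dimensional (F n))
  (incF : forall n, F n `<=` F n.+1)
  (denseF : closure (\bigcup_n F n) = setT).
Let C := R[i].
Implicit Types (x y v w a b h p : A).

Lemma AF_approx x (e : R) : 0 < e -> exists n, exists2 y, F n y & nm (x - y) <= e.
Proof.
move=> e0; have : closure (\bigcup_n F n) x by rewrite denseF.
by move=> /closure_nmP /(_ e e0) [y [n _ Fy] xy]; exists n, y.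
Qed.

Lemma AF_mono m n x : (m <= n)%N -> F m x -> F n x.
Proof. by move=> /subnKC <-; elim: (n - m)%N => [|k IH]; rewrite ?addn0 // addnS => /IH /incF. Qed.

(** The bound, required for all [v], is the substitute for invertibility of [1 + x]; moving [x] by
    [e] costs at most [e]. *)
Lemma lower_bound_perturb x y (k e : R) v :
  k * nm v <= nm (v + x ** v) -> nm (x - y) <= e -> (k - e) * nm v <= nm (v + y ** v).
Proof.
move=> h1 h2.
have -> : v + y ** v = v + x ** v - (x - y) ** v by cstar_ring.
have h3 := nm_leD (v + x ** v) (- ((x - y) ** v)); rewrite nmN in h3.
have := nm_cmul (x - y) v; have := nm_ge0 v; nra.
Qed.

(** An approximant [1 + y] in a finite-dimensional subalgebra is bounded below, hence invertible
    there, with quasi-inverse [z]. From [r (1 + x) = 0] comes [r = r (y - x)(1 + z)]; here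
    [|x| <= 2] gives [|z| <= 2.4], and [0.1 * 3.4 < 1]. *)
Lemma AF_isometry x r : (forall v, nm (v + x ** v) = nm v) -> r + r ** x = 0 -> r = 0.
Proof.
move=> iso rx.
have nx : nm x <= 2.
  have h : nm (x ** cadj x) <= 2 * nm (cadj x).
    have -> : x ** cadj x = cadj x + x ** cadj x - cadj x by linear_ring.
    by apply: le_trans (nmB _ _) _; rewrite iso; lra.
  move: h; rewrite -{1}(cadjK x) nm_cstar nm_adj; have := nm_ge0 x; nra.
have [n [y Fy xy]] := @AF_approx x (1 / 10) ltac:(lra).
have [d qd] := quasidet_exists (subF n) (fdF n).
have lb v : (9 / 10) * nm v <= nm (v + y ** v).
  have -> : 9 / 10 = 1 - 1 / 10 :> R by lra.
  by apply: lower_bound_perturb xy; rewrite iso mul1r.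
have dy : d y != 0.
  apply: (quasidet_neq0 qd) => // v Fv hv; apply/nm_eq0.
  by have := lb v; rewrite hv nm0; have := nm_ge0 v; lra.
have [z Fz [yz _]] := quasidet_inv qd Fy dy.
have ny : nm y <= 21 / 10 by have := nm_leD y (x - y); rewrite subrKC; lra.
have nz : nm z <= 24 / 10.
  have := lb z; have -> : z + y ** z = - y.
    by rewrite -[RHS]addr0 -yz; linear_ring.
  by rewrite nmN; lra.
have e1 : r = r ** (y - x) + r ** (y - x) ** z.
  apply/esym/subr0_eq.
  have -> : r ** (y - x) + r ** (y - x) ** z - r =
      r ** (y + z + y ** z) - (r + r ** x) - (r + r ** x) ** z by cstar_ring.
  by rewrite yz rx cmul0r cmul0l !subr0.
apply/nm_eq0; have h := nmD (r ** (y - x)) (r ** (y - x) ** z).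
have h1 := nm_cmul r (y - x); have h2 := nm_cmul (r ** (y - x)) z.
rewrite -e1 in h; move: h h1 h2 xy; rewrite nmBC.
have := nm_ge0 r; have := nm_ge0 (y - x); have := nm_ge0 z.
have := nm_ge0 (r ** (y - x)); nra.
Qed.

Lemma projection_norm_le1 p : cadj p = p -> p ** p = p -> nm p <= 1.
Proof.
move=> ps pp; have := nm_cstar p; rewrite ps pp => h.
by have := nm_ge0 p; nra.
Qed.

(** The idempotent is sought as [x + (1 - 2x) h] with [h] commuting with [x]. For [b = x - x^2] one
    has [(1 - 2x)^2 = 1 - 4b], and the condition becomes [(1 - 4b)(h^2 - h) = b], which says that
    [h] is fixed by [Phi]. Since [|b| <= 1/100], [Phi] contracts the ball of radius 1/40; the fixed
    point stays in the closed subalgebra [F n]. *)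
Lemma idempotent_near n p x : cadj p = p -> p ** p = p -> F n x ->
  nm (p - x) <= 1 / 400 -> exists2 e, F n e & e ** e = e /\ nm (e - p) <= 8 / 100.
Proof.
move=> ps pp Fx hx.
have [cF [F0 FD FZ FM _]] := subF n.
have np := projection_norm_le1 ps pp.
have FN y : F n y -> F n (- y) by rewrite -scaleN1r; apply: FZ.
have FB y z : F n y -> F n z -> F n (y - z) by move=> Fy /FN; apply: FD.
pose b := x - x ** x.
have Fb : F n b by apply: FB => //; apply: FM.
have nx : nm x <= 1 + 1 / 400 by have := nm_leD x (p - x); rewrite subrKC; lra.
have nb : nm b <= 1 / 100.
  have -> : b = (p - x) ** x + p ** (p - x) - (p - x) - (p ** p - p).
    by rewrite /b; cstar_ring.
  rewrite pp subrr subr0.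
  apply: le_trans (nmB _ _) _; have := nmD ((p - x) ** x) (p ** (p - x)).
  have := nm_cmul (p - x) x; have := nm_cmul p (p - x); have := nm_ge0 (p - x).
  by have := nm_ge0 x; have := nm_ge0 p; nra.
pose Phi h := h ** h - b - (4 : C) *: (b ** (h ** h - h)).
pose S := [set h | F n h] `&` [set h | nm h <= 1 / 40] `&` [set h | x ** h = h ** x].
have bx : x ** b = b ** x by rewrite cmulBr cmulBl cmulA.
have n4 : nm (4 : C) = 4 by rewrite -(rmorph_nat (real_complex R)) nm_real ger0_norm.
have [||h [[Fh hh] xh]|h k [[Fh hh] xh] [[Fk hk] xk]|h [[Fh hh] xh] fh] :=
    @fixpoint_exists _ A S Phi.
- apply: closedI (@closed_commutant _ _ _); apply: closedI => //.
  exact: closed_nm_ball.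
- by exists 0; split; [split|]; rewrite /= ?nm0 ?cmul0l ?cmul0r.
- rewrite /= in Fh hh xh.
  split; [split|]; rewrite /= /Phi.
  + by apply/FB; [apply/FB => //; apply/FM|apply/FZ/FM => //; apply/FB => //; apply/FM].
  + apply: le_trans (nmB _ _) _; rewrite nmZ n4.
    have := nmB (h ** h) b; have := nm_cmul h h; have := nmB (h ** h) h.
    have := nm_cmul b (h ** h - h); have := nm_ge0 (h ** h - h).
    have := nm_ge0 h; have := nm_ge0 b; nra.
  + have cM u t : x ** u = u ** x -> x ** t = t ** x -> x ** (u ** t) = u ** t ** x.
      by move=> xu xt; rewrite cmulA xu -cmulA xt cmulA.
    have cB u t : x ** u = u ** x -> x ** t = t ** x -> x ** (u - t) = (u - t) ** x.
      by move=> xu xt; rewrite cmulBr cmulBl xu xt.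
    apply/cB; first by apply/cB => //; apply/cM.
    by rewrite cmulZl cmulZr; congr (_ *: _); apply/cM/cB => //; apply/cM.
- rewrite /= in Fh hh xh Fk hk xk; rewrite /Phi.
  have e1 : h ** h - k ** k = h ** (h - k) + (h - k) ** k by rewrite cmulBl cmulBr subrKA.
  have -> : h ** h - b - 4 *: (b ** (h ** h - h)) - (k ** k - b - 4 *: (b ** (k ** k - k))) =
      h ** h - k ** k - 4 *: (b ** (h ** h - k ** k - (h - k))) by cstar_ring.
  apply: le_trans (nmB _ _) _; rewrite nmZ n4.
  have n1 : nm (h ** h - k ** k) <= 1 / 20 * nm (h - k).
    rewrite e1; apply: le_trans (nmD _ _) _.
    have := nm_cmul h (h - k); have := nm_cmul (h - k) k; have := nm_ge0 (h - k); nra.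
  have n2 := nm_cmul b (h ** h - k ** k - (h - k)).
  have n3 := nmB (h ** h - k ** k) (h - k).
  have := nm_ge0 (h ** h - k ** k - (h - k)); have := nm_ge0 (h - k).
  have := nm_ge0 b; nra.
rewrite /= in Fh hh xh.
pose P u := u - 2 *: (x ** u).
have PPE u : P (P u) = u - (4 : C) *: (b ** u) by rewrite /P /b; cstar_ring.
have PM : P h ** P h = P (P (h ** h)).
  by rewrite /P !cmulE -xh -[x ** h ** x]cmulA -xh !cmulE; linear_ring.
exists (x + P h).
  by apply: FD => //; apply: FB => //; apply/FZ/FM.
split.
  have -> : (x + P h) ** (x + P h) = x + P h + (P h ** P h - P (P h) - b).
    rewrite /P /b !cmulE -xh -[x ** h ** x]cmulA -xh !cmulE; linear_ring.
  rewrite PM !PPE.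
  have -> : h ** h - 4 *: (b ** (h ** h)) - (h - 4 *: (b ** h)) - b = Phi h - h.
    by rewrite /Phi; cstar_ring.
  by rewrite fh subrr addr0.
have -> : x + P h - p = P h - (p - x) by linear_ring.
apply: le_trans (nmB _ _) _; have := nmB h (2 *: (x ** h)).
have n2 : nm (2 : C) = 2 by rewrite -(rmorph_nat (real_complex R)) nm_real ger0_norm.
rewrite nmZ n2 -/(P h); have := nm_cmul x h; have := nm_ge0 h; have := nm_ge0 x; nra.
Qed.

End AFAlgebra.

(** * Trigonometric polynomials with values in the algebra *)

Section TrigonometricPolynomials.
Variables (R : realType) (A : cstarAlgType R).
Let C := R[i].
Implicit Types (f g : C -> A) (z : C).

(** On the unit circle [conj z] is the inverse of [z], so these are the Laurent polynomials with
    coefficients in [A]; the inductive form gives every closure property by induction. *)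
Inductive trig : (C -> A) -> Prop :=
  | trig_const a : trig (fun=> a)
  | trig_mulz f : trig f -> trig (fun z => z *: f z)
  | trig_mulJ f : trig f -> trig (fun z => Num.conj z *: f z)
  | trig_add f g : trig f -> trig g -> trig (fun z => f z + g z).

Lemma trig_scale c f : trig f -> trig (fun z => c *: f z).
Proof.
elim=> [a|h _ IH|h _ IH|h1 h2 _ IH1 _ IH2].
- exact: trig_const.
- by under eq_fun do rewrite scalerA mulrC -scalerA; apply: trig_mulz.
- by under eq_fun do rewrite scalerA mulrC -scalerA; apply: trig_mulJ.
- by under eq_fun do rewrite scalerDr; apply: trig_add.
Qed.

Lemma trig_zX n f : trig f -> trig (fun z => z ^+ n *: f z).
Proof.
move=> tf; elim: n => [|n IH]; first by under eq_fun do rewrite expr0 scale1r.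
by under eq_fun do rewrite exprS -scalerA; apply: trig_mulz.
Qed.

Lemma trig_mul f g : trig f -> trig g -> trig (fun z => f z ** g z).
Proof.
move=> tf; move: g; elim: tf => [a|h _ IH|h _ IH|h1 h2 _ IH1 _ IH2] g tg.
- elim: tg => [b|h _ IH|h _ IH|h1 h2 _ IH1 _ IH2].
  + exact: trig_const.
  + by under eq_fun do rewrite cmulZr; apply: trig_mulz.
  + by under eq_fun do rewrite cmulZr; apply: trig_mulJ.
  + by under eq_fun do rewrite cmulDr; apply: trig_add.
- by under eq_fun do rewrite cmulZl; apply/trig_mulz/IH.
- by under eq_fun do rewrite cmulZl; apply/trig_mulJ/IH.
- by under eq_fun do rewrite cmulDl; apply: trig_add; [apply: IH1|apply: IH2].
Qed.

Lemma trig_adj f : trig f -> trig (fun z => cadj (f z)).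
Proof.
elim=> [a|h _ IH|h _ IH|h1 h2 _ IH1 _ IH2].
- exact: trig_const.
- by under eq_fun do rewrite cadjZ; apply: trig_mulJ.
- by under eq_fun do rewrite cadjZ conjCK; apply: trig_mulz.
- by under eq_fun do rewrite cadjD; apply: trig_add.
Qed.

Lemma trig_bounded f : trig f -> exists2 B : R, 0 <= B & forall z, nm z = 1 -> nm (f z) <= B.
Proof.
elim=> [a|h _ [B B0 hB]|h _ [B B0 hB]|h1 h2 _ [B B0 hB] _ [B' B0' hB']].
- by exists (nm a); rewrite ?nm_ge0.
- by exists B => // z z1; rewrite nmZ z1 mul1r hB.
- by exists B => // z z1; rewrite nmZ nm_conj z1 mul1r hB.
- exists (B + B') => [|z z1]; first exact: addr_ge0.
  by apply: le_trans (nmD _ _) _; apply: lerD; [apply: hB|apply: hB'].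
Qed.

(* The analogue of [slow] for functions on the circle with values in [A]. *)
Definition vslow f := forall e : R, 0 < e -> exists n0, forall n, (n0 <= n)%N ->
  forall z, nm z = 1 -> nm (f (zeta R n * z) - f z) <= e.

(** The common core of multiplication by [z] and by [conj z]: [v] is the character and [u n] its
    value at [zeta n]. *)
Lemma vslow_scale (u : nat -> C) (v : C -> C) f (B : R) :
  (forall e : R, 0 < e -> exists n0, forall n, (n0 <= n)%N -> nm (u n - 1) <= e) ->
  (forall n z, nm z = 1 -> v (zeta R n * z) = u n * v z) ->
  (forall z, nm z = 1 -> nm (v z) = 1) ->
  0 <= B -> (forall z, nm z = 1 -> nm (f z) <= B) -> vslow f ->
  vslow (fun z => v z *: f z).
Proof.
move=> hu hv v1 B0 hB sf e e0.
have [n1 h1] := hu (e / 2 / (B + 1)) ltac:(rewrite divr_gt0; lra).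
have [n2 h2] := sf (e / 2) ltac:(lra).
exists (maxn n1 n2) => n; rewrite geq_max => /andP[ln1 ln2] z z1.
have zz1 : nm (zeta R n * z) = 1 by rewrite nmM nm_zeta z1 mulr1.
have -> : v (zeta R n * z) *: f (zeta R n * z) - v z *: f z =
    ((u n - 1) * v z) *: f (zeta R n * z) + v z *: (f (zeta R n * z) - f z).
  by rewrite hv //; linear_ring.
apply: le_trans (nmD _ _) _; rewrite !nmZ nmM v1 // mul1r mulr1.
have := h2 n ln2 z z1; have := h1 n ln1; rewrite ler_pdivlMr; last lra.
have := hB _ zz1; have := nm_ge0 (u n - 1); set t := nm (f (zeta R n * z)).
by have : 0 <= t := nm_ge0 _; nra.
Qed.

Lemma trig_slow f : trig f -> vslow f.
Proof.
elim=> [a|h th IH|h th IH|h1 h2 _ IH1 _ IH2].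
- by move=> e e0; exists 0%N => n _ z _; rewrite subrr nm0 ltW.
- have [B B0 hB] := trig_bounded th.
  by apply: (vslow_scale (u := zeta R) (v := id) (B := B)) IH => //; apply: zeta_cvg.
- have [B B0 hB] := trig_bounded th.
  apply: (vslow_scale (u := fun n => Num.conj (zeta R n)) (B := B)) IH => //.
  + move=> e /zeta_cvg [n0 hn]; exists n0 => n /hn.
    by rewrite -[nm (zeta R n - 1)]nm_conj rmorphB /= conjC1.
  + by move=> n z _; rewrite rmorphM.
  + by move=> z; rewrite nm_conj.
- move=> e e0; have [n1 hn1] := IH1 (e / 2) ltac:(lra).
  have [n2 hn2] := IH2 (e / 2) ltac:(lra).
  exists (maxn n1 n2) => n; rewrite geq_max => /andP[ln1 ln2] z z1.
  rewrite opprD addrACA; apply: le_trans (nmD _ _) _.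
  by have := hn1 n ln1 z z1; have := hn2 n ln2 z z1; lra.
Qed.

End TrigonometricPolynomials.

(** * Determinants along loops and homotopies *)

Section QuasidetLoops.
Variables (R : realType) (A : cstarAlgType R) (F : set A) (d : A -> R[i]).
Hypotheses (subF : cstar_subalgebra F) (qd : quasidet F d).
Let C := R[i].

Lemma pow_near_one (r : nat) (e : R) : 0 < e -> exists2 t : R, 0 < t & (1 + t) ^+ r - 1 <= e.
Proof.
move=> e0.
have key (t : R) : 0 <= t <= 1 -> (1 + t) ^+ r - 1 <= (2 ^+ r - 1) * t.
  move=> /andP[t0 t1]; elim: r => [|n IH]; first by rewrite !expr0 !subrr mul0r.
  rewrite !exprS; have : 1 <= (2 : R) ^+ n by rewrite exprn_ege1 // ler1n.
  move: IH; set a := (1 + t) ^+ n; set b := 2 ^+ n => IH b1.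
  have h1 : 0 <= (b - 1) * (t * (1 - t)) by rewrite !mulr_ge0 //; lra.
  have h2 : 0 <= (1 + t) * ((b - 1) * t - (a - 1)) by rewrite mulr_ge0 //; lra.
  lra.
have b1 : 1 <= (2 : R) ^+ r by rewrite exprn_ege1 // ler1n.
have m0 : 0 < Num.min 1 (e / 2 ^+ r) by rewrite lt_min ltr01 divr_gt0 // exprn_gt0.
exists (Num.min 1 (e / 2 ^+ r)) => //; apply: le_trans (key _ _) _.
  by rewrite (ltW m0) ge_min lexx.
have : Num.min 1 (e / 2 ^+ r) <= e / 2 ^+ r by rewrite ge_min lexx orbT.
by rewrite ler_pdivlMr ?exprn_gt0 //; move: m0; set t := Num.min _ _; nra.
Qed.

Lemma quasidet_slow (X : C -> A) (k : R) : 0 < k -> (forall z, F (X z)) ->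
  (forall z v, nm z = 1 -> k * nm v <= nm (v + X z ** v)) ->
  vslow X -> slow (fun z => d (X z)).
Proof.
move=> k0 FX lb sX e e0; have [r hr] := quasidet_ratio qd.
have [t t0 ht] := pow_near_one r e0.
have [n0 hn] := sX (t * k) (mulr_gt0 t0 k0).
exists n0 => n ln z z1; apply: le_trans ht.
have := hr k (t * k) (X z) (X (zeta R n * z)) k0 (FX _) (FX _).
rewrite mulfK ?lt0r_neq0 //; apply=> [v _|]; first exact: lb.
exact: hn.
Qed.

(** The uniform bound [k] turns Lipschitz dependence of [X] on [s] into the multiplicative
    continuity of [d] that [rootable_homotopy] asks for. *)
Lemma quasidet_homotopy q (X : R -> C -> A) (k K : R) : (0 < q)%N -> 0 < k -> 0 < K ->
  (forall s z, F (X s z)) ->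
  (forall s z v, 0 <= s <= 1 -> nm z = 1 -> k * nm v <= nm (v + X s z ** v)) ->
  (forall s, 0 <= s <= 1 -> vslow (X s)) ->
  (forall s t z, 0 <= s <= 1 -> 0 <= t <= 1 -> nm z = 1 ->
    nm (X s z - X t z) <= K * `|s - t|) ->
  rootable q (fun z => d (X 0 z)) -> rootable q (fun z => d (X 1 z)).
Proof.
move=> q0 k0 K0 FX lb sX lX; apply: (rootable_homotopy (D := fun s z => d (X s z))) => //.
  by move=> s s01; apply: (quasidet_slow (k := k)) (sX s s01) => // z v z1; apply: lb.
move=> e e0; have [r hr] := quasidet_ratio qd.
have [t t0 ht] := pow_near_one r e0.
exists (t * k / K); first by rewrite divr_gt0 // mulr_gt0.
move=> a b a01 b01 ab z z1; apply: le_trans ht.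
have := hr k (t * k) (X b z) (X a z) k0 (FX _ _) (FX _ _).
rewrite mulfK ?lt0r_neq0 //; apply=> [v _|]; first exact: (lb b z v b01 z1).
apply: le_trans (lX _ _ _ _ _ _) _ => //.
by rewrite mulrC -ler_pdivlMr.
Qed.

End QuasidetLoops.

(** * Paths of invertible elements *)

Section InvertiblePath.
Variables (R : realType) (A : cstarAlgType R) (F : set A) (d : A -> R[i]).
Hypotheses (subF : cstar_subalgebra F) (qd : quasidet F d).
Let C := R[i].

(** Parabolic arcs from 0 to 1, one for each [t]; arcs for different [t] meet only at the end
    points. *)
Definition bent_path (t s : R) : C := Complex s (t * (s * (1 - s))).

Lemma bent_path0 t : bent_path t 0 = 0.
Proof. by rewrite /bent_path mul0r mulr0. Qed.

Lemma bent_path1 t : bent_path t 1 = 1.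
Proof. by rewrite /bent_path subrr !mulr0. Qed.

Lemma nm_le_ReIm (z : C) : nm z <= `|complex.Re z| + `|complex.Im z|.
Proof.
rewrite -(@ler_pXn2r _ 2) ?nnegrE ?nm_ge0 ?addr_ge0 // nm_sqr.
rewrite -[complex.Re z ^+ 2]real_normK ?num_real // -[complex.Im z ^+ 2]real_normK ?num_real //.
by have := mulr_ge0 (normr_ge0 (complex.Re z)) (normr_ge0 (complex.Im z)); nra.
Qed.

Lemma bent_path_lipschitz t a b : 0 <= a <= 1 -> 0 <= b <= 1 ->
  nm (bent_path t a - bent_path t b) <= (1 + `|t|) * `|a - b|.
Proof.
move=> /andP[a0 a1] /andP[b0 b1]; apply: le_trans (nm_le_ReIm _) _.
rewrite /bent_path /= mulrDl mul1r lerD2l.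
have -> : t * (a * (1 - a)) + - (t * (b * (1 - b))) = t * (a - b) * (1 - a - b) by ring.
rewrite normrM normrM ler_piMr ?mulr_ge0 // ler_norml; lra.
Qed.

(* The roots of finitely many linear factors miss all but finitely many of
   the arcs from [0] to [1]. *)
Lemma bent_path_avoids (l : seq C) : (forall a, a \in l -> 1 + a != 0) ->
  exists t, forall s a, a \in l -> 1 + bent_path t s * a != 0.
Proof.
move=> hl.
(* The parameter of the only arc that can pass through [-1/a]; a [t] larger than all of them avoids
   every such point. *)
pose bad (a : C) := complex.Im (- a^-1) / (complex.Re (- a^-1) * (1 - complex.Re (- a^-1))).
exists (1 + \sum_(a <- l) `|bad a|) => s a al; apply/eqP => h0.
have a0 : a != 0 by apply/eqP => e; move: h0; rewrite e mulr0 addr0 => /eqP; rewrite oner_eq0.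
have hc : bent_path (1 + \sum_(a <- l) `|bad a|) s = - a^-1.
  apply: (mulIf a0); rewrite mulNr mulVf //; apply/eqP.
  by rewrite -subr_eq0 opprK addrC h0.
have s0 : s != 0.
  by apply/eqP => e; move: h0; rewrite e bent_path0 mul0r addr0 => /eqP; rewrite oner_eq0.
have s1 : 1 - s != 0.
  rewrite subr_eq0; apply/eqP => e; move: h0; rewrite -e bent_path1 mul1r => /eqP.
  by rewrite (negPf (hl _ al)).
have : bad a = 1 + \sum_(a <- l) `|bad a|.
  by rewrite /bad -hc /bent_path /=; field; rewrite ?s0 ?s1.
have : `|bad a| <= \sum_(a <- l) `|bad a|.
  rewrite (big_rem a al) /= lerDl; apply: sumr_ge0 => *; exact: normr_ge0.
by have := ler_norm (bad a); lra.
Qed.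

(** Off the roots of its linear factors the determinant is non-zero, so each [1 + c(s) x] has a
    quasi-inverse [y] in [F] and is bounded below by [1 / (1 + |y|)]. As [y] multiplies any [v], the
    bound is not confined to [F]. *)
Lemma bent_path_bounded_below x : F x -> d x != 0 -> exists t,
  exists2 k : R, 0 < k & forall s v, 0 <= s <= 1 ->
    k * nm v <= nm (v + (bent_path t s *: x) ** v).
Proof.
move=> Fx dx; have [l hl] := quasidet_scale qd Fx.
have FZ c y : F y -> F (c *: y) by have [_ [_ _ h _ _]] := subF; apply: h.
have [|t ht] := @bent_path_avoids l.
  move=> a al; apply/eqP => h0; move/eqP: dx; apply.
  by rewrite -(scale1r x) hl (big_rem a al) /= mul1r h0 mul0r.
exists t.
pose c := bent_path t.
pose P (k s : R) := 0 <= s <= 1 -> forall v, k * nm v <= nm (v + (c s *: x) ** v).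
(* Compactness in near-covering form: half of the bound at [s] absorbs the Lipschitz variation of
   the arc near [s], and one small [k] serves the whole interval. *)
have /compact_near_coveringP cov := @segment_compact R 0 1.
have near_s (s : R) : `[0, 1]%classic s -> \forall s' \near s & k \near (0 : R)^'+, P k s'.
  rewrite /= in_itv /= => s01.
  have [|y _ [_ yx]] := quasidet_inv qd (FZ (c s) x Fx).
    by rewrite hl prodf_seq_neq0; apply/allP => a al; apply/ht.
  pose k0 := (1 + nm y)^-1; have ny := nm_ge0 y.
  have k00 : 0 < k0 by rewrite invr_gt0; lra.
  have lb v : k0 * nm v <= nm (v + (c s *: x) ** v).
    rewrite ler_pdivrMl; last lra.
    set w := v + _; have -> : v = w + y ** w.
      have e : (c s *: x + y + y ** (c s *: x)) ** v = 0 by rewrite yx cmul0l.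
      by rewrite -[LHS]addr0 -e /w; cstar_ring.
    rewrite mulrDl mul1r; apply: le_trans (nmD _ _) _; rewrite lerD2l.
    exact: nm_cmul.
  have K1 : 0 < (1 + `|t|) * (nm x + 1).
    by apply: mulr_gt0; [have := normr_ge0 t|have := nm_ge0 x]; lra.
  have e0 : 0 < k0 / 2 / ((1 + `|t|) * (nm x + 1)) by rewrite !divr_gt0.
  exists ([set s' | `|s - s'| < k0 / 2 / ((1 + `|t|) * (nm x + 1))], [set k | k < k0 / 2]).
    split; first by apply: nbhsx_ballx.
    by apply: nbhs_right_lt; lra.
  move=> [s' k] /= [hs hk] s01' v.
  apply: le_trans (_ : (k0 - k0 / 2) * nm v <= _).
    by apply: ler_wpM2r; [apply: nm_ge0|lra].
  apply: (lower_bound_perturb (lb v)).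
  rewrite -scalerBl nmZ; have := bent_path_lipschitz t s01 s01'.
  move: hs; rewrite ltr_pdivlMr //.
  rewrite -/c; have := nm_ge0 x; have := nm_ge0 (c s - c s').
  set u := nm (c s - c s'); set n := nm x; set r := `|s - s'|; move=> u0 n0 h1 h2.
  have : u * n <= (1 + `|t|) * r * n by apply: ler_wpM2r.
  have : 0 <= (1 + `|t|) * r by have := normr_ge0 t; have : 0 <= r := normr_ge0 _; nra.
  nra.
have hP := cov R 0^'+ P _ near_s.
have [k [k0 hk]] : exists k : R, 0 < k /\ `[0, 1]%classic `<=` P k.
  near (0 : R)^'+ => k; exists k; split; first by near: k; apply: nbhs_right_gt.
  by near: k; exact: hP.
by exists k => // s v s01; apply: hk => //; rewrite /= in_itv.
Unshelve. all: by end_near. Qed.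

End InvertiblePath.

(** A trigonometric polynomial has finitely many coefficients, so one stage of the filtration
    approximates the whole loop. *)
Lemma trig_AF_approx (R : realType) (A : cstarAlgType R) (F : nat -> set A) :
  (forall n, cstar_subalgebra (F n)) -> (forall n, F n `<=` F n.+1) ->
  closure (\bigcup_n F n) = setT -> forall f, trig f -> forall e : R, 0 < e ->
  exists m g, [/\ trig g, forall z, F m (g z) &
    forall z, nm z = 1 -> nm (f z - g z) <= e].
Proof.
move=> subF incF denseF f; elim=> [a|h _ IH|h _ IH|h1 h2 _ IH1 _ IH2] e e0.
- have [m [y Fy ay]] := AF_approx denseF a e0.
  by exists m, (fun=> y); split=> //; apply: trig_const.
- have [m [g [tg Fg hg]]] := IH e e0; exists m, (fun z => z *: g z); split.
  + exact: trig_mulz.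
  + by move=> z; have [_ [_ _ FZ _ _]] := subF m; apply: FZ.
  + by move=> z z1; rewrite -scalerBr nmZ z1 mul1r hg.
- have [m [g [tg Fg hg]]] := IH e e0; exists m, (fun z => Num.conj z *: g z); split.
  + exact: trig_mulJ.
  + by move=> z; have [_ [_ _ FZ _ _]] := subF m; apply: FZ.
  + by move=> z z1; rewrite -scalerBr nmZ nm_conj z1 mul1r hg.
- have [m1 [g1 [tg1 Fg1 hg1]]] := IH1 (e / 2) ltac:(lra).
  have [m2 [g2 [tg2 Fg2 hg2]]] := IH2 (e / 2) ltac:(lra).
  exists (maxn m1 m2), (fun z => g1 z + g2 z); split; first exact: trig_add.
    move=> z; have [_ [_ FD _ _ _]] := subF (maxn m1 m2).
    by apply: FD; [apply: AF_mono (Fg1 z)|apply: AF_mono (Fg2 z)] => //;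
       rewrite ?leq_maxl ?leq_maxr.
  move=> z z1; rewrite opprD addrACA; apply: le_trans (nmD _ _) _.
  by have := hg1 z z1; have := hg2 z z1; lra.
Qed.

(** * Homogeneous unitaries under a circle action *)

Section HomogeneousUnitary.
Variables (R : realType) (A : cstarAlgType R).
Let C := R[i].

(** The hypothesis reads [(1 + y)^* (1 + y) = 1]. *)
Lemma nm_quasiunitary (y v : A) : y + cadj y + cadj y ** y = 0 -> nm (v + y ** v) = nm v.
Proof.
move=> h; apply: nm_eq_of_cstar; rewrite cadjD cadjM.
have -> : (cadj v + cadj v ** cadj y) ** (v + y ** v) =
    cadj v ** v + cadj v ** (y + cadj y + cadj y ** y) ** v by cstar_ring.
by rewrite h cmul0r cmul0l addr0.
Qed.

Variables (gam : C -> {linear A -> A}).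
Hypotheses (gam_hom : forall z, nm z = 1 -> star_hom (gam z))
  (gamK : forall z v, nm z = 1 -> gam z (gam (Num.conj z) v) = v)
  (gam_trig : forall x (e : R), 0 < e -> exists2 f, trig f &
    forall z, nm z = 1 -> nm (gam z x - f z) <= e).

Lemma nm_gam z v : nm z = 1 -> nm (gam z v) = nm v.
Proof.
move=> z1; apply/eqP; rewrite eq_le nm_star_hom; last exact: gam_hom.
have zj1 : nm (Num.conj z) = 1 by rewrite nm_conj.
by rewrite -{1}(gamK v zj1) conjCK nm_star_hom //; apply: gam_hom.
Qed.

Lemma bounded_below_gam z (c : C) (k : R) x v : nm z = 1 ->
  (forall w, k * nm w <= nm (w + (c *: x) ** w)) ->
  k * nm v <= nm (v + (c *: gam z x) ** v).
Proof.
move=> z1 h; have [gM _] := gam_hom z1.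
have [w vE] : exists w, v = gam z w by exists (gam (Num.conj z) v); rewrite gamK.
have -> : v + (c *: gam z x) ** v = gam z (w + (c *: x) ** w).
  have -> : gam z (w + (c *: x) ** w) = gam z w + gam z ((c *: x) ** w) by exact: raddfD.
  by rewrite gM -vE; congr (_ + _ ** _); rewrite linearZ.
by rewrite {1}vE !nm_gam //; apply: h.
Qed.

Variables (V p : A) (n : nat).
Hypotheses (ps : cadj p = p) (VV : cadj V ** V = p) (pV : p ** V = V) (Vp : V ** p = V)
  (p0 : p <> 0) (n0 : (0 < n)%N)
  (gamV : forall z, nm z = 1 -> gam z V = z ^+ n *: V).

(* [1 + (z ^ n V - p)] is a loop of unitaries.  If [A] were AF, its constant
   factor [1 + (V - p)] could be connected to [1], and moving the connecting
   path by the circle action would contract the loop; but its determinant in a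
   finite-dimensional subalgebra has winding number [n r], [r] being the rank of
   an idempotent close to [p]. *)
Lemma homogeneous_unitary_not_AF : ~ AF A.
Proof.
move=> [F [subF fdF incF denseF]].
have FD m x y : F m x -> F m y -> F m (x + y) by have [_ [_ h _ _ _]] := subF m; apply: h.
have FZ m (c : C) x : F m x -> F m (c *: x) by have [_ [_ _ h _ _]] := subF m; apply: h.
have FM m x y : F m x -> F m y -> F m (x ** y) by have [_ [_ _ _ h _]] := subF m; apply: h.
have pp : p ** p = p by rewrite -{1}VV -cmulA Vp VV.
have np : nm p = 1.
  have := nm_cstar p; rewrite ps pp expr2 => h.
  have np0 : nm p != 0 by apply/eqP => /nm_eq0.
  by apply: (mulIf np0); rewrite mul1r -h.
have Vsp : cadj V ** p = cadj V by rewrite -{1}ps -cadjM pV.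
have pVs : p ** cadj V = cadj V by rewrite -{1}ps -cadjM Vp.
pose Y (w : C) := w *: V - p.
have isoY w v : nm w = 1 -> nm (v + Y w ** v) = nm v.
  move=> w1; apply: nm_quasiunitary; rewrite /Y cadjB cadjZ ps.
  rewrite !cmulE pp VV Vsp pV scalerA nm_unit // scale1r; linear_ring.
have Y1 : Y 1 = V - p by rewrite /Y scale1r.
have gamY z : nm z = 1 -> gam z (V - p) = Y (z ^+ n).
  move=> z1; have [gM gs] := gam_hom z1.
  have -> : gam z (V - p) = gam z V - gam z p by exact: raddfB.
  rewrite -[in gam z p]VV gM gs gamV // cadjZ cmulZl cmulZr VV scalerA.
  by rewrite [_ * z ^+ n]mulrC nm_unit ?scale1r // nmX z1 expr1n.
have nu0 : nm (V - p) <= 2.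
  apply: le_trans (nmB _ _) _; rewrite np.
  by have := nm_cstar V; rewrite VV np; have := nm_ge0 V; nra.
have [m0 [x Fx hx]] := AF_approx denseF (V - p) (ltac:(lra) : (0 : R) < 1 / 8).
have [d0 qd0] := quasidet_exists (subF m0) (fdF m0).
have d0x : d0 x != 0.
  apply: (quasidet_neq0 qd0) => // v Fv hv; apply/nm_eq0.
  have : (1 - 1 / 8) * nm v <= nm (v + x ** v).
    by apply: lower_bound_perturb hx; rewrite -Y1 isoY ?nm1 // mul1r.
  by rewrite hv nm0; have := nm_ge0 v; lra.
have [t [k k0 hk]] := bent_path_bounded_below (subF m0) qd0 Fx d0x.
pose c := bent_path t; pose K : R := 1 + `|t|.
have K1 : 1 <= K by rewrite lerDl.
have I0 : 0 <= (0 : R) <= 1 by rewrite lexx ler01.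
have cK s : 0 <= s <= 1 -> nm (c s) <= K.
  move=> s01; have := bent_path_lipschitz t s01 I0.
  rewrite bent_path0 !subr0 => /le_trans; apply.
  by case/andP: s01 => s0 s1; rewrite (ger0_norm s0) -/K ler_piMr //; lra.
(* [g z] will be within [2 e] of [gam z x]. As [|c s| <= K], the first bound leaves [k / 2] of the
   lower bound along the moved arc; the second keeps [g z] close to [Y (z ^+ n)]. *)
pose e : R := Num.min (k / 4 / K) (1 / 32).
have e0 : 0 < e by rewrite lt_min !divr_gt0 //; lra.
have eK : e * K <= k / 4 by rewrite -ler_pdivlMr ?ge_min ?lexx //; lra.
have e32 : e <= 1 / 32 by rewrite ge_min lexx orbT.
have [f tf hf] := gam_trig x e0.
have [m1 [g [tg Fg hg]]] := trig_AF_approx subF incF denseF tf e0.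
have [m2 [x2 Fx2 hx2]] := AF_approx denseF p (ltac:(lra) : (0 : R) < 1 / 400).
have [i Fi [ii hi]] := idempotent_near subF ps pp Fx2 hx2.
have [m3 [u Fu hu]] := AF_approx denseF (V - p) (ltac:(lra) : (0 : R) < 1 / 100).
pose m := maxn m1 (maxn m2 m3).
have {}Fg z : F m (g z) by apply: AF_mono incF _ _ _ _ (Fg z); apply: leq_maxl.
have {}Fi : F m i.
  by apply: AF_mono incF _ _ _ _ Fi; rewrite leq_max leq_max leqnn orbT.
have {}Fu : F m u.
  by apply: AF_mono incF _ _ _ _ Fu; rewrite leq_max leq_max leqnn !orbT.
have i0 : i <> 0 by move=> h; move: hi; rewrite h sub0r nmN np; lra.
have [d qd] := quasidet_exists (subF m) (fdF m).
have {}hg z : nm z = 1 -> nm (gam z x - g z) <= 2 * e.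
  move=> z1; apply: le_trans (nm_tri (f z) _ _) _.
  by have := hf z z1; have := hg z z1; lra.
have [B B0 hB] := trig_bounded tg.
(* [1 + eta z = (1 + (z^n - 1) i)(1 + u)] imitates [1 + Y (z^n) = (1 + (z^n - 1) p)(1 + (V - p))].
   The variable [z] sits beside an exact idempotent, so the determinant is exactly a constant times
   a power of [z]. *)
pose eta z := (z ^+ n - 1) *: i + u + ((z ^+ n - 1) *: i) ** u.
have teta : trig eta.
  have -> : eta = fun z => z ^+ n *: (i + i ** u) + (u - i - i ** u).
    by apply/funext => z; rewrite /eta; cstar_ring.
  by apply: trig_add (trig_const _); apply/trig_zX/trig_const.
have Feta z : F m (eta z) by apply/FD/FM => //; [apply/FD => //|]; apply/FZ.
have [B' B0' hB'] := trig_bounded teta.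
have hetaY z : nm z = 1 -> nm (Y (z ^+ n) - eta z) <= 3 / 4.
  move=> z1; set w := z ^+ n.
  have w1 : nm (w - 1) <= 2.
    by apply: le_trans (nmB _ _) _; rewrite /w nmX z1 expr1n nm1.
  have -> : Y w - eta z = (w - 1) *: (p - i) + (V - p - u) +
      (w - 1) *: ((p - i) ** (V - p) + i ** (V - p - u)) + (w - 1) *: (p ** p - p)
      - (w - 1) *: (p ** V - V).
    by rewrite /Y /eta -/w; cstar_ring.
  rewrite pp pV !subrr !scaler0 addr0 subr0.
  have h1 := nmD ((w - 1) *: (p - i) + (V - p - u))
    ((w - 1) *: ((p - i) ** (V - p) + i ** (V - p - u))).
  have h2 := nmD ((w - 1) *: (p - i)) (V - p - u).
  have h3 := nmD ((p - i) ** (V - p)) (i ** (V - p - u)).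
  have h4 := nm_cmul (p - i) (V - p); have h5 := nm_cmul i (V - p - u).
  have ni : nm i <= 108 / 100 by have := nm_leD i (p - i); rewrite subrKC np nmBC; lra.
  rewrite !nmZ in h1 h2; rewrite nmBC in hi.
  move: h1 h2 h3 h4 h5 ni hi hu w1 nu0.
  have := nm_ge0 ((p - i) ** (V - p) + i ** (V - p - u)).
  have := nm_ge0 (V - p); have := nm_ge0 (V - p - u); have := nm_ge0 (w - 1).
  have := nm_ge0 (p - i); have := nm_ge0 i.
  set x1 := nm i; set x2' := nm (p - i); set x3 := nm (w - 1); set x4 := nm (V - p - u).
  set x5 := nm (V - p); set x6 := nm (_ ** _ + _); set x7 := nm (_ *: _ + _).
  set x8 := nm (_ ** (V - p)); set x9 := nm (i ** _).
  move=> ? ? ? ? ? ? h1 h2 h3 h4 h5 *.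
  have : x8 <= 16 / 100 by nra.
  have : x9 <= 2 / 100 by nra.
  move=> ? ?; have : x6 <= 18 / 100 by lra.
  nra.
have hgY z : nm z = 1 -> nm (Y (z ^+ n) - g z) <= 3 / 4.
  move=> z1; apply: le_trans (nm_tri (gam z x) _ _) _.
  by rewrite -gamY // -raddfB nm_gam //; have := hg z z1; lra.
have [r r0 hr] : exists2 r, (0 < r)%N & forall z, d (eta z) = d u * z ^+ (n * r).
  have [r r0 hr] := quasidet_idempotent qd Fi ii i0.
  exists r => // y; rewrite (quasidetD qd) //; last exact: FZ.
  by rewrite hr subrKC mulrC exprM.
have du : d u != 0.
  apply: (quasidet_neq0 qd) => // v Fv hv; apply/nm_eq0.
  have : (1 - 1 / 100) * nm v <= nm (v + u ** v).
    by apply: lower_bound_perturb hu; rewrite -Y1 isoY ?nm1 // mul1r.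
  by rewrite hv nm0; have := nm_ge0 v; lra.
pose s := (n * r)%N; have s0 : (0 < s)%N by rewrite muln_gt0 n0.
have q0 : (0 < 2 ^ s)%N by rewrite expn_gt0.
(* The exponent [s] of the loop also fixes the root to extract, as [s < 2^s]. *)
apply: (@power_not_rootable R s s (d u) s0 (ltn_expl _ _) du) => //.
have -> : (fun z => d u * z ^+ s) = fun z => d (eta z) by apply/funext => z; rewrite hr.
have root_g : rootable (2 ^ s) (fun z => d (g z)).
  have -> : (fun z => d (g z)) = fun z => d (c 1 *: g z).
    by apply/funext => z; rewrite /c bent_path1 scale1r.
  apply: (quasidet_homotopy qd (X := fun a z => c a *: g z) (k := k / 2) (K := K * (B + 1))) => //.
  - by rewrite divr_gt0.
  - by rewrite mulr_gt0 //; lra.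
  - by move=> a z; apply: FZ.
  - move=> a z v a01 z1; apply: le_trans (_ : (k - k / 2) * nm v <= _).
      by rewrite [k - _](_ : _ = k / 2) //; field.
    apply: (lower_bound_perturb (x := c a *: gam z x)).
      by apply: bounded_below_gam => // w; apply: hk.
    rewrite -scalerBr nmZ; have := cK a a01; have := hg z z1.
    by have := nm_ge0 (gam z x - g z); have := nm_ge0 (c a); nra.
  - by move=> a a01; apply/trig_slow/trig_scale.
  - move=> a b z a01 b01 z1; rewrite -scalerBl nmZ.
    have := bent_path_lipschitz t a01 b01; rewrite -/c -/K; have := hB z z1.
    have := nm_ge0 (c a - c b); have := normr_ge0 (a - b); have := nm_ge0 (g z).
    set x1 := nm (g z); set x2' := `|_|; set x3 := nm (_ - _) => ? ? ? ? h.
    apply: le_trans (_ : K * x2' * (B + 1) <= _); last by rewrite mulrAC.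
    by apply: ler_pM => //; lra.
  - have -> : (fun z => d (c 0 *: g z)) = fun=> 1; last exact: rootable_one.
    by apply/funext => z; rewrite /c bent_path0 scale0r (quasidet0 qd).
pose rc := real_complex R.
(* A straight line joins the two approximations: both [g z] and [eta z] lie within 3/4 of
   [Y (z ^+ n)], which acts isometrically, so the line stays bounded below by 1/4. *)
pose X a z := rc (1 - a) *: g z + rc a *: eta z.
have X0 z : X 0 z = g z by rewrite /X subr0 /rc rmorph1 rmorph0 scale1r scale0r addr0.
have X1 z : X 1 z = eta z by rewrite /X subrr /rc rmorph1 rmorph0 scale1r scale0r add0r.
have -> : (fun z => d (eta z)) = fun z => d (X 1 z) by apply/funext => z; rewrite X1.
have nrc a : 0 <= a -> nm (rc a) = a by move=> a0; rewrite /rc nm_real ger0_norm.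
apply: (quasidet_homotopy qd (X := X) (k := 1 / 4) (K := B + B' + 1)) => //.
- lra.
- by move=> a z; apply/FD; apply/FZ.
- move=> a z v /andP[a0 a1] z1; apply: le_trans (_ : (1 - 3 / 4) * nm v <= _).
    by apply: ler_wpM2r; [apply: nm_ge0|lra].
  have w1 : nm (z ^+ n) = 1 by rewrite nmX z1 expr1n.
  apply: (lower_bound_perturb (x := Y (z ^+ n))); first by rewrite mul1r isoY.
  have -> : Y (z ^+ n) - X a z = rc (1 - a) *: (Y (z ^+ n) - g z) + rc a *: (Y (z ^+ n) - eta z).
    by rewrite /X /rc rmorphB rmorph1 /=; linear_ring.
  apply: le_trans (nmD _ _) _; rewrite !nmZ !nrc ?subr_ge0 //.
  have := hetaY z z1; have := hgY z z1.
  set y1 := nm _; set y2 := nm _; nra.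
- move=> a a01; apply/trig_slow; apply: trig_add; exact: trig_scale.
- move=> a b z a01 b01 z1.
  have -> : X a z - X b z = rc (a - b) *: (eta z - g z).
    by rewrite /X /rc !rmorphB rmorph1 /=; linear_ring.
  rewrite nmZ /rc nm_real mulrC; apply: ler_wpM2r; first exact: normr_ge0.
  by apply: le_trans (nmB _ _) _; have := hB z z1; have := hB' z z1; lra.
- by have -> : (fun z => d (X 0 z)) = fun z => d (g z) by apply/funext => z; rewrite X0.
Qed.

End HomogeneousUnitary.

(** * Paths in a k-graph *)

Section KGraphPaths.
Variables (k : nat) (L : kgraph k).
Implicit Types (l m n p q v mu nu : L).

Definition initial l m : Prop := exists2 n, kg_s l = kg_r n & m = kg_comp l n.

Definition degree_le (a b : degree k) : Prop := forall i, (a i <= b i)%N.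

Lemma degree_addI (a b c : degree k) : a + b = a + c -> b = c.
Proof.
move=> h; apply/ffunP => i; apply: (@addnI (a i)).
by have := congr1 (fun f : degree k => f i) h; rewrite !ffunE.
Qed.

Lemma kg_comp_inj l m l' m' : kg_s l = kg_r m -> kg_s l' = kg_r m' ->
  kg_comp l m = kg_comp l' m' -> kg_d l = kg_d l' -> l = l' /\ m = m'.
Proof.
move=> lm lm' e dl.
have d1 := kg_d_comp lm; have d2 := kg_d_comp lm'.
have [x [_ xU]] := kg_factorisation d1.
have h1 := xU (l, m) (And4 erefl erefl lm erefl).
have dm : kg_d m' = kg_d m.
  by apply: (@degree_addI (kg_d l)); rewrite -d1 e d2 dl.
have h2 := xU (l', m') (And4 (esym dl) dm lm' e).
by rewrite h1 in h2; case: h2.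
Qed.

Lemma kg_compI l m m' : kg_s l = kg_r m -> kg_s l = kg_r m' ->
  kg_comp l m = kg_comp l m' -> m = m'.
Proof. by move=> lm lm' e; have [] := kg_comp_inj lm lm' e erefl. Qed.

Lemma vertices_s l : vertices (kg_s l).
Proof. by rewrite /vertices /= -(kg_rs l) kg_d_id. Qed.

Lemma vertices_rE v : vertices v -> kg_r v = v.
Proof. by move/verticesP. Qed.

Lemma vertices_sE v : vertices v -> kg_s v = v.
Proof. by move=> hv; rewrite -{1}(vertices_rE hv) kg_sr vertices_rE. Qed.

Lemma initial_refl l : initial l l.
Proof. by exists (kg_s l); rewrite ?kg_rs ?kg_comp_id_r. Qed.

Lemma initial_trans l m n : initial l m -> initial m n -> initial l n.
Proof.
move=> [a la ->] [b mb ->]; rewrite kg_s_comp // in mb.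
by exists (kg_comp a b); rewrite ?kg_r_comp ?kg_compA.
Qed.

Lemma initial_comp l m : kg_s l = kg_r m -> initial l (kg_comp l m).
Proof. by exists m. Qed.

Lemma initial_compl l m n : kg_s l = kg_r m -> initial m n ->
  initial (kg_comp l m) (kg_comp l n).
Proof.
move=> lm [a ma ->]; exists a; first by rewrite kg_s_comp.
by rewrite kg_compA.
Qed.

Lemma initial_compr l m n : kg_s l = kg_r m -> kg_s l = kg_r n ->
  initial (kg_comp l m) (kg_comp l n) -> initial m n.
Proof.
move=> lm ln [a]; rewrite kg_s_comp // => ma.
rewrite -kg_compA // => /kg_compI -> //; last by rewrite kg_r_comp.
by exists a.
Qed.

Lemma initial_r l m : initial l m -> kg_r l = kg_r m.
Proof. by move=> [a la ->]; rewrite kg_r_comp. Qed.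

Lemma initial_degree l m : initial l m -> degree_le (kg_d l) (kg_d m).
Proof. by move=> [a la ->] i; rewrite kg_d_comp // ffunE leq_addr. Qed.

Lemma initial_factor l (e : degree k) : degree_le e (kg_d l) ->
  exists2 p, initial p l & kg_d p = e.
Proof.
move=> le.
have : kg_d l = e + [ffun i => kg_d l i - e i]%N.
  by apply/ffunP => i; rewrite !ffunE; apply/esym/subnKC.
by move=> /kg_factorisation [[p q] [[/= dp _ pq ->] _]]; exists p => //; exists q.
Qed.

(** The prefix of [q] of degree [d(p)] is also a prefix of [l], and by unique factorisation [l] has
    only one prefix of that degree. *)
Lemma initial_le l p q : initial p l -> initial q l -> degree_le (kg_d p) (kg_d q) ->
  initial p q.
Proof.
move=> [a pa la] [b qb lb] /initial_factor [p' [c pc qE] dp].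
have h : kg_comp p a = kg_comp p' (kg_comp c b).
  by rewrite -la lb qE kg_compA // -qb qE kg_s_comp.
have cb : kg_s c = kg_r b by rewrite -qb qE kg_s_comp.
have pcb : kg_s p' = kg_r (kg_comp c b) by rewrite kg_r_comp.
by have [-> _] := kg_comp_inj pa pcb h (esym dp); exists c.
Qed.

Lemma initial_antisym l m : initial l m -> initial m l -> l = m.
Proof.
move=> lm ml; have [a la e] := lm.
have : kg_d a = 0.
  apply: (@degree_addI (kg_d l)); rewrite -kg_d_comp // -e addr0; apply/ffunP => i.
  by apply/eqP; rewrite eqn_leq; rewrite (initial_degree lm) (initial_degree ml).
by move=> /vertices_rE ra; rewrite e -ra -la kg_comp_id_r.
Qed.

Definition compatible l m := exists2 p, initial l p & initial m p.

Lemma MCE_initial l m p : MCE l m p -> initial l p /\ initial m p.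
Proof. by case=> _ [a la pa] [b mb pb]; split; [exists a|exists b]. Qed.

Lemma degree_joinP (a b c : degree k) :
  degree_le a c -> degree_le b c -> degree_le (degree_join a b) c.
Proof. by move=> ac bc i; rewrite ffunE geq_max ac bc. Qed.

(** The prefix of [p] whose degree is the join. Thus arbitrary common extensions can be used in
    place of minimal ones. *)
Lemma MCE_of_common l m p : initial l p -> initial m p ->
  exists2 q, MCE l m q & initial q p.
Proof.
move=> lp mp; have [q qp dq] := initial_factor
  (degree_joinP (initial_degree lp) (initial_degree mp)).
exists q => //; split=> //.
  have [a la ->] : initial l q.
    by apply: initial_le lp qp _ => i; rewrite dq ffunE leq_maxl.
  by exists a.
have [a la ->] : initial m q.
  by apply: initial_le mp qp _ => i; rewrite dq ffunE leq_maxr.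
by exists a.
Qed.

Lemma compatibleP l m : compatible l m <-> MCE l m !=set0.
Proof.
split=> [[p lp mp]|[p /MCE_initial [lp mp]]]; last by exists p.
by have [q hq _] := MCE_of_common lp mp; exists q.
Qed.

(** By left cancellation a pair is determined by its composite, an element of the finite set
    [MCE mu nu]. *)
Lemma finite_MCE_pairs (L_fa : finitely_aligned L) mu nu : finite_set (MCE_pairs mu nu).
Proof.
have fin := L_fa mu nu.
apply: (@sub_finite_set _ _ ([set p | exists2 l, MCE mu nu l &
   [/\ kg_s mu = kg_r p.1, kg_s nu = kg_r p.2, l = kg_comp mu p.1 & l = kg_comp nu p.2]])).
  by move=> p [h1 h2 h3 h4]; exists (kg_comp mu p.1).
pose f l : L * L := xget (mu, mu) [set p : L * L |
   [/\ kg_s mu = kg_r p.1, kg_s nu = kg_r p.2, l = kg_comp mu p.1 & l = kg_comp nu p.2]].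
apply: sub_finite_set (finite_image f fin) => p [l hl hp]; exists l => //.
rewrite /f; case: xgetP => [q _ [q1 q2 q3 q4]|/(_ p) h]; last by case: h.
case: hp => p1 p2 p3 p4; case: p p1 p2 p3 p4 => a b /= p1 p2 p3 p4.
case: q q1 q2 q3 q4 => c d /= q1 q2 q3 q4.
by rewrite (kg_compI p1 q1) -?p3 // (kg_compI p2 q2) -?p4.
Qed.

Definition completions mu nu : set L := fst @` MCE_pairs mu nu.

(** A common extension of [mu t] and [nu] has a prefix [mu a] in [MCE(mu, nu)]; cancelling [mu]
    leaves a common extension of [t] and [a]. *)
Lemma completions_exhaustive mu nu : generalised_cycle mu nu ->
  exhaustive (kg_s mu) (completions mu nu).
Proof.
move=> [_ ss rr h]; split=> [l [p [p1 _ _ _] <-] /=|t rt]; first by rewrite p1.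
have [l /MCE_initial [h1 h2]] := h t rt.
have mt : kg_s mu = kg_r t by rewrite rt.
have [q hq ql] := MCE_of_common (initial_trans (initial_comp mt) h1) h2.
have [_ [a ma qa] [b nb qb]] := hq.
exists a; first by exists (a, b) => //; split=> //=; rewrite -?qa.
apply/compatibleP; have [c tc lc] := h1.
rewrite kg_s_comp // in tc.
have lE : l = kg_comp mu (kg_comp t c) by rewrite lc kg_compA.
exists (kg_comp t c); first by exists c.
apply: (@initial_compr mu) => //; first by rewrite kg_r_comp.
by rewrite -lE -qa.
Qed.

(** For [t = s(mu)] the condition gives a common extension of [mu] and [nu]; with equal degrees
    these would be the same prefix of it. *)
Lemma generalised_cycle_degree mu nu : generalised_cycle mu nu -> kg_d mu <> kg_d nu.
Proof.
move=> [ne ss _ h] dd; apply: ne.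
have [|l] := h (kg_s mu); first by rewrite kg_rs.
rewrite kg_comp_id_r => -[_ [a ma la] [b nb lb]].
by have [] := kg_comp_inj ma nb (etrans (esym la) lb) dd.
Qed.

End KGraphPaths.

(** * Cuntz-Krieger families *)

Section CuntzKrieger.
Variables (R : realType) (k : nat) (L : kgraph k) (A : cstarAlgType R) (s : L -> A).
Hypotheses (L_fa : finitely_aligned L) (CK : CK_family s).
Implicit Types (l mu nu v : L).

Lemma CK_vertex_adj v : vertices v -> cadj (s v) = s v.
Proof. by move=> /(ck1_proj CK) []. Qed.

Lemma CK_mul_source l : s l ** s (kg_s l) = s l.
Proof. by rewrite (ck2 CK) ?kg_rs // kg_comp_id_r. Qed.

Lemma CK_adj_mul l : cadj (s l) ** s l = s (kg_s l).
Proof.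
rewrite (ck3 CK).
have -> : MCE_pairs l l = [set (kg_s l, kg_s l)].
  apply/seteqP; split => [[a b] /= [la lb ab [dl _ _]]|_ ->].
    rewrite /= in la lb ab dl; have eab := kg_compI la lb ab.
    have : kg_d a = 0.
      apply: (@degree_addI _ (kg_d l)); rewrite -kg_d_comp // dl.
      by apply/ffunP => i; rewrite !ffunE maxnn; apply/esym/addn0.
    by move=> /vertices_rE ra; rewrite -eab -ra -la.
  have h : initial l (kg_comp l (kg_s l)) by apply: initial_comp; rewrite kg_rs.
  split; rewrite /= ?kg_rs //; split=> //.
  by rewrite kg_comp_id_r; apply/ffunP => i; rewrite !ffunE maxnn.
rewrite fsbig_set1 /= (CK_vertex_adj (vertices_s l)).
by have [_ ->] := ck1_proj CK (vertices_s l).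
Qed.

Lemma CK_adj_source l : s (kg_s l) ** cadj (s l) = cadj (s l).
Proof. by rewrite -(CK_vertex_adj (vertices_s l)) -cadjM CK_mul_source. Qed.

Definition range_proj l : A := s l ** cadj (s l).

Lemma range_proj_adj l : cadj (range_proj l) = range_proj l.
Proof. by rewrite /range_proj cadjM cadjK. Qed.

Lemma range_proj_mul l : range_proj l ** s l = s l.
Proof. by rewrite /range_proj -cmulA CK_adj_mul CK_mul_source. Qed.

Lemma mul_range_proj l : cadj (s l) ** range_proj l = cadj (s l).
Proof. by rewrite -(range_proj_adj l) -cadjM range_proj_mul. Qed.

Lemma range_proj_idem l : range_proj l ** range_proj l = range_proj l.
Proof. by rewrite {1}/range_proj -cmulA mul_range_proj. Qed.

(** Each factor acts on [x] from the right as [s v], that is, trivially. When (CK4) makes the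
    product vanish, so does [x]. *)
Lemma mul_gaps_fixed v (r : seq L) (x : A) : x ** s v = x ->
  (forall l, l \in r -> x ** range_proj l = 0) ->
  x ** \big[@cmul R A/s v]_(l <- r) (s v - range_proj l) = x.
Proof.
move=> xv; elim: r => [|l r IH] h; first by rewrite big_nil.
rewrite big_cons cmulA cmulBr xv h ?mem_head // subr0 IH // => m mr.
by apply: h; rewrite inE mr orbT.
Qed.

(** For [mu a = nu b], the range of [s_mu s_a = s_nu s_b] lies under the range projection of [nu].
    So what that projection misses of [s_mu] is fixed by every gap at a completion [a], and (CK4)
    makes it zero. *)
Lemma generalised_cycle_range mu nu : generalised_cycle mu nu ->
  range_proj nu ** s mu = s mu.
Proof.
move=> gc; have fin : finite_set (completions mu nu).
  by apply: finite_image; apply: finite_MCE_pairs.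
have := completions_exhaustive gc; rewrite -(fset_setK fin) => ex.
have := ck4 CK (vertices_s mu) ex => h.
apply/esym/subr0_eq; pose x := s mu - range_proj nu ** s mu.
rewrite -/x -(@mul_gaps_fixed (kg_s mu) (fset_set (completions mu nu)) x).
- by rewrite /range_proj h cmul0r.
- by rewrite /x cmulBl -cmulA CK_mul_source.
- move=> l; rewrite in_fset_set // inE => -[[a b] /= [/= ma nb ab _] <-].
  have e : s mu ** s a = s nu ** s b by rewrite !(ck2 CK) // ab.
  rewrite /x cmulBl -[range_proj nu ** _ ** _]cmulA {2 3}/range_proj.
  by rewrite !cmulA e -[range_proj nu ** _ ** _]cmulA e cmulA range_proj_mul subrr.
Qed.

Variable i : 'I_k.

Definition gauge (z : R[i]) l : A := z ^+ (kg_d l i) *: s l.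

(** With integer exponents the two sides are [z^(b - a)] and [z^(c - e)]. This is the homogeneity of
    (CK3), where [d(mu) + d(alpha) = d(nu) + d(beta)]. *)
Lemma unit_circle_exp (z : R[i]) a b c e : nm z = 1 -> (a + c = b + e)%N ->
  Num.conj z ^+ a * z ^+ b = z ^+ c * Num.conj z ^+ e.
Proof.
move=> z1 h; have zz := nm_unit z1.
have z0 : z != 0 by rewrite -nm_gt0 z1.
apply: (mulIf (expf_neq0 a z0)); apply: (mulIf (expf_neq0 e z0)).
have -> : Num.conj z ^+ a * z ^+ b * z ^+ a * z ^+ e = (z * Num.conj z) ^+ a * z ^+ (b + e).
  by rewrite exprMn exprD; ring.
have -> : z ^+ c * Num.conj z ^+ e * z ^+ a * z ^+ e = (z * Num.conj z) ^+ e * z ^+ (a + c).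
  by rewrite exprMn exprD; ring.
by rewrite zz !expr1n h.
Qed.

Lemma gauge_CK (z : R[i]) : nm z = 1 -> CK_family (gauge z).
Proof.
move=> z1.
have gv v : vertices v -> gauge z v = s v.
  by rewrite /vertices /= /gauge => ->; rewrite ffunE expr0 scale1r.
have gg l m : gauge z l ** cadj (gauge z m) =
    (z ^+ (kg_d l i) * Num.conj z ^+ (kg_d m i)) *: (s l ** cadj (s m)).
  by rewrite /gauge cadjZ cmulZl cmulZr scalerA rmorphXn.
split=> [v vv|v w vv ww vw|mu nu mn|mu nu|v E vv ex].
- by rewrite gv //; exact: (ck1_proj CK vv).
- by rewrite !gv //; exact: (ck1_orth CK vv ww vw).
- by rewrite /gauge cmulZl cmulZr scalerA (ck2 CK mn) kg_d_comp // ffunE exprD.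
- have -> : cadj (gauge z mu) ** gauge z nu =
      (Num.conj z ^+ (kg_d mu i) * z ^+ (kg_d nu i)) *: (cadj (s mu) ** s nu).
    by rewrite /gauge cadjZ cmulZl cmulZr scalerA rmorphXn.
  have fin := finite_MCE_pairs L_fa mu nu.
  rewrite (ck3 CK) !fsbig_finite //= scaler_sumr.
  apply: eq_big_seq => -[a b]; rewrite in_fset_set // inE => -[/= ma nb ab _].
  rewrite gg; congr (_ *: _); apply: unit_circle_exp => //.
  have := congr1 (fun l => kg_d l i) ab.
  by rewrite !kg_d_comp // !ffunE.
- rewrite gv //; under eq_bigr do rewrite gg -exprMn nm_unit // expr1n scale1r.
  exact: (ck4 CK vv ex).
Qed.

End CuntzKrieger.

(** * Closures of subalgebras and the gauge action of one coordinate circle *)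

Section ClosureSubalgebra.
Variables (R : realType) (A : cstarAlgType R).

Lemma cstar_subalgebra_closure (S : set A) :
  [/\ S 0, forall x y, S x -> S y -> S (x + y),
      forall (c : R[i]) x, S x -> S (c *: x),
      forall x y, S x -> S y -> S (x ** y)
    & forall x, S x -> S (cadj x)] -> cstar_subalgebra (closure S).
Proof.
move=> [S0 SD SZ SM SJ]; split; first exact: closed_closure.
split=> [|x y|c x|x y|x].
- exact: subset_closure.
- move=> /closure_nmP hx /closure_nmP hy; apply/closure_nmP => e e0.
  have [x' Sx xx] := hx (e / 2) ltac:(lra); have [y' Sy yy] := hy (e / 2) ltac:(lra).
  exists (x' + y'); first exact: SD.
  by rewrite opprD addrACA; apply: le_trans (nmD _ _) _; lra.
- move=> /closure_nmP hx; apply/closure_nmP => e e0.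
  have n0 := nm_ge0 c; have [|x' Sx xx] := hx (e / (nm c + 1)); first by rewrite divr_gt0 //; lra.
  exists (c *: x'); first exact: SZ.
  rewrite -scalerBr nmZ; move: xx; rewrite ler_pdivlMr; last lra.
  by have := nm_ge0 (x - x'); lra.
- move=> /closure_nmP hx /closure_nmP hy; apply/closure_nmP => e e0.
  have nx := nm_ge0 x; have ny := nm_ge0 y.
  have m0 : 0 < Num.min 1 (e / 2 / (nm x + nm y + 1)).
    by rewrite lt_min ltr01 !divr_gt0 //; lra.
  have [x' Sx] := hx _ m0; have [y' Sy] := hy _ m0.
  rewrite !le_min !ler_pdivlMr; try lra.
  move=> /andP[y1 y2] /andP[x1 x2].
  exists (x' ** y'); first exact: SM.
  have -> : x ** y - x' ** y' = x ** (y - y') + (x - x') ** (y - (y - y')) by cstar_ring.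
  apply: le_trans (nmD _ _) _.
  have h1 := nm_cmul x (y - y'); have h2 := nm_cmul (x - x') (y - (y - y')).
  have h3 := nmB y (y - y'); have := nm_ge0 (x - x'); have := nm_ge0 (y - y').
  have : nm (x - x') * nm (y - (y - y')) <= nm (x - x') * (nm y + 1).
    by apply: ler_wpM2l; [apply: nm_ge0|lra].
  have : 0 <= nm (x - x') * nm x by rewrite mulr_ge0 ?nm_ge0.
  have : 0 <= nm (y - y') * (nm y + 1) by rewrite mulr_ge0 ?nm_ge0 //; lra.
  lra.
- move=> /closure_nmP hx; apply/closure_nmP => e e0.
  have [x' Sx xx] := hx e e0; exists (cadj x'); first exact: SJ.
  by rewrite -cadjB nm_adj.
Qed.

End ClosureSubalgebra.

Section GaugeAction.
Variables (R : realType) (k : nat) (L : kgraph k) (A : cstarAlgType R) (s : L -> A).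
Hypotheses (L_fa : finitely_aligned L) (univ : is_graph_cstar_algebra s).
Variable i : 'I_k.

(** Universality yields [gam z]. The last two clauses are checked on generators: the elements
    satisfying the inversion law form a closed subalgebra, and those with trigonometric orbit form a
    subalgebra, which is therefore dense; contractivity passes to the limit. *)
Lemma gauge_action_exists : exists gam : R[i] -> {linear A -> A},
  [/\ forall z, nm z = 1 -> star_hom (gam z),
      forall z l, nm z = 1 -> gam z (s l) = gauge s i z l,
      forall z v, nm z = 1 -> gam z (gam (Num.conj z) v) = v
    & forall x (e : R), 0 < e -> exists2 f, trig f &
        forall z, nm z = 1 -> nm (gam z x - f z) <= e].
Proof.
have [CK gen ext] := univ.
have /choice [gam hgam] : forall z : R[i], exists f : {linear A -> A},
    nm z = 1 -> star_hom f /\ forall l, f (s l) = gauge s i z l.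
  (* Off the circle the identity map is a default value. *)
  move=> z; have [z1|nz] := pselect (nm z = 1); last first.
    by exists idfun => /nz.
  by have [f f1 f2] := ext A _ (gauge_CK L_fa CK i z1); exists f.
have gl z l : nm z = 1 -> gam z (s l) = gauge s i z l by move=> z1; apply: (hgam z z1).2.
have gh z : nm z = 1 -> star_hom (gam z) by move=> z1; apply: (hgam z z1).1.
have gD z x y : gam z (x + y) = gam z x + gam z y by exact: raddfD.
have gZ z c x : gam z (c *: x) = c *: gam z x by exact: linearZ.
have gB z x y : gam z (x - y) = gam z x - gam z y by exact: raddfB.
exists gam; split=> // [z v z1|x e e0].
  have zj : nm (Num.conj z) = 1 by rewrite nm_conj.
  have [gM gs] := gh z z1; have [gM' gs'] := gh _ zj.
  pose S := [set x | gam z (gam (Num.conj z) x) - x = 0].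
  suff h : S = setT.
    have : S v by rewrite h.
    exact: subr0_eq.
  apply: gen; last first.
    move=> l; rewrite /S /= gl // /gauge gZ gl // /gauge scalerA -exprMn mulrC.
    by rewrite nm_unit // expr1n scale1r subrr.
  split.
    apply: (@closed_kernel _ _ _ 2) => x y.
    rewrite opprD addrACA -gB -gB -opprD; apply: le_trans (nmB _ _) _.
    have := nm_star_hom (x - y) (gh _ zj).
    have := nm_star_hom (gam (Num.conj z) (x - y)) (gh z z1); lra.
  have SE x : S x <-> gam z (gam (Num.conj z) x) = x.
    by split=> [/subr0_eq//|h]; rewrite /S /= h subrr.
  split=> [|x y /SE hx /SE hy|c x /SE hx|x y /SE hx /SE hy|x /SE hx]; apply/SE.
  - by rewrite !raddf0.
  - by rewrite !gD hx hy.
  - by rewrite !gZ hx.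
  - by rewrite gM' gM hx hy.
  - by rewrite gs' gs hx.
pose S := [set x | exists2 f, trig f & forall z, nm z = 1 -> gam z x = f z].
have : closure S x.
  rewrite (_ : closure S = setT) //; apply: gen; last first.
    move=> l; apply: subset_closure; exists (fun z => z ^+ (kg_d l i) *: s l).
      exact/trig_zX/trig_const.
    by move=> z z1; rewrite gl.
  apply: cstar_subalgebra_closure.
  split=> [|a b [f tf hf] [g tg hg]|c a [f tf hf]|a b [f tf hf] [g tg hg]|a [f tf hf]].
  - by exists (fun=> 0); [exact: trig_const|move=> z _; rewrite raddf0].
  - exists (fun z => f z + g z); first exact: trig_add.
    by move=> z z1; rewrite gD hf // hg.
  - exists (fun z => c *: f z); first exact: trig_scale.
    by move=> z z1; rewrite gZ hf.
  - exists (fun z => f z ** g z); first exact: trig_mul.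
    by move=> z z1; have [gM _] := gh z z1; rewrite gM hf // hg.
  - exists (fun z => cadj (f z)); first exact: trig_adj.
    by move=> z z1; have [_ gs] := gh z z1; rewrite gs hf.
move=> /closure_nmP /(_ e e0) [y [f tf hf] xy]; exists f => // z z1.
by rewrite -hf // -gB; apply: le_trans (nm_star_hom _ (gh z z1)) xy.
Qed.

End GaugeAction.

(** * Generalised cycles contradict the AF property *)

Section NotAF.
Variables (R : realType) (k : nat) (L : kgraph k) (A : cstarAlgType R) (s : L -> A).
Hypotheses (L_fa : finitely_aligned L) (univ : is_graph_cstar_algebra s) (af : AF A).

Let CK : CK_family s. Proof. by case: univ. Qed.

(** In the proof [p] belongs to [nu] and [q] to [mu]. From [p V = V = q V] and [q p = q], the
    element [p - q] annihilates the isometry [1 + (V - p)] from the left, so [AF_isometry] makes it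
    zero. *)
Lemma AF_range_eq mu nu : generalised_cycle mu nu -> range_proj s mu = range_proj s nu.
Proof.
move=> gc; have [F [subF fdF incF denseF]] := af.
have pm := generalised_cycle_range L_fa CK gc.
have [_ ss rr _] := gc.
pose p := range_proj s nu; pose V := s mu ** cadj (s nu).
have ps : cadj p = p := range_proj_adj s nu.
have pp : p ** p = p := range_proj_idem CK nu.
have Vs : cadj V = s nu ** cadj (s mu) by rewrite cadjM cadjK.
have VV : cadj V ** V = p.
  by rewrite Vs /V -cmulA [cadj (s mu) ** _]cmulA (CK_adj_mul CK) ss (CK_adj_source CK).
have pV : p ** V = V by rewrite /V cmulA pm.
have Vp : V ** p = V by rewrite /V -cmulA (mul_range_proj CK).
have qV : range_proj s mu ** V = V by rewrite /V cmulA (range_proj_mul CK).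
have qp : range_proj s mu ** p = range_proj s mu.
  have : p ** range_proj s mu = range_proj s mu by rewrite {1 2}/range_proj cmulA pm.
  by move=> h; rewrite -(range_proj_adj s mu) -{1}ps -cadjM h.
have Vsp : cadj V ** p = cadj V by rewrite -{1}ps -cadjM pV.
apply/esym/subr0_eq; rewrite -/p; set q := range_proj s mu in qV qp *.
clearbody p V q; apply: (AF_isometry subF fdF denseF (x := V - p)).
  move=> v; apply: nm_quasiunitary; rewrite cadjB ps !cmulE pp VV Vsp pV; linear_ring.
by rewrite !cmulE pV qV pp qp; linear_ring.
Qed.

Lemma AF_no_generalised_cycle mu nu : s (kg_s nu) <> 0 -> generalised_cycle mu nu -> False.
Proof.
move=> s0 gc; have e := AF_range_eq gc.
have [_ ss rr _] := gc.
have [i ne] : exists i, kg_d mu i != kg_d nu i.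
  apply: contrapT => h; apply: (generalised_cycle_degree gc); apply/ffunP => i.
  by apply/eqP/negPn/negP => h'; apply: h; exists i.
have [gam [gh gl gK gt]] := gauge_action_exists L_fa univ i.
(* Once the range projections agree the two paths play symmetric roles; [a] is the one with the
   larger [i]-th degree, so that the exponent of homogeneity is positive. *)
have main a b : kg_s a = kg_s b -> range_proj s a = range_proj s b -> s (kg_s b) <> 0 ->
    (kg_d b i < kg_d a i)%N -> False.
  move=> sab rab sb lt.
  pose p := range_proj s b; pose V := s a ** cadj (s b).
  apply: (@homogeneous_unitary_not_AF R A gam gh gK gt V p (kg_d a i - kg_d b i)%N) => //.
  - exact: range_proj_adj.
  - rewrite /V cadjM cadjK -cmulA [cadj (s a) ** _]cmulA (CK_adj_mul CK) sab.
    by rewrite (CK_adj_source CK).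
  - by rewrite /p -rab /V cmulA (range_proj_mul CK).
  - by rewrite /V -cmulA (mul_range_proj CK).
  - move=> p0; apply: sb; rewrite -(CK_adj_mul CK b) -[s b](range_proj_mul CK).
    by rewrite -/p p0 cmul0l cmul0r.
  - by rewrite subn_gt0.
  - move=> z z1; have [gM gs] := gh z z1.
    rewrite /V gM gs !gl // /gauge cadjZ cmulZl cmulZr scalerA rmorphXn /=.
    congr (_ *: _); rewrite -{1}(subnK (ltnW lt)) exprD -mulrA -exprMn nm_unit //.
    by rewrite expr1n mulr1.
move: ne; rewrite neq_ltn => /orP[lt|lt].
  by apply: (main nu mu) lt => //; rewrite ?ss // -e.
exact: (main mu nu) lt.
Qed.

End NotAF.

(** * Bounded operators on a Hilbert space *)

Section SquareSummable.
Variable R : realType.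
Let C := R[i].

(* The real inner product suffices: it determines adjoints of complex-linear
   maps, and spares limits of complex sequences. *)
Definition dot (f g : nat -> C) (j : nat) : R :=
  complex.Re (f j) * complex.Re (g j) + complex.Im (f j) * complex.Im (g j).

Lemma dotC (f g : nat -> C) : dot f g = dot g f.
Proof. by apply/funext => j; rewrite /dot mulrC [X in _ + X]mulrC. Qed.

Lemma dotDl (f g h : nat -> C) : dot (f + g) h = dot f h + dot g h.
Proof.
by apply/funext => j; rewrite /dot !fctE; case: (f j) (g j) => [a b] [c d] /=; ring.
Qed.

Lemma dot_ge0 (f : nat -> C) j : 0 <= dot f f j.
Proof. by rewrite /dot -!expr2 addr_ge0 ?sqr_ge0. Qed.

Definition square_summable : {pred nat -> C} :=
  fun f => `[< exists M, forall n, series (dot f f) n <= M >].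

Lemma square_summable_submod : submod_closed square_summable.
Proof.
split=> [|c f g /asboolP [M hM] /asboolP [N hN]]; apply/asboolP.
  exists 0 => n; rewrite /series /= big1 // => j _.
  by rewrite /dot /= !mul0r addr0.
exists (2 * (nm c ^+ 2 * M) + 2 * N) => n; rewrite /series /=.
apply: (@le_trans _ _ (\sum_(0 <= j < n) (2 * (nm c ^+ 2 * dot f f j) + 2 * dot g g j))).
  apply: ler_sum => j _; rewrite nm_sqr /dot !fctE.
  case: (f j) (g j) c => [a b] [x y] [u v] /=.
  rewrite -subr_ge0.
  have -> : 2 * ((u ^+ 2 + v ^+ 2) * (a * a + b * b)) + 2 * (x * x + y * y) -
    ((u * a - v * b + x) * (u * a - v * b + x) + (u * b + v * a + y) * (u * b + v * a + y)) =
    (u * a - v * b - x) ^+ 2 + (u * b + v * a - y) ^+ 2 by ring.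
  by rewrite addr_ge0 ?sqr_ge0.
rewrite big_split /= -!mulr_sumr; have := hM n; have := hN n; rewrite /series /=.
have : 0 <= nm c ^+ 2 by apply: sqr_ge0.
by set u := nm c ^+ 2; set s := \sum_(_ <= _ < _) _; set s' := \sum_(_ <= _ < _) _; nra.
Qed.

HB.instance Definition _ :=
  GRing.isSubmodClosed.Build C (nat -> C) square_summable square_summable_submod.

Record l2 : Type := L2 { l2val :> nat -> C; _ : l2val \in square_summable }.
HB.instance Definition _ := [isSub for l2val].
HB.instance Definition _ := [Choice of l2 by <:].
HB.instance Definition _ := [SubChoice_isSubLmodule of l2 by <:].

Implicit Types f g h : l2.

Lemma l2P (f g : l2) : (forall j, f j = g j) -> f = g.
Proof. by move=> h; apply/val_inj/funext. Qed.

Lemma l2D (f g : l2) j : (f + g) j = f j + g j. Proof. by []. Qed.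
Lemma l2B (f g : l2) j : (f - g) j = f j - g j. Proof. by []. Qed.
Lemma l2Z c (f : l2) j : (c *: f) j = c * f j. Proof. by []. Qed.
Lemma l20 j : (0 : l2) j = 0. Proof. by []. Qed.

Lemma cvg_series_sqr (f : l2) : cvgn (series (dot f f)).
Proof.
have /asboolP [M hM] := valP f.
apply: nondecreasing_is_cvgn.
  by apply: nondecreasing_series => j _ _; exact: dot_ge0.
by exists M => _ [n _ <-]; exact: hM.
Qed.

Lemma cvg_series_dot (f g : l2) : cvgn (series (dot f g)).
Proof.
have -> : dot f g = (2^-1 : R) *: (dot (f + g) (f + g) - dot f f - dot g g).
  apply/funext => j; rewrite !fctE /dot l2D; case: (f j) (g j) => [a b] [c d] /=.
  by rewrite /GRing.scale /=; field.
apply: is_cvg_seriesZ; apply: is_cvg_seriesB; first apply: is_cvg_seriesB.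
all: exact: cvg_series_sqr.
Qed.

Definition rip (f g : l2) : R := limn (series (dot f g)).

Lemma ripC f g : rip f g = rip g f.
Proof. by rewrite /rip dotC. Qed.

Lemma ripDl f g h : rip (f + g) h = rip f h + rip g h.
Proof. by rewrite /rip -lim_seriesD -?dotDl //; apply: cvg_series_dot. Qed.

Lemma ripZl (a : R) f g : rip (real_complex R a *: f) g = a * rip f g.
Proof.
rewrite /rip; have -> : dot (real_complex R a *: f) g = a *: dot f g.
  apply/funext => j; rewrite fctE /dot l2Z; case: (f j) (g j) => [x y] [u v] /=.
  by rewrite /GRing.scale /=; ring.
by rewrite lim_seriesZ //; apply: cvg_series_dot.
Qed.

Lemma ripNl f g : rip (- f) g = - rip f g.
Proof.
have -> : - f = real_complex R (-1) *: f by rewrite rmorphN1 scaleN1r.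
by rewrite ripZl mulN1r.
Qed.

Lemma ripBl f g h : rip (f - g) h = rip f h - rip g h.
Proof. by rewrite ripDl ripNl. Qed.

Lemma ripDr f g h : rip h (f + g) = rip h f + rip h g.
Proof. by rewrite ripC ripDl !(ripC h). Qed.

Lemma ripBr f g h : rip h (f - g) = rip h f - rip h g.
Proof. by rewrite ripC ripBl !(ripC h). Qed.

Lemma ripZr (a : R) f g : rip f (real_complex R a *: g) = a * rip f g.
Proof. by rewrite ripC ripZl ripC. Qed.

Lemma ripZ_conj (c : C) f g : rip (c *: f) g = rip f (Num.conj c *: g).
Proof.
rewrite /rip; congr (limn (series _)); apply/funext => j; rewrite /dot !l2Z.
by case: (f j) (g j) c => [x y] [u v] [a b] /=; ring.
Qed.

Lemma partial_le_rip f n : series (dot f f) n <= rip f f.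
Proof.
apply: nondecreasing_cvgn_le; last exact: cvg_series_sqr.
by apply: nondecreasing_series => j _ _; exact: dot_ge0.
Qed.

Lemma rip_le f M : (forall n, series (dot f f) n <= M) -> rip f f <= M.
Proof.
move=> h; apply: limr_le; first exact: cvg_series_sqr.
by apply: nearW.
Qed.

Lemma rip_ge0 f : 0 <= rip f f.
Proof. by apply: le_trans (partial_le_rip f 0); rewrite /series /= big_geq. Qed.

Lemma term_le_rip f j : nm (f j) ^+ 2 <= rip f f.
Proof.
apply: le_trans (partial_le_rip f j.+1); rewrite /series /= big_nat_recr //=.
rewrite nm_sqr /dot -!expr2 lerDr sumr_ge0 // => i _; exact: dot_ge0.
Qed.

Lemma rip_eq0 f : rip f f = 0 -> f = 0.
Proof.
move=> h; apply: l2P => j; rewrite l20; apply/nm_eq0/eqP.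
by rewrite -sqrf_eq0 eq_le sqr_ge0 andbT -h term_le_rip.
Qed.

Definition l2nm f : R := Num.sqrt (rip f f).

Lemma l2nm_ge0 f : 0 <= l2nm f. Proof. exact: sqrtr_ge0. Qed.

Lemma l2nm_sqr f : l2nm f ^+ 2 = rip f f.
Proof. by rewrite sqr_sqrtr // rip_ge0. Qed.

Lemma l2nm_le f a : 0 <= a -> rip f f <= a ^+ 2 -> l2nm f <= a.
Proof. by move=> a0 h; rewrite -(@ler_pXn2r _ 2) ?nnegrE ?l2nm_ge0 // l2nm_sqr. Qed.

Lemma l2nm0 : l2nm 0 = 0.
Proof. by rewrite /l2nm -(scale0r 0) -(rmorph0 (real_complex R)) ripZl mul0r sqrtr0. Qed.

Lemma l2nm_eq0 f : l2nm f = 0 -> f = 0.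
Proof. by move=> h; apply: rip_eq0; rewrite -l2nm_sqr h expr0n. Qed.

Lemma l2nmZ (c : C) f : l2nm (c *: f) = nm c * l2nm f.
Proof.
apply/eqP; rewrite -(@eqrXn2 _ 2) ?l2nm_ge0 ?mulr_ge0 ?nm_ge0 ?l2nm_ge0 //.
rewrite exprMn !l2nm_sqr ripZ_conj scalerA.
have -> : Num.conj c * c = real_complex R (nm c ^+ 2).
  by rewrite mulrC -normCK normE rmorphXn.
by rewrite ripZr.
Qed.

Lemma cauchy_schwarz f g : rip f g <= l2nm f * l2nm g.
Proof.
have [g0|g0] := eqVneq (l2nm g) 0.
  by rewrite g0 mulr0 (l2nm_eq0 g0) -(scale0r 0) -(rmorph0 (real_complex R)) ripZr mul0r.
have [f0|f0] := eqVneq (l2nm f) 0.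
  by rewrite f0 mul0r (l2nm_eq0 f0) -(scale0r 0) -(rmorph0 (real_complex R)) ripZl mul0r.
have fp : 0 < l2nm f by rewrite lt_neqAle eq_sym f0 l2nm_ge0.
have gp : 0 < l2nm g by rewrite lt_neqAle eq_sym g0 l2nm_ge0.
pose h := real_complex R (l2nm g) *: f - real_complex R (l2nm f) *: g.
have := rip_ge0 h.
rewrite /h !(ripBl, ripBr, ripZl, ripZr) -!l2nm_sqr (ripC g f).
move=> h1; have : 0 <= (l2nm f * l2nm g) * (l2nm f * l2nm g - rip f g) by nra.
by rewrite pmulr_rge0 ?mulr_gt0 // subr_ge0.
Qed.

Lemma l2nmD f g : l2nm (f + g) <= l2nm f + l2nm g.
Proof.
apply: l2nm_le; first by rewrite addr_ge0 ?l2nm_ge0.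
rewrite ripDl !ripDr (ripC g f) -!l2nm_sqr; have := cauchy_schwarz f g; nra.
Qed.

Lemma l2nmN f : l2nm (- f) = l2nm f.
Proof. by rewrite -scaleN1r l2nmZ nmN nm1 mul1r. Qed.

Lemma l2nmBC f g : l2nm (f - g) = l2nm (g - f).
Proof. by rewrite -opprB l2nmN. Qed.

Lemma l2nm_tri g f h : l2nm (f - h) <= l2nm (f - g) + l2nm (g - h).
Proof. by rewrite -[f - h](subrKA g) l2nmD. Qed.

Lemma rip_abs_le f g : `|rip f g| <= l2nm f * l2nm g.
Proof.
rewrite ler_norml cauchy_schwarz andbT lerNl -ripNl -(l2nmN f).
exact: cauchy_schwarz.
Qed.

(** The intervals of radius [2 M / 2 ^+ n] about [u n] are nested; the limit is the infimum of their
    right ends. *)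
Lemma real_geometric_cvg (u : nat -> R) (M : R) :
  (forall n, `|u n.+1 - u n| <= M / 2 ^+ n) ->
  exists l, forall n, `|u n - l| <= 2 * M / 2 ^+ n.
Proof.
move=> hu.
pose b n : R := 2 * M / 2 ^+ n.
have bS n : b n = 2 * b n.+1 by rewrite /b exprS; field; rewrite expf_neq0.
have hb n : `|u n.+1 - u n| <= b n.+1.
  apply: le_trans (hu n) _; rewrite /b exprS.
  by rewrite le_eqVlt; apply/orP; left; apply/eqP; field; rewrite expf_neq0.
have b0 n : 0 <= b n.
  by case: n => [|n]; [rewrite bS; have := le_trans (normr_ge0 _) (hb 0%N); lra|
     exact: le_trans (normr_ge0 _) (hb n)].
have dec m n : (m <= n)%N -> u n + b n <= u m + b m /\ u m - b m <= u n - b n.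
  move=> /subnKC <-; elim: (n - m)%N => [|i [IH1 IH2]]; first by rewrite addn0.
  rewrite addnS; have := hb (m + i)%N; rewrite ler_norml.
  have := bS (m + i)%N; split; lra.
have cross m n : u m - b m <= u n + b n.
  have [h1 h2] := dec _ _ (leq_maxl m n); have [h3 h4] := dec _ _ (leq_maxr m n).
  have := b0 (maxn m n); lra.
pose E := range (fun n => u n + b n).
have hE : has_inf E.
  split; first by exists (u 0%N + b 0%N), 0%N.
  by exists (u 0%N - b 0%N) => _ [n _ <-]; exact: cross.
exists (inf E) => n.
have h1 : inf E <= u n + b n by apply: ge_inf; [case: hE|exists n].
have h2 : u n - b n <= inf E.
  by apply: lb_le_inf; [case: hE|move=> _ [m _ <-]; exact: cross].
by rewrite ler_norml -/(b n); lra.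
Qed.

(** The limit is taken coordinatewise. Norm bounds pass to the limit in each finite partial sum, and
    a bound on all partial sums is both membership in the space and the estimate. *)
Lemma l2_geometric_cvg (u : nat -> l2) (M : R) :
  (forall n, l2nm (u n.+1 - u n) <= M / 2 ^+ n) ->
  exists l, forall n, l2nm (u n - l) <= 2 * M / 2 ^+ n.
Proof.
move=> hu.
have M0 : 0 <= M by have := le_trans (l2nm_ge0 _) (hu 0%N); rewrite expr0 divr1.
have hj j n : nm (u n.+1 j - u n j) <= M / 2 ^+ n.
  apply: le_trans (hu n); rewrite -(@ler_pXn2r _ 2) ?nnegrE ?l2nm_ge0 ?nm_ge0 //.
  by rewrite l2nm_sqr -l2B; apply: term_le_rip.
have /choice [x hx] : forall j, exists a, forall n, `|complex.Re (u n j) - a| <= 2 * M / 2 ^+ n.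
  move=> j; apply: (@real_geometric_cvg (fun n => complex.Re (u n j))) => n.
  apply: le_trans (hj j n); rewrite -raddfB /= -(@ler_pXn2r _ 2) ?nnegrE ?nm_ge0 //.
  by rewrite nm_sqr real_normK ?num_real // lerDl sqr_ge0.
have /choice [y hy] : forall j, exists a, forall n, `|complex.Im (u n j) - a| <= 2 * M / 2 ^+ n.
  move=> j; apply: (@real_geometric_cvg (fun n => complex.Im (u n j))) => n.
  apply: le_trans (hj j n); rewrite -raddfB /= -(@ler_pXn2r _ 2) ?nnegrE ?nm_ge0 //.
  by rewrite nm_sqr real_normK ?num_real // lerDr sqr_ge0.
have hp (k : nat) : 0 < (2 : R) ^+ k by rewrite exprn_gt0.
have hm n i : l2nm (u n - u (n + i)%N) <= 2 * M / 2 ^+ n.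
  suff : l2nm (u n - u (n + i)%N) <= 2 * M / 2 ^+ n - 2 * M / 2 ^+ (n + i).
    move=> /le_trans; apply.
    by rewrite lerBlDr lerDl divr_ge0 ?mulr_ge0 ?exprn_ge0.
  elim: i => [|i IH]; first by rewrite addn0 !subrr l2nm0.
  apply: le_trans (l2nm_tri (u (n + i)%N) _ _) _; rewrite addnS.
  have h1 := hu (n + i)%N; rewrite l2nmBC in h1.
  have h2 : 2 * M / 2 ^+ (n + i) - 2 * M / 2 ^+ (n + i).+1 = M / 2 ^+ (n + i).
    by rewrite exprS; field; rewrite lt0r_neq0.
  by move: IH h1 h2; set a := 2 * M / 2 ^+ (n + i); set b := 2 * M / 2 ^+ (n + i).+1; lra.
have cvgb : (fun m : nat => 2 * M / 2 ^+ m : R) @ \oo --> (0 : R).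
  have -> : (fun m : nat => 2 * M / 2 ^+ m : R) = fun m => 2 * M * 2^-1 ^+ m.
    by apply/funext => m; rewrite exprVn.
  rewrite -(mulr0 (2 * M)); apply: cvgMl_tmp; apply: cvg_expr.
  by rewrite ger0_norm ?invr_ge0 // invf_lt1 // ltr1n.
have cvg_close (v : nat -> R) a : (forall m, `|v m - a| <= 2 * M / 2 ^+ m) -> v @ \oo --> a.
  move=> hv; apply/cvgrPdist_le => e e0.
  have /cvgrPdist_le /(_ e e0) := cvgb; apply: filterS => m /=.
  rewrite sub0r normrN distrC => /(le_trans (ler_norm _)); exact: le_trans.
pose l j : C := Complex (x j) (y j).
pose dl n j : C := u n j - l j.
have part n (N : nat) : series (dot (dl n) (dl n)) N <= (2 * M / 2 ^+ n) ^+ 2.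
  have key : (fun m => series (dot (u n - u m)%R (u n - u m)%R) N) @ \oo -->
      series (dot (dl n) (dl n)) N.
    rewrite /series /=; apply: cvg_big => [|j _]; first exact: add_continuous.
    rewrite /dot.
    have cx := cvg_close _ _ (hx j); have cy := cvg_close _ _ (hy j).
    have e1 : (fun m => complex.Re ((u n - u m) j)) @ \oo --> complex.Re (dl n j).
      have -> : (fun m => complex.Re ((u n - u m) j)) = fun m => complex.Re (u n j) - complex.Re (u m j).
        by apply/funext => m; rewrite -raddfB.
      by rewrite /dl raddfB /=; apply: cvgB => //; exact: cvg_cst.
    have e2 : (fun m => complex.Im ((u n - u m) j)) @ \oo --> complex.Im (dl n j).
      have -> : (fun m => complex.Im ((u n - u m) j)) = fun m => complex.Im (u n j) - complex.Im (u m j).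
        by apply/funext => m; rewrite -raddfB.
      by rewrite /dl raddfB /=; apply: cvgB => //; exact: cvg_cst.
    by apply: cvgD; apply: cvgM.
  apply: (cvgr_to_le key); exists n => // m nm'.
  rewrite -[X in X <= _]/(series (dot (u n - u m) (u n - u m)) N).
  apply: le_trans (partial_le_rip _ _) _; rewrite -l2nm_sqr -(subnKC nm').
  by rewrite ler_pXn2r ?nnegrE ?l2nm_ge0 // (le_trans (l2nm_ge0 _) (hm n 0%N)).
have l_mem : (l : nat -> C) \in square_summable.
  have h0 : dl 0%N \in square_summable.
    by apply/asboolP; exists ((2 * M / 2 ^+ 0) ^+ 2); exact: part.
  have -> : l = (u 0%N : nat -> C) - dl 0%N.
    by apply/funext => j; rewrite -[RHS]/(u 0%N j - (u 0%N j - l j)) subKr.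
  by apply: rpredB => //; exact: valP.
exists (L2 l_mem) => n; apply: l2nm_le.
  by rewrite divr_ge0 ?mulr_ge0 // ltW.
by apply: rip_le => N; exact: part.
Qed.

End SquareSummable.

Section CompleteOfGeometric.
Variables (R : realType) (V : normedModType R[i]).

(** A Cauchy filter contains, for each [n], a ball of radius [1 / 2^n] about some [u n]; two sets of
    the filter meet, so consecutive centres are at distance at most [2 / 2^n]. *)
Lemma complete_of_geometric :
  (forall (u : nat -> V) (M : R), (forall n, nm (u n.+1 - u n) <= M / 2 ^+ n) ->
    exists l, forall n, nm (u n - l) <= 2 * M / 2 ^+ n) ->
  forall F : set_system V, ProperFilter F -> cauchy F -> cvg F.
Proof.
move=> hV F FF /cauchyP cF.
have /choice [u hu] : forall n : nat, exists x : V, F [set y | nm (x - y) < (1 : R) / 2 ^+ n].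
  move=> n; have e0 : 0 < (1 : R) / 2 ^+ n by rewrite divr_gt0 ?exprn_gt0.
  have [|x hx] := cF (real_complex R (1 / 2 ^+ n)); first by rewrite ltcR.
  exists x; apply: filterS hx => y; rewrite -ball_normE /= normE.
  by rewrite ltcR.
have [n|l hl] := hV u 2.
  have [y [/= h1 h2]] := filter_ex (filterI (hu n) (hu n.+1)).
  apply: le_trans (nm_tri y _ _) _; rewrite [nm (y - _)]nmBC.
  have : (1 : R) / 2 ^+ n.+1 <= 1 / 2 ^+ n.
    by rewrite ler_pM2l // lef_pV2 ?posrE ?exprn_gt0 // ler_weXn2l // ler1n.
  by move: h1 h2; rewrite -[2 / 2 ^+ n]/(2 * _) !mul1r; lra.
apply/cvg_ex; exists l => B /nbhs_nmP [e e0 hB].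
(* 5 is 1 for the distance from [y] to [u n] plus 4 for that from [u n] to the limit. *)
have [n hn] := @geometric_small _ 5 e (ltac:(lra)) e0.
apply: filterS (hu n) => y /= hy; apply: hB.
apply: le_lt_trans (nm_tri (u n) _ _) _; rewrite nmBC.
have := hl n; move: hy hn; rewrite mul1r.
by set t := _^-1; lra.
Qed.

End CompleteOfGeometric.

(** * The C*-algebra of bounded adjointable operators *)

Section BoundedOperators.
Variable R : realType.
Let C := R[i].
Let H := l2 R.
Implicit Types (f g : H) (S T : H -> H) (M : R).

Definition bounded_by T M := 0 <= M /\ forall f, l2nm (T f) <= M * l2nm f.
Definition adjoint_pair S T := forall f g, rip (S f) g = rip f (T g).
Definition lin T := forall (c : C) f g, T (c *: f + g) = c *: T f + T g.

(** The adjoint is demanded instead of derived from Riesz representation; the operators to be built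
    have explicit adjoints, and limits inherit them. *)
Definition adjointable : {pred H -> H} := fun T =>
  `[< [/\ lin T, exists M, bounded_by T M & exists S, adjoint_pair T S] >].

Lemma adjointable_submod : submod_closed adjointable.
Proof.
split=> [|c S T /asboolP [lS [M [M0 hM]] [S' hS]] /asboolP [lT [N [N0 hN]] [T' hT]]]; apply/asboolP.
  split.
  - by move=> c f g; rewrite scaler0 addr0.
  - by exists 0; split=> // f; rewrite l2nm0 mul0r.
  - by exists 0 => f g; rewrite /= -(scale0r 0) -(rmorph0 (real_complex R)) ripZl ripZr !mul0r.
split.
- move=> a f g; rewrite !fctE lS lT; linear_ring.
- exists (nm c * M + N); split; first by rewrite addr_ge0 ?mulr_ge0 ?nm_ge0.
  move=> f; rewrite !fctE; apply: le_trans (l2nmD _ _) _; rewrite l2nmZ mulrDl; apply: lerD => //.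
  by rewrite -mulrA; apply: ler_wpM2l; rewrite ?nm_ge0.
- exists (fun g => S' (Num.conj c *: g) + T' g) => f g; rewrite !fctE.
  by rewrite ripDl ripDr ripZ_conj hS hT.
Qed.

HB.instance Definition _ :=
  GRing.isSubmodClosed.Build C (H -> H) adjointable adjointable_submod.

Record bop : Type := Bop { bopval :> H -> H; _ : bopval \in adjointable }.
HB.instance Definition _ := [isSub for bopval].
HB.instance Definition _ := [Choice of bop by <:].
HB.instance Definition _ := [SubChoice_isSubLmodule of bop by <:].

Implicit Types (A B : bop).

Lemma bopP A B : (forall f, A f = B f) -> A = B.
Proof. by move=> h; apply/val_inj/funext. Qed.

Lemma bopD A B f : (A + B) f = A f + B f. Proof. by []. Qed.
Lemma bopB A B f : (A - B) f = A f - B f. Proof. by []. Qed.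
Lemma bopZ c A f : (c *: A) f = c *: A f. Proof. by []. Qed.
Lemma bop0 f : (0 : bop) f = 0. Proof. by []. Qed.

Lemma bop_lin A : lin A.
Proof. by have /asboolP [] := valP A. Qed.

Lemma bop_linD A f g : A (f + g) = A f + A g.
Proof. by rewrite -[f]scale1r bop_lin !scale1r. Qed.

Lemma bop_lin0 A : A 0 = 0.
Proof. by apply: (addrI (A 0)); rewrite -bop_linD !addr0. Qed.

Lemma bop_linZ A c f : A (c *: f) = c *: A f.
Proof. by rewrite -[c *: f]addr0 bop_lin bop_lin0 addr0. Qed.

Definition opnorm A : R := inf [set M | bounded_by A M].

Lemma opnorm_has_inf A : has_inf [set M | bounded_by A M].
Proof.
have /asboolP [_ [M hM] _] := valP A.
by split; [exists M|exists 0 => N []].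
Qed.

Lemma opnorm_ge0 A : 0 <= opnorm A.
Proof. by apply: lb_le_inf; [case: (opnorm_has_inf A)|move=> N []]. Qed.

Lemma opnorm_le A M : 0 <= M -> (forall f, l2nm (A f) <= M * l2nm f) -> opnorm A <= M.
Proof. by move=> M0 h; apply: ge_inf; [case: (opnorm_has_inf A)|split]. Qed.

Lemma opnormP A f : l2nm (A f) <= opnorm A * l2nm f.
Proof.
have [f0|f0] := eqVneq (l2nm f) 0.
  by rewrite (l2nm_eq0 f0) bop_lin0 l2nm0 mulr0.
have fp : 0 < l2nm f by rewrite lt_neqAle eq_sym f0 l2nm_ge0.
rewrite -ler_pdivrMr //; apply: lb_le_inf; first by case: (opnorm_has_inf A).
by move=> N [_ hN]; rewrite ler_pdivrMr.
Qed.

Lemma opnormD A B : opnorm (A + B) <= opnorm A + opnorm B.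
Proof.
apply: opnorm_le => [|f]; first by rewrite addr_ge0 ?opnorm_ge0.
rewrite bopD mulrDl; apply: le_trans (l2nmD _ _) _.
by apply: lerD; apply: opnormP.
Qed.

Lemma opnormZ_le c A : opnorm (c *: A) <= nm c * opnorm A.
Proof.
apply: opnorm_le => [|f]; first by rewrite mulr_ge0 ?nm_ge0 ?opnorm_ge0.
by rewrite bopZ l2nmZ -mulrA; apply: ler_wpM2l; [apply: nm_ge0|apply: opnormP].
Qed.

Lemma opnorm_eq0 A : opnorm A = 0 -> A = 0.
Proof.
move=> h; apply: bopP => f; rewrite bop0; apply/l2nm_eq0/eqP.
by rewrite eq_le l2nm_ge0 andbT; have := opnormP A f; rewrite h mul0r.
Qed.

Lemma opnormZ c A : opnorm (c *: A) = nm c * opnorm A.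
Proof.
apply/eqP; rewrite eq_le opnormZ_le /=.
have [->|c0] := eqVneq c 0; first by rewrite nm0 mul0r opnorm_ge0.
have : 0 < nm c by rewrite nm_gt0.
have := opnormZ_le c^-1 (c *: A); rewrite scalerA mulVf // scale1r nmV mulrC.
by move=> h p; move: h; rewrite ler_pdivlMr // mulrC.
Qed.

Definition bnorm A : C := real_complex R (opnorm A).

Fact bnormD A B : bnorm (A + B) <= bnorm A + bnorm B.
Proof. by rewrite /bnorm -rmorphD lecR opnormD. Qed.

Fact bnormZ (c : C) A : bnorm (c *: A) = `|c| * bnorm A.
Proof. by rewrite /bnorm opnormZ rmorphM normE. Qed.

Fact bnorm_eq0 A : bnorm A = 0 -> A = 0.
Proof. by move=> /complexI /opnorm_eq0. Qed.

HB.instance Definition _ := Lmodule_isNormed.Build C bop bnormD bnormZ bnorm_eq0.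

Lemma nm_bop A : nm A = opnorm A.
Proof. by []. Qed.

(** The adjoint provided by [adjointable] is a bare function; linearity and the bound follow from
    those of [A] by testing against all vectors. *)
Lemma adj_exists A : exists B : bop, adjoint_pair A B.
Proof.
have /asboolP [_ _ [S hS']] := valP A.
have hS : adjoint_pair A S := hS'.
have Sb g : l2nm (S g) <= opnorm A * l2nm g.
  have [g0|g0] := eqVneq (l2nm (S g)) 0; first by rewrite g0 mulr_ge0 ?opnorm_ge0 ?l2nm_ge0.
  have gp : 0 < l2nm (S g) by rewrite lt_neqAle eq_sym g0 l2nm_ge0.
  rewrite -(ler_pM2l gp) -expr2 l2nm_sqr -hS; apply: le_trans (cauchy_schwarz _ _) _.
  rewrite mulrA [l2nm _ * opnorm A]mulrC; apply: ler_wpM2r; [apply: l2nm_ge0|apply: opnormP].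
have uniq f g : (forall h, rip h f = rip h g) -> f = g.
  move=> h; apply/subr0_eq/rip_eq0; rewrite ripBr h subrr //.
have lS : lin S.
  move=> c f g; apply: uniq => h; rewrite -hS !ripDr -hS; congr (_ + _).
  have cc : c = Num.conj (Num.conj c) by rewrite conjCK.
  by rewrite {1 2}cc -!ripZ_conj -hS bop_linZ.
have Sin : S \in adjointable.
  apply/asboolP; split=> //; first by exists (opnorm A); split=> //; exact: opnorm_ge0.
  by exists A => f g; rewrite ripC -hS ripC.
by exists (Bop Sin) => f g; rewrite hS.
Qed.

Definition badj A : bop := sval (cid (adj_exists A)).

Lemma badjP A f g : rip (A f) g = rip f (badj A g).
Proof. exact: (svalP (cid (adj_exists A))). Qed.

Lemma badj_unique A B : adjoint_pair A B -> badj A = B.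
Proof.
move=> h; apply: bopP => g; apply/subr0_eq/rip_eq0.
by rewrite ripBr -badjP -h subrr.
Qed.

Fact badjK : involutive badj.
Proof. by move=> A; apply: badj_unique => f g; rewrite ripC -badjP ripC. Qed.

Fact badjD : {morph badj : A B / A + B}.
Proof.
by move=> A B; apply: badj_unique => f g; rewrite !bopD ripDl ripDr !badjP.
Qed.

Fact badjZ (c : C) A : badj (c *: A) = Num.conj c *: badj A.
Proof.
by apply: badj_unique => f g; rewrite !bopZ ripZ_conj badjP bop_linZ.
Qed.

Lemma bmul_in A B : (fun f => A (B f)) \in adjointable.
Proof.
apply/asboolP; split.
- by move=> c f g; rewrite !bop_lin.
- exists (opnorm A * opnorm B); split; first by rewrite mulr_ge0 ?opnorm_ge0.
  move=> f; apply: le_trans (opnormP _ _) _; rewrite -mulrA.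
  by apply: ler_wpM2l; [apply: opnorm_ge0|apply: opnormP].
- by exists (fun g => badj B (badj A g)) => f g; rewrite !badjP.
Qed.

Definition bmul A B : bop := Bop (bmul_in A B).

Fact bmulA : associative bmul.
Proof. by move=> A B D; apply: bopP. Qed.

Fact bmulDl : left_distributive bmul +%R.
Proof. by move=> A B D; apply: bopP. Qed.

Fact bmulDr : right_distributive bmul +%R.
Proof. by move=> A B D; apply: bopP => f; rewrite -[LHS]/(A (B f + D f)) bop_linD. Qed.

Fact bscaleAl (c : C) A B : c *: bmul A B = bmul (c *: A) B.
Proof. exact: bopP. Qed.

Fact bscaleAr (c : C) A B : c *: bmul A B = bmul A (c *: B).
Proof. by apply: bopP => f; rewrite -[RHS]/(A (c *: B f)) bop_linZ. Qed.

Fact badjM A B : badj (bmul A B) = bmul (badj B) (badj A).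
Proof. by apply: badj_unique => f g; rewrite /= !badjP. Qed.

Lemma opnormM A B : opnorm (bmul A B) <= opnorm A * opnorm B.
Proof.
apply: opnorm_le => [|f]; first by rewrite mulr_ge0 ?opnorm_ge0.
apply: le_trans (opnormP A (B f)) _; rewrite -mulrA.
by apply: ler_wpM2l; [apply: opnorm_ge0|apply: opnormP].
Qed.

Lemma opnorm_badj A : opnorm (badj A) = opnorm A.
Proof.
have le B : opnorm (badj B) <= opnorm B.
  apply: opnorm_le => [|g]; first exact: opnorm_ge0.
  have [g0|g0] := eqVneq (l2nm (badj B g)) 0; first by rewrite g0 mulr_ge0 ?opnorm_ge0 ?l2nm_ge0.
  have gp : 0 < l2nm (badj B g) by rewrite lt_neqAle eq_sym g0 l2nm_ge0.
  rewrite -(ler_pM2l gp) -expr2 l2nm_sqr -badjP; apply: le_trans (cauchy_schwarz _ _) _.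
  by rewrite mulrA [l2nm _ * opnorm B]mulrC; apply: ler_wpM2r; [apply: l2nm_ge0|apply: opnormP].
by apply/eqP; rewrite eq_le le -{1}(badjK A) le.
Qed.

Lemma opnorm_cstar A : opnorm (bmul (badj A) A) = opnorm A ^+ 2.
Proof.
apply/eqP; rewrite eq_le; apply/andP; split.
  by rewrite expr2 -{1}(opnorm_badj A) opnormM.
have h f : l2nm (A f) <= Num.sqrt (opnorm (bmul (badj A) A)) * l2nm f.
  apply: l2nm_le; first by rewrite mulr_ge0 ?sqrtr_ge0 ?l2nm_ge0.
  rewrite exprMn sqr_sqrtr ?opnorm_ge0 // badjP expr2.
  apply: le_trans (cauchy_schwarz _ _) _; rewrite mulrA mulrC.
  by apply: ler_wpM2r; [apply: l2nm_ge0|apply: (opnormP (bmul (badj A) A))].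
have := opnorm_le (sqrtr_ge0 _) h.
rewrite -(@ler_pXn2r _ 2) ?nnegrE ?opnorm_ge0 ?sqrtr_ge0 // sqr_sqrtr //.
exact: opnorm_ge0.
Qed.

(** The adjoints satisfy the same estimates, so they converge pointwise too; their limit is the
    adjoint that the limit operator must have. *)
Lemma bop_geometric_cvg (u : nat -> bop) M :
  (forall n, nm (u n.+1 - u n) <= M / 2 ^+ n) ->
  exists l : bop, forall n, nm (u n - l) <= 2 * M / 2 ^+ n.
Proof.
move=> hu.
have hp (n : nat) : 0 < (2 : R) ^+ n by rewrite exprn_gt0.
have M0 : 0 <= M by have := le_trans (nm_ge0 _) (hu 0%N); rewrite expr0 divr1.
have limit (v : nat -> bop) : (forall n, opnorm (v n.+1 - v n) <= M / 2 ^+ n) ->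
    exists T : H -> H, forall f n, l2nm (v n f - T f) <= 2 * (M * l2nm f) / 2 ^+ n.
  move=> hv.
  have /choice [T hT] : forall f, exists g, forall n, l2nm (v n f - g) <= 2 * (M * l2nm f) / 2 ^+ n.
    move=> f; apply: (@l2_geometric_cvg _ (fun n => v n f)) => n.
    rewrite -bopB; apply: le_trans (opnormP _ _) _; rewrite mulrAC.
    by apply: ler_wpM2r; [apply: l2nm_ge0|apply: hv].
  by exists T.
have [T hT] := limit u hu.
have [T' hT'] : exists T : H -> H,
    forall f n, l2nm (badj (u n) f - T f) <= 2 * (M * l2nm f) / 2 ^+ n.
  apply: (limit (fun n => badj (u n))) => n.
  have -> : badj (u n.+1) - badj (u n) = badj (u n.+1 - u n).
    by rewrite badjD -[- u n]scaleN1r badjZ rmorphN1 scaleN1r.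
  by rewrite opnorm_badj.
have small (a b : R) : 0 <= a -> (forall n : nat, b <= a / 2 ^+ n) -> b <= 0.
  move=> a0 h; apply/ler_addgt0Pr => e e0; rewrite add0r.
  by have [n hn'] := geometric_small a0 e0; apply: le_trans (h n) (ltW hn').
have hn_small (a : R) f : 0 <= a -> (forall n : nat, l2nm f <= a / 2 ^+ n) -> f = 0.
  move=> a0 h; apply/l2nm_eq0/eqP; rewrite eq_le l2nm_ge0 andbT.
  exact: small a0 h.
have T_in : T \in adjointable.
  apply/asboolP; split.
  - move=> c f g; apply/subr0_eq.
    apply: (hn_small (2 * (M * l2nm (c *: f + g)) + nm c * (2 * (M * l2nm f)) + 2 * (M * l2nm g))).
      by rewrite !addr_ge0 ?mulr_ge0 ?l2nm_ge0 ?nm_ge0.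
    move=> n.
    have -> : T (c *: f + g) - (c *: T f + T g) =
        c *: (u n f - T f) + (u n g - T g) - (u n (c *: f + g) - T (c *: f + g)).
      by rewrite bop_lin; linear_ring.
    apply: le_trans (l2nmD _ _) _; rewrite l2nmN.
    have h1 := l2nmD (c *: (u n f - T f)) (u n g - T g); rewrite l2nmZ in h1.
    have h2 : nm c * l2nm (u n f - T f) <= nm c * (2 * (M * l2nm f)) / 2 ^+ n.
      by rewrite -mulrA; apply: ler_wpM2l; [apply: nm_ge0|apply: hT].
    have h3 := hT g n; have h4 := hT (c *: f + g) n.
    by rewrite !mulrDl; lra.
  - exists (opnorm (u 0%N) + 2 * M); split.
      by rewrite addr_ge0 ?opnorm_ge0 ?mulr_ge0.
    move=> f; have := hT f 0%N; rewrite expr0 divr1 => h.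
    have := l2nmD (u 0%N f) (T f - u 0%N f); rewrite subrKC l2nmBC => h'.
    by have := opnormP (u 0%N) f; lra.
  - exists T' => f g; apply/subr0_eq/eqP; rewrite -normr_eq0 eq_le normr_ge0 andbT.
    apply: (small (2 * (M * l2nm f) * l2nm g + l2nm f * (2 * (M * l2nm g)))).
      by rewrite !addr_ge0 ?mulr_ge0 ?l2nm_ge0.
    move=> n.
    have -> : rip (T f) g - rip f (T' g) =
        - rip (u n f - T f) g + rip f (badj (u n) g - T' g).
      by rewrite ripBl ripBr badjP; ring.
    apply: le_trans (ler_normD _ _) _; rewrite normrN mulrDl; apply: lerD.
      apply: le_trans (rip_abs_le _ _) _; rewrite mulrAC.
      by apply: ler_wpM2r; [apply: l2nm_ge0|apply: hT].
    apply: le_trans (rip_abs_le _ _) _; rewrite -mulrA.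
    by apply: ler_wpM2l; [apply: l2nm_ge0|apply: hT'].
exists (Bop T_in) => n; rewrite nm_bop; apply: opnorm_le => [|f].
  by rewrite divr_ge0 ?mulr_ge0 // ltW.
by rewrite bopB /=; have := hT f n; rewrite mulrA mulrAC.
Qed.

HB.instance Definition _ := Uniform_isComplete.Build bop
  (complete_of_geometric bop_geometric_cvg).

Fact bnormM A B : `|bmul A B| <= `|A| * `|B|.
Proof. by rewrite !normE -rmorphM lecR !nm_bop opnormM. Qed.

Fact bnorm_cstar A : `|bmul (badj A) A| = `|A| ^+ 2.
Proof. by rewrite !normE -rmorphXn !nm_bop opnorm_cstar. Qed.

HB.instance Definition _ := CompleteNormedModule_isCStarAlgebra.Build R bop
  bmulA bmulDl bmulDr bscaleAl bscaleAr badjK badjD badjZ badjM bnormM bnorm_cstar.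


End BoundedOperators.

(** * Operators given by partial injections of the basis *)

Section PartialInjections.
Variable R : realType.
Let C := R[i].

Definition partial_inverses (g g' : nat -> option nat) :=
  forall m n, g m = Some n <-> g' n = Some m.

Definition transport (g' : nat -> option nat) (f : nat -> C) : nat -> C :=
  fun n => if g' n is Some m then f m else 0.

Variables (g g' : nat -> option nat).
Hypothesis gg : partial_inverses g g'.

(** The first [N] entries of the image are entries of [f] at distinct places, apart from zeros; the
    partial sum of [f] up to the largest of these places contains them all. *)
Lemma transport_partial_sum (f : nat -> C) N : exists K,
  series (dot (transport g' f) (transport g' f)) N <= series (dot f f) K.
Proof.
pose s := pmap g' (index_iota 0 N).
have us : uniq s.
  apply: (@pmap_uniq _ _ _ (fun m => odflt 0%N (g m))); last exact: iota_uniq.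
  by move=> n; case e: (g' n) => [m|//]; rewrite /= (gg m n).2.
exists (\max_(m <- s) m).+1; rewrite /series /=.
have -> : \sum_(0 <= n < N) dot (transport g' f) (transport g' f) n = \sum_(m <- s) dot f f m.
  rewrite big_pmap; apply: eq_bigr => n _; rewrite /dot /transport.
  by case: (g' n) => [m //|]; rewrite /= !mul0r addr0.
have -> : \sum_(m <- s) dot f f m =
    \sum_(m <- [seq m <- index_iota 0 (\max_(m <- s) m).+1 | m \in s]) dot f f m.
  apply: perm_big; apply: uniq_perm => // [|m]; first by rewrite filter_uniq ?iota_uniq.
  rewrite mem_filter mem_index_iota /= ltnS; apply/esym/andb_idr => ms.
  exact: (leq_bigmax_seq (F := id)).
rewrite big_filter big_mkcond; apply: ler_sum => m _.
by case: ifP => // _; exact: dot_ge0.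
Qed.

Lemma transport_in (f : l2 R) : transport g' f \in @square_summable R.
Proof.
apply/asboolP; exists (rip f f) => N.
have [K hK] := transport_partial_sum f N.
exact: le_trans hK (partial_le_rip f K).
Qed.

Definition ltransport (f : l2 R) : l2 R := L2 (transport_in f).

Lemma ltransport_rip f : rip (ltransport f) (ltransport f) <= rip f f.
Proof.
apply: rip_le => N; have [K hK] := transport_partial_sum f N.
exact: le_trans hK (partial_le_rip f K).
Qed.

Lemma ltransport_lin : lin ltransport.
Proof.
move=> c f h; apply: l2P => n.
rewrite l2D l2Z /= /transport; case: (g' n) => [m //|].
by rewrite mulr0 addr0.
Qed.

End PartialInjections.

Section PartialInjectionOperators.
Variables (R : realType) (g g' : nat -> option nat) (gg : partial_inverses g g').

Lemma partial_inverses_sym : partial_inverses g' g.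
Proof. by move=> m n; split=> /gg. Qed.

Let P := ltransport (R := R) gg.
Let P' := ltransport (R := R) partial_inverses_sym.

Lemma eq_rip (a b c d : l2 R) : (forall j, dot a b j = dot c d j) -> rip a b = rip c d.
Proof. by move=> h; rewrite /rip; congr (limn (series _)); apply/funext. Qed.

(* A partial injection is isometric on the vectors supported in its domain, and
   only the components of [f] and [h] in its domain and range contribute. *)
Lemma ltransport_adjoint : adjoint_pair P P'.
Proof.
have PD f h : P (f + h) = P f + P h.
  by have := ltransport_lin gg 1 f h; rewrite !scale1r.
have P'D f h : P' (f + h) = P' f + P' h.
  by have := ltransport_lin partial_inverses_sym 1 f h; rewrite !scale1r.
have PE f n : P f n = if g' n is Some m then f m else 0 by [].
have P'E f n : P' f n = if g n is Some m then f m else 0 by [].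
have PP'P f : P (P' (P f)) = P f.
  apply: l2P => n; rewrite !PE; case e: (g' n) => [m|//].
  by rewrite P'E ((gg m n).2 e) PE e.
have P'PP' f : P' (P (P' f)) = P' f.
  apply: l2P => n; rewrite !P'E; case e: (g n) => [m|//].
  by rewrite PE ((gg n m).1 e) P'E e.
have iso f : P' (P f) = f -> rip (P f) (P f) = rip f f.
  move=> e; apply/eqP; rewrite eq_le ltransport_rip /=.
  by rewrite -{1 2}e; apply: ltransport_rip.
have iso2 f h : P' (P f) = f -> P' (P h) = h -> rip (P f) (P h) = rip f h.
  move=> ef eh; have := iso (f + h); rewrite PD P'D ef eh => /(_ erefl).
  rewrite !ripDl !ripDr (iso f) // (iso h) // (ripC (P h)) (ripC h f).
  by move=> e; lra.
move=> f h.
have -> : rip (P f) h = rip (P (P' (P f))) (P (P' h)).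
  rewrite PP'P; apply: eq_rip => n; rewrite /dot !PE; case e: (g' n) => [m|].
    by rewrite P'E ((gg m n).2 e).
  by rewrite /= !mul0r.
rewrite iso2 ?PP'P ?P'PP' //; apply: eq_rip => n; rewrite /dot !P'E.
case e: (g n) => [m|]; last by rewrite /= !mulr0.
by rewrite PE ((gg n m).1 e).
Qed.

Lemma ltransport_adjointable : P \in @adjointable R.
Proof.
apply/asboolP; split; first exact: ltransport_lin.
  exists 1; split=> // f; rewrite mul1r; apply: l2nm_le; first exact: l2nm_ge0.
  by rewrite l2nm_sqr ltransport_rip.
by exists P'; exact: ltransport_adjoint.
Qed.

Definition pinj : bop R := Bop ltransport_adjointable.

Lemma pinjE (f : l2 R) n : pinj f n = if g' n is Some m then f m else 0.
Proof. by []. Qed.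

End PartialInjectionOperators.

Lemma pinj_adj (R : realType) (g g' : nat -> option nat) (gg : partial_inverses g g') :
  cadj (pinj R gg) = pinj R (partial_inverses_sym gg).
Proof. by apply: badj_unique; exact: ltransport_adjoint. Qed.

(** * The boundary representation *)

Section BoundaryPoints.
Variables (k : nat) (L : kgraph k).
Hypothesis L_fa : finitely_aligned L.
Implicit Types (l m n p q v : L) (x y z : set L).

(* Ultrafilters of paths; they play the role of boundary paths. *)
Record boundary x : Prop := Boundary {
  boundary_nonempty : x !=set0;
  boundary_initial : forall l m, initial l m -> x m -> x l;
  boundary_directed : forall l m, x l -> x m -> exists2 n, x n & initial l n /\ initial m n;
  boundary_maximal : forall l, x l \/ exists2 m, x m & ~ compatible l m
}.

Lemma compatible_sym l m : compatible l m -> compatible m l.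
Proof. by move=> [p h1 h2]; exists p. Qed.

Lemma compatible_initial l m n : initial m n -> compatible l n -> compatible l m.
Proof. by move=> mn [p lp np]; exists p => //; apply: initial_trans mn np. Qed.

Lemma boundary_r x l m : boundary x -> x l -> x m -> kg_r l = kg_r m.
Proof.
move=> bx xl xm; have [n _ [/initial_r -> /initial_r ->]] := boundary_directed bx xl xm.
by [].
Qed.

Lemma boundary_range x l : boundary x -> x l -> x (kg_r l).
Proof.
move=> bx xl; apply: boundary_initial bx _ _ _ xl; exists l; rewrite ?kg_sr //.
by rewrite kg_comp_id_l.
Qed.

Lemma boundary_source_r x l m : boundary x -> x (kg_s l) -> x m -> kg_s l = kg_r m.
Proof. by move=> bx xl xm; rewrite -(boundary_r bx xl xm) kg_rs. Qed.

Lemma boundary_common x (s : seq L) l : boundary x -> x l ->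
  (forall m, m \in s -> x m) -> exists2 n, x n & initial l n /\ forall m, m \in s -> initial m n.
Proof.
move=> bx xl; elim: s => [|a s IH] h; first by exists l => //; split=> //; exact: initial_refl.
have [m ms|n xn [ln hn]] := IH; first by apply: h; rewrite inE ms orbT.
have [p xp [ap np]] := boundary_directed bx (h a (mem_head _ _)) xn.
exists p => //; split=> [|m]; first exact: initial_trans np.
by rewrite inE => /orP[/eqP ->//|/hn mn]; exact: initial_trans np.
Qed.

(** Starting from [v], the current path is extended past the path with code [n] whenever the two are
    compatible. Each path is tested once: either it becomes a prefix, or it is incompatible with the
    stage at which it was met. *)
Lemma boundary_exists v : vertices v -> exists2 x, boundary x & x v.
Proof.
move=> vv.
pose step l m : L := xget l [set q | initial l q /\ initial m q].
pose rho := fix rho (n : nat) : L := if n is n'.+1 then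
  (if @choice.unpickle L n' is Some m then step (rho n') m else rho n') else v.
have stepI l m : initial l (step l m).
  by rewrite /step; case: xgetP => [q _ []|_] //; exact: initial_refl.
have rhoS (n : nat) : initial (rho n) (rho n.+1).
  by rewrite /=; case: (choice.unpickle n) => [m|]; [exact: stepI|exact: initial_refl].
have rhoM (i j : nat) : (i <= j)%N -> initial (rho i) (rho j).
  move=> /subnKC <-; elim: (j - i)%N => [|n IH]; first by rewrite addn0; exact: initial_refl.
  by rewrite addnS; exact: initial_trans IH (rhoS _).
exists [set m | exists i : nat, initial m (rho i)]; last by exists 0%N; exact: initial_refl.
split=> [|l m lm [n mn]|l m [i li] [j mj]|l].
- by exists v, 0%N; exact: initial_refl.
- by exists n; exact: initial_trans lm mn.
- exists (rho (maxn i j)); first by exists (maxn i j); exact: initial_refl.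
  by split; [apply: initial_trans li _|apply: initial_trans mj _]; apply: rhoM;
     rewrite ?leq_maxl ?leq_maxr.
- have [c|nc] := pselect (compatible l (rho (choice.pickle l))).
    left; exists (choice.pickle l).+1; rewrite /= choice.pickleK /step.
    by case: xgetP => [q _ []//|/= none]; case: c => p lp rp; case: (none p).
  by right; exists (rho (choice.pickle l)) => //; exists (choice.pickle l); exact: initial_refl.
Qed.

Definition prepend l x : set L := [set m | exists2 n, x n & kg_s l = kg_r n /\ initial m (kg_comp l n)].

Definition strip l x : set L := [set n | kg_s l = kg_r n /\ x (kg_comp l n)].

(** Maximality is where finite alignment enters. If no [l b] in [MCE(l, a)] has [b] in [x], each
    such [b] is incompatible with some member of [x]; there are finitely many, so a single [n] in
    [x] extends all these members, and [l n] is incompatible with [a]. *)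
Lemma prepend_boundary l x : boundary x -> x (kg_s l) -> boundary (prepend l x).
Proof.
move=> bx xl; have src := boundary_source_r bx xl.
split=> [|a b ab [n xn [ln bn]]|a b [n xn [ln an]] [m xm [lm bm]]|a].
- by exists l, (kg_s l) => //; rewrite kg_rs kg_comp_id_r; split=> //; exact: initial_refl.
- by exists n => //; split=> //; exact: initial_trans bn.
- have [p xp [np mp]] := boundary_directed bx xn xm.
  exists (kg_comp l p).
    by exists p => //; split; [exact: src|exact: initial_refl].
  by split; [apply: initial_trans an _|apply: initial_trans bm _]; apply: initial_compl.
- have [[b xb /= hb]|none] := pselect (exists2 b, x b & MCE l a (kg_comp l b) /\ kg_s l = kg_r b).
    left; have [hm lb] := hb; exists b => //; split=> //.
    by have [] := MCE_initial hm.
  have fin := L_fa l a.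
  have /choice [f hf] : forall q, exists m, MCE l a q ->
      x m /\ forall b, kg_s l = kg_r b -> q = kg_comp l b -> ~ compatible b m.
    move=> q; have [hq|] := pselect (MCE l a q); last by exists l.
    have [_ [b lb qb] _] := hq.
    have nb : ~ x b by move=> xb; apply: none; exists b => //; rewrite -qb.
    case: (boundary_maximal bx b) => [//|[m xm hm]]; exists m => _; split=> // c lc qc.
    by rewrite -(kg_compI lb lc) // -qb.
  right; have [|n xn [ln hn]] := @boundary_common x (map f (fset_set (MCE l a))) (kg_s l) bx xl.
    by move=> m /mapP [q]; rewrite in_fset_set // inE => hq ->; have [] := hf q hq.
  have sln := src n xn.
  exists (kg_comp l n); first by exists n => //; split=> //; exact: initial_refl.
  move=> [p ap lnp].
  have lp : initial l p := initial_trans (initial_comp sln) lnp.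
  have [q hq qp] := MCE_of_common lp ap.
  have [_ [b lb qb] _] := hq; have [_ hb] := hf q hq.
  apply: (hb b lb qb); apply: (@compatible_initial _ _ n).
    by apply: hn; apply/mapP; exists q => //; rewrite in_fset_set // inE.
  have [c nc pc] := lnp; rewrite kg_s_comp // in nc.
  have pE : p = kg_comp l (kg_comp n c) by rewrite pc kg_compA.
  exists (kg_comp n c); last by exists c.
  apply: (@initial_compr _ _ l) => //; first by rewrite kg_r_comp.
  by rewrite -qb -pE.
Qed.

Lemma strip_boundary l x : boundary x -> x l -> boundary (strip l x).
Proof.
move=> bx xl.
have ext m : x m -> exists2 b, kg_s l = kg_r b & x (kg_comp l b) /\ initial m (kg_comp l b).
  move=> xm; have [n xn [[b lb nb] mn]] := boundary_directed bx xl xm.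
  by exists b => //; rewrite -nb.
split=> [|a b ab [lb xb]|a b [la xa] [lb xb]|a].
- by exists (kg_s l); split; rewrite ?kg_rs // kg_comp_id_r.
- have ra := initial_r ab; split; first by rewrite ra.
  by apply: boundary_initial bx _ _ _ xb; apply: initial_compl => //; rewrite ra.
- have [n xn [an bn]] := boundary_directed bx xa xb.
  have [c lc [xc nc]] := ext n xn.
  exists c => //; split; apply: (@initial_compr _ _ l) => //; exact: initial_trans nc.
- have [la|nla] := pselect (kg_s l = kg_r a); last first.
    right; exists (kg_s l); first by split; rewrite ?kg_rs // kg_comp_id_r.
    by move=> [p /initial_r ap /initial_r]; rewrite kg_rs -ap => /nla.
  case: (boundary_maximal bx (kg_comp l a)) => [xa|[m xm hm]]; first by left.
  right; have [b lb [xb mb]] := ext m xm; exists b => //.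
  move=> [p ap bp]; apply: hm; exists (kg_comp l p).
    exact: initial_compl.
  by apply: initial_trans mb _; exact: initial_compl.
Qed.

Lemma prepend_mem l x : boundary x -> x (kg_s l) -> prepend l x l.
Proof.
move=> bx xl; exists (kg_s l) => //; rewrite kg_rs kg_comp_id_r.
by split=> //; exact: initial_refl.
Qed.

Lemma strip_mem l x : x l -> strip l x (kg_s l).
Proof. by move=> xl; split; rewrite ?kg_rs // kg_comp_id_r. Qed.

Lemma prependK l x : boundary x -> x (kg_s l) -> strip l (prepend l x) = x.
Proof.
move=> bx xl; apply/seteqP; split => [a [la [n xn [ln an]]]|a xa].
  by apply: boundary_initial bx _ _ _ xn; apply: initial_compr an.
have la := boundary_source_r bx xl xa.
by split=> //; exists a => //; split=> //; exact: initial_refl.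
Qed.

Lemma stripK l x : boundary x -> x l -> prepend l (strip l x) = x.
Proof.
move=> bx xl; apply/seteqP; split => [a [n [ln xn] [_ an]]|a xa].
  exact: boundary_initial bx _ _ an xn.
have [n xn [[b lb nb] an]] := boundary_directed bx xl xa.
by exists b; [split=> //; rewrite -nb|split=> //; rewrite -nb].
Qed.

Lemma strip_comp l m x : kg_s l = kg_r m -> strip (kg_comp l m) x = strip m (strip l x).
Proof.
move=> lm; apply/seteqP; split => [a [/= ma xa]|a [ma [la xa]]].
  rewrite kg_s_comp // in ma; rewrite /strip /=; split=> //.
  by split; rewrite ?kg_r_comp // kg_compA.
by split; rewrite ?kg_s_comp // -kg_compA.
Qed.

Lemma prepend_comp l m x : boundary x -> x (kg_s m) -> kg_s l = kg_r m ->
  prepend l (prepend m x) = prepend (kg_comp l m) x.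
Proof.
move=> bx xm lm.
have bm := prepend_boundary bx xm.
have ml : prepend m x (kg_s l) by rewrite lm; apply: boundary_range bm _; exact: prepend_mem.
have bl := prepend_boundary bm ml.
have xlm : x (kg_s (kg_comp l m)) by rewrite kg_s_comp.
have lmx : prepend l (prepend m x) (kg_comp l m).
  by exists m; [exact: prepend_mem|split=> //; exact: initial_refl].
by rewrite -(stripK bl lmx) strip_comp // (prependK bm ml) (prependK bx xm).
Qed.

(** Otherwise each [l] in [E] is incompatible with a member of [x]. A common extension in [x] of
    these finitely many members and [v] is incompatible with all of [E], against exhaustiveness.
    This is (CK4) at the level of points. *)
Lemma boundary_meets x v (E : seq L) : boundary x -> x v -> vertices v ->
  exhaustive v [set` E] -> exists2 l, l \in E & x l.
Proof.
move=> bx xv vv [_ ex]; apply: contrapT => none.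
have /choice [f hf] : forall l, exists m, l \in E -> x m /\ ~ compatible l m.
  move=> l; have [lE|] := pselect (l \in E); last by exists l.
  case: (boundary_maximal bx l) => [xl|[m xm hm]]; last by exists m.
  by case: none; exists l.
have [m /mapP [l lE ->]|n xn [vn hn]] := @boundary_common x (map f E) v bx xv.
  by have [] := hf l lE.
have [|l lE /compatibleP c] := ex n.
  by rewrite -(initial_r vn) vertices_rE.
have [_ h] := hf l lE; apply: h; apply: (@compatible_initial _ _ n).
  by apply: hn; apply/mapP; exists l.
exact: compatible_sym.
Qed.

End BoundaryPoints.

Section BoundaryRepresentation.
Variables (R : realType) (k : nat) (L : kgraph k).
Hypothesis L_fa : finitely_aligned L.
Variables (x0 : set L) (v0 : L).
Hypotheses (bx0 : boundary x0) (xv0 : x0 v0) (vv0 : vertices v0).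
Implicit Types (l a b mu nu v : L) (x y z : set L) (f : l2 R).

(* A countable set of boundary points, stable under adding and removing
   initial segments, serves as an orthonormal basis indexed by numbers. *)
Definition address (y : set L) : set (L * L) :=
  [set p | [/\ x0 p.2, kg_s p.1 = kg_s p.2 & y = prepend p.1 (strip p.2 x0)]].

Definition orbit_pt y : Prop := boundary y /\ address y !=set0.

Definition code y : nat := @choice.pickle (L * L)%type (xget (v0, v0) (address y)).

Definition pt (n : nat) : set L :=
  if @choice.unpickle (L * L)%type n is Some p then prepend p.1 (strip p.2 x0) else set0.

Lemma codeK y : orbit_pt y -> pt (code y) = y.
Proof.
move=> [_ [p hp]]; rewrite /pt /code choice.pickleK.
by case: xgetP => [q _ [_ _ <-]|/(_ p)].
Qed.

Lemma orbit_prepend l y : orbit_pt y -> y (kg_s l) -> orbit_pt (prepend l y).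
Proof.
move=> [byy [[a b] [/= xb ab yE]]] yl; split; first exact: prepend_boundary.
have bz := strip_boundary bx0 xb; have zb := strip_mem xb.
have za : strip b x0 (kg_s a) by rewrite ab.
have la : kg_s l = kg_r a.
  by apply: boundary_source_r byy yl _; rewrite yE; exact: prepend_mem.
exists (kg_comp l a, b); split=> //=; first by rewrite kg_s_comp.
by rewrite yE prepend_comp.
Qed.

(** Let [y] be [a] prepended to [strip b x0]. Inside [y], the paths [a] and [l] have a common
    extension [a c = l e]; so [strip l y] is [e] prepended to [strip (b c) x0]. *)
Lemma orbit_strip l y : orbit_pt y -> y l -> orbit_pt (strip l y).
Proof.
move=> [byy [[a b] [/= xb ab yE]]] yl; split; first exact: strip_boundary.
have bz := strip_boundary bx0 xb.
have za : strip b x0 (kg_s a) by rewrite ab; exact: strip_mem.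
have ya : y a by rewrite yE; exact: prepend_mem.
have [q yq [[c ac qc] [e le qe]]] := boundary_directed byy ya yl.
have zE : strip a y = strip b x0 by rewrite yE prependK.
have [bc xbc] : strip b x0 c by rewrite -zE; split=> //; rewrite -qc.
have ye : strip l y e by split=> //; rewrite -qe.
exists (e, kg_comp b c); split=> //=.
  by rewrite (kg_s_comp bc) -(kg_s_comp le) -qe qc kg_s_comp.
rewrite -(stripK (strip_boundary byy yl) ye); congr (prepend e _).
by rewrite strip_comp // -zE -!strip_comp // -qe qc.
Qed.

Lemma orbit_x0 : orbit_pt x0.
Proof.
split=> //; exists (v0, v0); split=> //=.
by rewrite stripK.
Qed.

(** A point can have several addresses and some numbers encode no point, so only the chosen code of
    each point counts; the operators vanish at the other basis vectors. *)
Definition canonical (n : nat) : Prop := orbit_pt (pt n) /\ code (pt n) = n.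

Lemma canonical_code y : orbit_pt y -> canonical (code y).
Proof. by move=> Oy; rewrite /canonical codeK. Qed.

Definition fwd l (n : nat) : option nat :=
  if `[< canonical n /\ pt n (kg_s l) >] then Some (code (prepend l (pt n))) else None.

Definition bwd l (n : nat) : option nat :=
  if `[< canonical n /\ pt n l >] then Some (code (strip l (pt n))) else None.

Lemma fwd_bwd l : partial_inverses (fwd l) (bwd l).
Proof.
move=> m n; rewrite /fwd /bwd; split.
  case: asboolP => [[[Om cm] ym] [<-]|//].
  have Oy := orbit_prepend Om ym; rewrite codeK //.
  case: asboolP => [_|[]]; first by rewrite prependK ?cm //; case: Om.
  by split; [exact: canonical_code|apply: prepend_mem => //; case: Om].
case: asboolP => [[[On cn] yn] [<-]|//].
have Oy := orbit_strip On yn; rewrite codeK //.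
case: asboolP => [_|[]]; first by rewrite stripK ?cn //; case: On.
by split; [exact: canonical_code|exact: strip_mem].
Qed.

Definition brep l : bop R := pinj R (fwd_bwd l).

Lemma brepE l f n : brep l f n =
  if `[< canonical n /\ pt n l >] then f (code (strip l (pt n))) else 0.
Proof. by rewrite /brep pinjE /bwd; case: asboolP. Qed.

Lemma brep_adjE l f n : cadj (brep l) f n =
  if `[< canonical n /\ pt n (kg_s l) >] then f (code (prepend l (pt n))) else 0.
Proof. by rewrite /brep pinj_adj pinjE /fwd; case: asboolP. Qed.

Lemma brep_code l f y : orbit_pt y ->
  brep l f (code y) = if `[< y l >] then f (code (strip l y)) else 0.
Proof.
move=> Oy; rewrite brepE codeK //; congr (if _ then _ else _).
by apply: asbool_equiv_eq; split=> [[]//|yl]; split=> //; exact: canonical_code.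
Qed.

Lemma brep_adj_code l f y : orbit_pt y ->
  cadj (brep l) f (code y) = if `[< y (kg_s l) >] then f (code (prepend l y)) else 0.
Proof.
move=> Oy; rewrite brep_adjE codeK //; congr (if _ then _ else _).
by apply: asbool_equiv_eq; split=> [[]//|yl]; split=> //; exact: canonical_code.
Qed.

Lemma brep_out l f n : ~ canonical n -> brep l f n = 0.
Proof. by move=> h; rewrite brepE; case: asboolP => // -[]. Qed.

Lemma brep_adj_out l f n : ~ canonical n -> cadj (brep l) f n = 0.
Proof. by move=> h; rewrite brep_adjE; case: asboolP => // -[]. Qed.

Lemma bop_eq (S T : bop R) :
  (forall f n, ~ canonical n -> S f n = T f n) ->
  (forall f y, orbit_pt y -> S f (code y) = T f (code y)) -> S = T.
Proof.
move=> h1 h2; apply: bopP => f; apply: l2P => n.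
have [[On cn]|] := pselect (canonical n); last exact: h1.
by rewrite -cn h2.
Qed.

Lemma bop_mulE (S T : bop R) f : (S ** T) f = S (T f).
Proof. by []. Qed.

Lemma strip_vertex v y : boundary y -> vertices v -> y v -> strip v y = y.
Proof.
move=> byy vv yv; apply/seteqP; split => [a [va]|a ya].
  by rewrite -(vertices_sE vv) va kg_comp_id_l.
have va : kg_s v = kg_r a by rewrite (vertices_sE vv) -(vertices_rE vv); exact: boundary_r ya.
by split=> //; rewrite -(vertices_sE vv) va kg_comp_id_l.
Qed.

Lemma brep_vertex_code v f y : vertices v -> orbit_pt y ->
  brep v f (code y) = if `[< y v >] then f (code y) else 0.
Proof.
move=> vv Oy; rewrite brep_code //; case: asboolP => // yv.
by rewrite strip_vertex //; case: Oy.
Qed.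

Lemma brep_range_code l f y : orbit_pt y ->
  (brep l ** cadj (brep l)) f (code y) = if `[< y l >] then f (code y) else 0.
Proof.
move=> Oy; rewrite bop_mulE brep_code //; case: asboolP => // yl.
rewrite brep_adj_code; last exact: orbit_strip.
case: asboolP => [_|[]]; last exact: strip_mem.
by rewrite stripK //; case: Oy.
Qed.

Lemma brep_out_mul l (T : bop R) f n : ~ canonical n -> (brep l ** T) f n = 0.
Proof. by move=> h; rewrite bop_mulE brep_out. Qed.

(** At a point [y], the left side is non-zero only if [nu] lies in [mu y]. Then [mu y] contains
    exactly one element of [MCE(mu, nu)], so a single term of the sum survives, and it moves [y] to
    the same point. *)
Lemma brep_ck3 mu nu : cadj (brep mu) ** brep nu =
  \sum_(p \in MCE_pairs mu nu) brep p.1 ** cadj (brep p.2).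
Proof.
have fin := finite_MCE_pairs L_fa mu nu.
rewrite fsbig_finite //=; set s := fset_set _.
have sumE f n : (\sum_(p <- s) brep p.1 ** cadj (brep p.2)) f n =
    \sum_(p <- s) (brep p.1 ** cadj (brep p.2)) f n.
  by elim/big_ind2: _ => [//|S a T b <- <-|//].
apply: bop_eq => [f n hn|f y Oy].
  rewrite sumE big1 // => [|p _]; last exact: brep_out_mul.
  by rewrite bop_mulE brep_adj_out.
rewrite sumE bop_mulE brep_adj_code //.
have byy : boundary y by case: Oy.
have in_s p : p \in s -> MCE_pairs mu nu p by rewrite in_fset_set // inE.
have term p : p \in s -> (brep p.1 ** cadj (brep p.2)) f (code y) =
    if `[< y p.1 >] then f (code (prepend p.2 (strip p.1 y))) else 0.
  move=> /in_s [m1 m2 e _].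
  have ss : kg_s p.1 = kg_s p.2 by rewrite -(kg_s_comp m1) e kg_s_comp.
  rewrite bop_mulE brep_code //; case: asboolP => // yp.
  rewrite brep_adj_code; last exact: orbit_strip.
  by case: asboolP => // -[]; rewrite -ss; exact: strip_mem.
rewrite big_seq (eq_bigr _ term) -big_seq {term}.
have no p : p \in s -> y p.1 -> y (kg_s mu) /\ prepend mu y nu.
  move=> /in_s [m1 m2 e _] yp.
  have ymu : y (kg_s mu) by rewrite m1; exact: boundary_range byy yp.
  split=> //; exists p.1 => //; split=> //; rewrite e; exact: initial_comp.
case: asboolP => [ymu|nmu]; last first.
  by rewrite big_seq big1 // => p ps; case: asboolP => // /(no p ps) [].
have Oz := orbit_prepend Oy ymu; have bz : boundary (prepend mu y) by case: Oz.
rewrite brep_code //; case: asboolP => [znu|nnu]; last first.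
  by rewrite big_seq big1 // => p ps; case: asboolP => // /(no p ps) [].
have zmu := prepend_mem byy ymu.
have [q zq [h1 h2]] := boundary_directed bz zmu znu.
have [r hr rq] := MCE_of_common h1 h2.
have zr : prepend mu y r := boundary_initial bz rq zq.
have [dr [a ma ra] [b nb rb]] := hr.
have abs : (a, b) \in s.
  by rewrite in_fset_set // inE; split=> //=; rewrite -?ra -?rb.
have ya : y a by rewrite -(prependK byy ymu); split=> //; rewrite -ra.
rewrite (big_rem _ abs) /= [X in _ + X]big_seq big1 => [|p ps].
  rewrite addr0; case: asboolP => // _; congr (f (code _)).
  have sab : kg_s a = kg_s b by rewrite -(kg_s_comp ma) -ra rb kg_s_comp.
  have bw := strip_boundary byy ya; have wa := strip_mem ya.
  have znb : strip nu (prepend mu y) b by split=> //; rewrite -rb.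
  rewrite -(stripK (strip_boundary bz znu) znb); congr (prepend b _).
  by rewrite -strip_comp // -rb ra strip_comp // prependK.
(* Another surviving term would put a second element of [MCE(mu, nu)] in the same boundary point;
   being of equal degree and prefixes of a common path, the two coincide. *)
case: asboolP => // yp; move: ps; rewrite rem_filter ?fset_uniq // mem_filter.
move=> /andP[ne ps]; case/eqP: ne; have [m1 m2 e [dp _ _]] := in_s _ ps.
have zp : prepend mu y (kg_comp mu p.1) by exists p.1 => //; split=> //; exact: initial_refl.
have [w zw [rw pw]] := boundary_directed bz zr zp.
have er : r = kg_comp mu p.1.
  have i1 : initial r (kg_comp mu p.1) by apply: (initial_le rw pw) => i; rewrite dr dp.
  have i2 : initial (kg_comp mu p.1) r by apply: (initial_le pw rw) => i; rewrite dr dp.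
  exact: initial_antisym i1 i2.
case: p m1 m2 e {dp ps yp zp pw} er => c d /= m1 m2 e er.
have -> : c = a by apply: (kg_compI m1 ma); rewrite -er.
by have -> : d = b by apply: (kg_compI m2 nb); rewrite -e -er.
Qed.

Lemma brep_CK : CK_family brep.
Proof.
split=> [v vv|v w vv ww vw|mu nu mn|mu nu|v E vv ex].
- have ss : brep v ** brep v = brep v.
    apply: bop_eq => [f n hn|f y Oy]; first by rewrite brep_out_mul ?brep_out.
    by rewrite bop_mulE !brep_vertex_code //; case: asboolP.
  split=> //; apply: bop_eq => [f n hn|f y Oy]; first by rewrite brep_adj_out ?brep_out.
  rewrite brep_adj_code // brep_vertex_code // (vertices_sE vv).
  case: asboolP => // yv; have byy : boundary y by case: Oy.
  by rewrite -{1}(strip_vertex byy vv yv) stripK.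
- apply: bop_eq => [f n hn|f y Oy]; first by rewrite brep_out_mul.
  rewrite bop_mulE !brep_vertex_code //; case: asboolP => // yv; case: asboolP => // yw.
  have byy : boundary y by case: Oy.
  by case: vw; rewrite -(vertices_rE vv) -(vertices_rE ww); exact: boundary_r yv yw.
- apply: bop_eq => [f n hn|f y Oy]; first by rewrite brep_out_mul ?brep_out.
  have byy : boundary y by case: Oy.
  rewrite bop_mulE (brep_code mu _ Oy) (brep_code (kg_comp mu nu) _ Oy) strip_comp //.
  have memE : y (kg_comp mu nu) <-> y mu /\ strip mu y nu.
    by split=> [yc|[_ []//]]; split=> //; exact: boundary_initial (initial_comp mn) yc.
  case: (asboolP (y mu)) => [ym|nm]; last first.
    by case: (asboolP (y _)) => // /memE [].
  rewrite brep_code; last exact: orbit_strip.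
  by congr (if _ then _ else _); apply: asbool_equiv_eq; split=> [yn|/memE []//]; apply/memE.
- exact: brep_ck3.
(* The product of gaps is diagonal: it keeps exactly the points that contain [v] and avoid every
   path of [r]. By [boundary_meets] no point survives for exhaustive [E]. *)
- have diag (r : seq L) f y : orbit_pt y ->
      (\big[@cmul R (bop R)/brep v]_(l <- r) (brep v - brep l ** cadj (brep l))) f (code y) =
      if `[< y v /\ forall l, l \in r -> ~ y l >] then f (code y) else 0.
    move=> Oy; elim: r => [|l r IH].
      rewrite big_nil brep_vertex_code //; congr (if _ then _ else _).
      by apply: asbool_equiv_eq; split=> [yv|[]].
    rewrite big_cons bop_mulE bopB l2B brep_vertex_code // brep_range_code // IH.
    case: (asboolP (y l)) => [yl|nl].
      case: (asboolP (y v /\ forall m, m \in r -> ~ y m)) => [[yv' _]|_]; last first.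
        rewrite !if_same subrr; case: asboolP => // -[_ /(_ l (mem_head _ _))].
        by move=> /(_ yl).
      case: asboolP => // _; rewrite subrr; case: asboolP => // -[_ /(_ l (mem_head _ _))].
      by move=> /(_ yl).
    rewrite subr0; case: (asboolP (y v)) => [yv|nv]; last by case: asboolP => // -[].
    congr (if _ then _ else _); apply: asbool_equiv_eq; split=> -[_ h]; split=> // m.
      by rewrite inE => /orP[/eqP ->|/h].
    by move=> mr; apply: h; rewrite inE mr orbT.
  have diag_out (r : seq L) f n : ~ canonical n ->
      (\big[@cmul R (bop R)/brep v]_(l <- r) (brep v - brep l ** cadj (brep l))) f n = 0.
    move=> hn; case: r => [|l r]; first by rewrite big_nil brep_out.
    by rewrite big_cons bop_mulE bopB l2B brep_out // brep_out_mul // subrr.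
  apply: bop_eq => [f n hn|f y Oy]; first by rewrite diag_out.
  rewrite diag //; case: asboolP => // -[yv h]; have byy : boundary y by case: Oy.
  by have [l lE yl] := boundary_meets byy yv vv ex; case: (h l lE).
Qed.

Lemma brep_neq0 : brep v0 <> 0.
Proof.
have cx := canonical_code orbit_x0.
pose e : nat -> R[i] := fun n => (n == code x0)%:R.
have e_in : e \in @square_summable R.
  apply/asboolP; exists 1 => n; rewrite /series /=.
  apply: (@le_trans _ _ (\sum_(0 <= j < n) (if j == code x0 then 1 else 0))).
    apply: ler_sum => j _; rewrite /dot /e; case: eqP => _ /=.
      by rewrite mulr1 mulr0 addr0.
    by rewrite !mulr0 addr0.
  rewrite -big_mkcond big_const_seq count_uniq_mem ?iota_uniq //.
  by case: (_ \in _); rewrite //= addr0.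
move=> h; have := congr1 (fun T : bop R => T (L2 e_in) (code x0)) h.
rewrite (brep_vertex_code (L2 e_in) vv0 orbit_x0) /=; case: asboolP => // _.
by rewrite /e eqxx => /eqP; rewrite oner_eq0.
Qed.

End BoundaryRepresentation.

Lemma vertex_projection_neq0 (R : realType) (k : nat) (L : kgraph k) (A : cstarAlgType R)
  (s : L -> A) (v : L) : finitely_aligned L -> is_graph_cstar_algebra s ->
  vertices v -> s v <> 0.
Proof.
move=> fa [_ _ univ] vv sv.
have [x bx xv] := boundary_exists vv.
have [f _ fs] := univ _ _ (brep_CK R fa v bx).
by apply: (@brep_neq0 R k L fa x v bx xv vv); rewrite -fs sv raddf0.
Qed.

Theorem theorem3p4 (R : realType) (k : nat) (k_ge1 : (1 <= k)%N)
    (L : kgraph k) (L_fa : finitely_aligned L)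
    (A : cstarAlgType R) (s : L -> A) (A_univ : is_graph_cstar_algebra s) :
  AF A -> ~ (exists mu nu : L, generalised_cycle mu nu).
Proof.
move=> af [mu [nu gc]]; apply: (AF_no_generalised_cycle L_fa A_univ af) gc.
exact: vertex_projection_neq0 (vertices_s _).
Qed.
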